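(* Let $p$ be prime, $D\geq 2$ and $1\leq j\leq D-1$, and let $(\varphi_X,\varphi_Z)$ be a translation-invariant topological CSS code over $R=\mathbb{Z}_p[\mathbb{Z}^D]$ with $\operatorname{Ext}_R^\ell(\overline{\operatorname{coker}\varphi_X},R)=0$ for all $\ell>0$, $\ell\ne j$. Set $E:=\operatorname{Ext}_R^j(\overline{\operatorname{coker}\varphi_X},R)$ and $$\Lambda_E:=\{\mathbf v\in\mathbb Z^D: x^{\mathbf v}e=e\ \text{for all } e\in E\},$$ and suppose that $Q:=\dim_{\mathbb{Z}_p}E<\infty$. Let $\Lambda\subseteq\mathbb{Z}^D$ be a finite-index subgroup. Then, after coarse-graining to $\Lambda$ (viewing the code over $R_\Lambda=\mathbb Z_p[\Lambda]$), the code is equivalent to $Q$ decoupled copies of the degree-$j$ toric code $\mathrm{TC}_j^{(D)}(\mathbb{Z}_p)$ via a $\Lambda$-invariant Clifford circuit and product-state ancillas, i.e. $\varphi_X\sim_{R_\Lambda,\mathrm{Cl},\mathrm{st}}\bigl(\varphi_X^{\mathrm{TC}}\bigr)^{\oplus Q}$, if and only if $\Lambda\subseteq\Lambda_E$.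
   Context: $R=\mathbb Z_p[\mathbb Z^D]=\mathbb Z_p[x_1^{\pm1},\dots,x_D^{\pm1}]$ with $\mathbb Z_p$-linear involution $\overline{x^{\mathbf v}}=x^{-\mathbf v}$. For an $R$-module $M$, $\overline M$ is the same abelian group with action $r\ast m=\overline r\,m$. For a matrix $\varphi$ over $R$, $\varphi^\dagger:=\overline{\varphi}^{\mathsf T}$. A translation-invariant CSS code over $R$ is a pair of matrices $\varphi_X\in M_{q\times a}(R)$, $\varphi_Z\in M_{q\times b}(R)$ with $\varphi_X^\dagger\varphi_Z=0$; it is topological if $\operatorname{im}\varphi_X=\ker\varphi_Z^\dagger$ and $\operatorname{im}\varphi_Z=\ker\varphi_X^\dagger$. Coarse graining: for a finite-index subgroup $\Lambda\subseteq\mathbb Z^D$, $R$ is free of rank $[\mathbb Z^D:\Lambda]$ over $R_\Lambda=\mathbb Z_p[\Lambda]$ with basis $x^{\mathbf u}$, $\mathbf u$ running over coset representatives; in these bases an $R$-matrix becomes an $R_\Lambda$-matrix (restriction of scalars). Toric code: for a sequence $\mathbf f=(f_1,\dots,f_D)$ in a commutative ring $A$, the Koszul complex has $K_i(\mathbf f)=\bigwedge^iA^D$ and $\partial_i(e_{a_1}\wedge\cdots\wedge e_{a_i})=\sum_{k}(-1)^{k-1}f_{a_k}e_{a_1}\wedge\cdots\widehat{e_{a_k}}\cdots\wedge e_{a_i}$. The degree-$j$ toric code over $R_\Lambda$ has $\varphi^{\mathrm{TC}}_X=\partial_j^\dagger$, $\varphi^{\mathrm{TC}}_Z=\partial_{j+1}$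 for the Koszul complex over $A=R_\Lambda$ of $(y_1-1,\dots,y_D-1)$, where $y_1,\dots,y_D$ are the monomials of a $\mathbb Z$-basis of $\Lambda$. For $A=R_\Lambda$: $\operatorname{E}_q(A)\subseteq\operatorname{GL}_q(A)$ is the subgroup generated by $I+rE_{i,k}$, $r\in A$, $i\ne k$. $\varphi\sim_{A,\mathrm{Cl}}\varphi'$ (same size $q\times a$) means $W\varphi\Phi=\varphi'$ for some $W\in\operatorname{E}_q(A)$, $\Phi\in\operatorname{GL}_a(A)$. $\varphi\sim_{A,\mathrm{Cl},\mathrm{st}}\varphi'$ means $\varphi\oplus I_\alpha\oplus 0_{\beta,\eta}\sim_{A,\mathrm{Cl}}\varphi'\oplus I_{\alpha'}\oplus0_{\beta',\eta'}$ for some integers $\alpha,\beta,\eta,\alpha',\beta',\eta'\ge0$ ($0_{\beta,\eta}$ the $\beta\times\eta$ zero matrix). This is the algebraic formulation of equivalence by a $\Lambda$-invariant Clifford circuit with product-state ancillas. *)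

(* Defs.v *)
From HB Require Import structures.
From mathcomp Require Import all_boot all_order all_algebra.
From mathcomp Require Import generic_quotient ring_quotient finmap monalg.
From mathcomp Require Import boolp functions.

Set Implicit Arguments.
Unset Strict Implicit.
Unset Printing Implicit Defensive.

Import GRing.Theory.
Local Open Scope quotient_scope.
Local Open Scope fset_scope.
Local Open Scope ring_scope.

(* monalg makes {malg k[K]} a ring only for monoids K without nontrivial
   invertible elements, so the convolution product is supplied here for an
   abelian group G. *)
Definition galg (k : comNzRingType) (G : zmodType) : Type := {malg k[G]}.

HB.instance Definition _ (k : comNzRingType) (G : zmodType) :=
  GRing.Lmodule.copy (galg k G) {malg k[G]}.

Section GroupAlgebra.
Context (k : comNzRingType) (G : zmodType).
Implicit Types (r s t : galg k G) (v w : G) (c : k).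

Definition gmonom c v : galg k G := << c *g v >>.

Definition galg_one : galg k G := gmonom 1 0.

Definition galg_mul r s : galg k G :=
  \sum_(v <- msupp r) \sum_(w <- msupp s) gmonom (r@_v * s@_w) (v + w).

Lemma galg_mulw (d1 d2 : {fset G}) r s :
  msupp r `<=` d1 -> msupp s `<=` d2 ->
  galg_mul r s = \sum_(v <- d1) \sum_(w <- d2) gmonom (r@_v * s@_w) (v + w).
Proof.
move=> le1 le2; rewrite /galg_mul (big_fset_incl _ le1) /=.
  apply/eq_bigr => v _; apply/big_fset_incl => // w _ /mcoeff_outdom ->.
  by rewrite mulr0 /gmonom monalgU0.
move=> v _ /mcoeff_outdom rv.
by rewrite big1 => // w _; rewrite rv mul0r /gmonom monalgU0.
Qed.

Lemma galg_mulC : commutative galg_mul.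
Proof.
move=> r s; rewrite /galg_mul exchange_big /=; apply: eq_bigr => v _.
by apply: eq_bigr => w _; rewrite mulrC addrC.
Qed.

Lemma galg_mulDl : left_distributive galg_mul +%R.
Proof.
move=> r s t.
set d := msupp r `|` msupp s.
rewrite (@galg_mulw d (msupp t) r t) ?fsubsetUl //.
rewrite (@galg_mulw d (msupp t) s t) ?fsubsetUr //.
rewrite (@galg_mulw d (msupp t)) ?msuppD_le //.
rewrite -big_split /=; apply/eq_bigr => v _.
rewrite -big_split /=; apply/eq_bigr => w _.
by rewrite mcoeffD mulrDl /gmonom monalgUD.
Qed.

Lemma galg_mulDr : right_distributive galg_mul +%R.
Proof. by move=> r s t; rewrite ![galg_mul r _]galg_mulC galg_mulDl. Qed.

Lemma galg_mul0l r : galg_mul 0 r = 0.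
Proof. by rewrite /galg_mul msupp0 big_seq_fset0. Qed.

Lemma galg_mul0r r : galg_mul r 0 = 0.
Proof. by rewrite galg_mulC galg_mul0l. Qed.

Lemma galg_mulUU c d v w :
  galg_mul (gmonom c v) (gmonom d w) = gmonom (c * d) (v + w).
Proof.
rewrite (@galg_mulw [fset v] [fset w]) ?msuppU_le //.
by rewrite !big_seq_fset1 !mcoeffUU.
Qed.

Lemma galg_sumE r : r = \sum_(v <- msupp r) gmonom r@_v v.
Proof. exact: monalgE. Qed.

Lemma galg_mulA : associative galg_mul.
Proof.
have sl I (l : seq I) F s :
    galg_mul (\sum_(i <- l) F i) s = \sum_(i <- l) galg_mul (F i) s.
  exact: (big_morph (galg_mul^~ s) (fun _ _ => galg_mulDl _ _ _) (galg_mul0l s)).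
have sr I (l : seq I) F s :
    galg_mul s (\sum_(i <- l) F i) = \sum_(i <- l) galg_mul s (F i).
  exact: (big_morph (galg_mul s) (fun _ _ => galg_mulDr _ _ _) (galg_mul0r s)).
move: galg_mulUU sl sr; move: galg_mul => m mUU sl sr r s t.
rewrite (galg_sumE r) (galg_sumE s) (galg_sumE t) !sl; apply: eq_bigr => u _.
rewrite !(sr _ (msupp s)) sl; apply: eq_bigr => v _.
rewrite !sr; apply: eq_bigr => w _.
by rewrite !mUU mulrA addrA.
Qed.

Lemma galg_mul1l : left_id galg_one galg_mul.
Proof.
move=> r; rewrite [in RHS](galg_sumE r) (@galg_mulw [fset 0] (msupp r)) ?msuppU_le //.
rewrite big_seq_fset1; apply: eq_bigr => v _.
by rewrite mcoeffUU mul1r add0r.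
Qed.

Lemma galg_one_neq0 : galg_one != 0.
Proof. by rewrite /galg_one /gmonom monalgU_eq0 oner_eq0. Qed.

HB.instance Definition _ := GRing.Zmodule_isComNzRing.Build (galg k G)
  galg_mulA galg_mulC galg_mul1l galg_mulDl galg_one_neq0.

Lemma gmonomM c d v w : gmonom c v * gmonom d w = gmonom (c * d) (v + w).
Proof. exact: galg_mulUU. Qed.

Definition gbar r : galg k G := \sum_(v <- msupp r) gmonom r@_v (- v).

Lemma gbarw (d : {fset G}) r : msupp r `<=` d ->
  gbar r = \sum_(v <- d) gmonom r@_v (- v).
Proof.
move=> le; rewrite /gbar; apply/big_fset_incl => // v _ /mcoeff_outdom ->.
by rewrite /gmonom monalgU0.
Qed.

Lemma gbarU c v : gbar (gmonom c v) = gmonom c (- v).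
Proof. by rewrite (@gbarw [fset v]) ?msuppU_le // big_seq_fset1 mcoeffUU. Qed.

Lemma gbar_is_zmod_morphism : zmod_morphism gbar.
Proof.
move=> r s.
set d := msupp r `|` msupp s.
rewrite (@gbarw d r) ?fsubsetUl // (@gbarw d s) ?fsubsetUr //.
rewrite (@gbarw d) ?msuppB_le //.
rewrite -sumrB; apply: eq_bigr => v _.
by rewrite mcoeffB /gmonom monalgUB.
Qed.

HB.instance Definition _ := GRing.isZmodMorphism.Build (galg k G) (galg k G)
  gbar gbar_is_zmod_morphism.

Lemma gbar_is_monoid_morphism : monoid_morphism gbar.
Proof.
split; first by rewrite gbarU oppr0.
move=> r s; rewrite (galg_sumE r) (galg_sumE s) mulr_suml !(raddf_sum gbar).
rewrite mulr_suml; apply: eq_bigr => v _.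
rewrite !mulr_sumr !(raddf_sum gbar); apply: eq_bigr => w _ /=.
by rewrite gmonomM !gbarU gmonomM opprD.
Qed.

HB.instance Definition _ := GRing.isMonoidMorphism.Build (galg k G) (galg k G)
  gbar gbar_is_monoid_morphism.

Lemma gbarK : involutive gbar.
Proof.
move=> r; rewrite [in RHS](galg_sumE r) {2}/gbar raddf_sum; apply: eq_bigr => v _.
by rewrite /= gbarU opprK.
Qed.

Definition dagger m n (phi : 'M[galg k G]_(m, n)) : 'M[galg k G]_(n, m) :=
  (map_mx gbar phi)^T.

End GroupAlgebra.

Arguments gmonom {k G} c v.

Section Quotient.
Context (R : nzRingType) (V : lmodType R) (S : submodClosed V).

Definition quot_pred : {pred V} := mem S.

Lemma quot_pred_zmod : zmod_closed quot_pred.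
Proof.
split=> [|x y]; first exact: (rpred0 S).
move=> xS yS; suff: x + (-1) *: y \in S by rewrite scaleN1r.
by rewrite rpredD // rpredZ.
Qed.

HB.instance Definition _ := GRing.isZmodClosed.Build V quot_pred quot_pred_zmod.

Definition quotmod : Type := Quotient.quot quot_pred.

HB.instance Definition _ := GRing.Zmodule.on quotmod.

Definition qproj (x : V) : quotmod := \pi_(Quotient.quot quot_pred) x.
Definition qscale (a : R) (x : quotmod) : quotmod :=
  qproj (a *: repr (x : Quotient.quot quot_pred)).

Lemma qprojP x y : reflect (qproj x = qproj y) (x - y \in S).
Proof.
apply: (iffP idP) => h.
  by apply/eqP; rewrite /qproj -Quotient.idealrBE.
by move/eqP: h; rewrite /qproj -Quotient.idealrBE.
Qed.

Lemma qproj_is_zmod_morphism : zmod_morphism qproj.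
Proof. by move=> x y; rewrite /qproj raddfB. Qed.

HB.instance Definition _ := GRing.isZmodMorphism.Build V quotmod
  qproj qproj_is_zmod_morphism.

Lemma qproj_repr (x : quotmod) : qproj (repr (x : Quotient.quot quot_pred)) = x.
Proof. exact: reprK. Qed.

Lemma qproj_surj (x : quotmod) : exists y, x = qproj y.
Proof. by exists (repr (x : Quotient.quot quot_pred)); rewrite qproj_repr. Qed.

Lemma qscaleE a x : qscale a (qproj x) = qproj (a *: x).
Proof.
apply/qprojP; rewrite -scalerBr rpredZ //; apply/qprojP.
by rewrite qproj_repr.
Qed.

Lemma qscaleA a b x : qscale a (qscale b x) = qscale (a * b) x.
Proof. by have [y ->] := qproj_surj x; rewrite !qscaleE scalerA. Qed.

Lemma qscale1 : left_id 1 qscale.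
Proof. by move=> x; have [y ->] := qproj_surj x; rewrite qscaleE scale1r. Qed.

Lemma qscaleDr : right_distributive qscale +%R.
Proof.
move=> a x y; have [x' ->] := qproj_surj x; have [y' ->] := qproj_surj y.
by rewrite -raddfD !qscaleE scalerDr raddfD.
Qed.

Lemma qscaleDl x : {morph qscale^~ x : a b / a + b}.
Proof.
by move=> a b; have [y ->] := qproj_surj x; rewrite !qscaleE scalerDl raddfD.
Qed.

HB.instance Definition _ := GRing.Zmodule_isLmodule.Build R quotmod
  qscaleA qscale1 qscaleDr qscaleDl.

Lemma qproj_is_scalable : scalable qproj.
Proof. by move=> a x; rewrite -qscaleE. Qed.

HB.instance Definition _ := GRing.isScalable.Build R V quotmod *:%R
  qproj qproj_is_scalable.

End Quotient.

Section KernelCokernel.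
Context (R : nzRingType) (U V : lmodType R) (f : {linear U -> V}).

Definition ker_pred : {pred U} := [pred x | f x == 0].

Lemma ker_pred_closed : submod_closed ker_pred.
Proof.
split=> [|a x y]; rewrite !inE ?raddf0 // => /eqP fx /eqP fy.
by rewrite linearP fx fy scaler0 addr0.
Qed.

HB.instance Definition _ := GRing.isSubmodClosed.Build R U ker_pred ker_pred_closed.
HB.instance Definition _ := GRing.isZmodClosed.Build U ker_pred
  (GRing.submod_closedB ker_pred_closed).

Definition kermod := {x : U | x \in ker_pred}.

HB.instance Definition _ := SubChoice.on kermod.
HB.instance Definition _ := [SubChoice_isSubLmodule of kermod by <:].

Definition im_pred : {pred V} := [pred y | `[< exists x, y = f x >]].

Lemma im_pred_closed : submod_closed im_pred.
Proof.
split=> [|a _ _ /asboolP[x ->] /asboolP[y ->]]; apply/asboolP.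
  by exists 0; rewrite raddf0.
by exists (a *: x + y); rewrite linearP.
Qed.

HB.instance Definition _ := GRing.isSubmodClosed.Build R V im_pred im_pred_closed.

Definition cokermod := quotmod im_pred.

HB.instance Definition _ := GRing.Lmodule.on cokermod.

End KernelCokernel.

Section Hom.
Context (R : comNzRingType) (P N : lmodType R).

Definition linhom_pred : {pred P -> N} := [pred f | `[< linear f >]].

Lemma linhom_pred_closed : submod_closed linhom_pred.
Proof.
split=> [|a f g /asboolP lf /asboolP lg]; apply/asboolP => b x y /=.
  by rewrite scaler0 addr0.
have E z : (a *: f + g) z = a *: f z + g z by [].
by rewrite !E lf lg !scalerDr !scalerA (mulrC b) addrACA.
Qed.

HB.instance Definition _ := GRing.isSubmodClosed.Build R (P -> N) linhom_pred
  linhom_pred_closed.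
HB.instance Definition _ := GRing.isZmodClosed.Build (P -> N) linhom_pred
  (GRing.submod_closedB linhom_pred_closed).

Definition linhom := {f : P -> N | f \in linhom_pred}.

HB.instance Definition _ := SubChoice.on linhom.
HB.instance Definition _ := [SubChoice_isSubLmodule of linhom by <:].

Lemma linhom_linear (f : linhom) : linear (val f).
Proof. exact/asboolP/(valP f). Qed.

End Hom.

Section Precomposition.
Context (R : comNzRingType) (P' P N : lmodType R) (d : {linear P' -> P}).

Lemma precomp_proof (f : linhom P N) : val f \o d \in @linhom_pred R P' N.
Proof. by apply/asboolP => a x y /=; rewrite linearP linhom_linear. Qed.

Definition precomp (f : linhom P N) : linhom P' N := Sub (val f \o d) (precomp_proof f).

Lemma precomp_is_linear : linear precomp.
Proof. by move=> a f g; apply: val_inj; apply/funext. Qed.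

HB.instance Definition _ := GRing.isLinear.Build R (linhom P N) (linhom P' N) *:%R
  precomp precomp_is_linear.

End Precomposition.

Section FreeModule.
Context (R : comNzRingType) (M : lmodType R).

Definition freemod : Type := {malg R[M]}.

HB.instance Definition _ := GRing.Lmodule.on freemod.

Definition augm (x : freemod) : M := \sum_(m <- msupp x) x@_m *: m.

Lemma augmw (d : {fset M}) x : msupp x `<=` d ->
  augm x = \sum_(m <- d) x@_m *: m.
Proof.
move=> le; apply/big_fset_incl => // m _ /mcoeff_outdom ->.
by rewrite scale0r.
Qed.

Lemma augm_is_linear : linear augm.
Proof.
move=> a x y; set d := msupp x `|` msupp y.
have led : msupp (a *: x + y) `<=` d.
  apply: fsubset_trans (msuppD_le _ _) _; apply: fsetSU; exact: msuppZ_le.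
rewrite (augmw led) (@augmw d x) ?fsubsetUl // (@augmw d y) ?fsubsetUr //.
rewrite scaler_sumr -big_split; apply: eq_bigr => m _ /=.
by rewrite mcoeffD mcoeffZ scalerDl scalerA.
Qed.

HB.instance Definition _ := GRing.isLinear.Build R freemod M *:%R
  augm augm_is_linear.

Lemma augmU a m : augm << a *g m >> = a *: m.
Proof. by rewrite (@augmw [fset m]) ?msuppU_le // big_seq_fset1 mcoeffUU. Qed.

End FreeModule.

Section Ext.
Context (R : comNzRingType).
Implicit Types (M N : lmodType R) (l i : nat).

(* The canonical free resolution of M: resol M i is the free module on the
   underlying set of the i-th syzygy, and syzygy M i.+1 is the kernel of
   resol M i -> syzygy M i. *)
Fixpoint syzygy M i : lmodType R :=
  if i is i'.+1 then kermod (augm (M := syzygy M i')) else M.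

Definition resol M i : lmodType R := freemod (syzygy M i).

Definition resol_d M i (x : resol M i.+1) : resol M i :=
  val (augm (x : freemod (kermod (augm (M := syzygy M i))))).

Lemma resol_d_is_linear M i : linear (@resol_d M i).
Proof. by move=> a x y; rewrite /resol_d !linearP. Qed.

HB.instance Definition _ M i :=
  GRing.isLinear.Build R (resol M i.+1) (resol M i) *:%R
    (@resol_d M i) (@resol_d_is_linear M i).

Lemma augm_surj M (m : M) : exists x : resol M 0, augm x = m.
Proof. by exists << 1 *g m >>; rewrite augmU scale1r. Qed.

Lemma resol_exact0 M (x : resol M 0) :
  augm x = 0 <-> exists y, resol_d (i := 0) y = x.
Proof.
split=> [x0|[y <-]]; last exact/eqP/(valP (augm y)).
have kx : x \in ker_pred (augm (M := M)).
  exact/eqP.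
have [y hy] := @augm_surj (syzygy M 1) (Sub x kx).
by exists y; rewrite /resol_d hy.
Qed.

Lemma resol_exact M i (x : resol M i.+1) :
  resol_d x = 0 <-> exists y, resol_d (i := i.+1) y = x.
Proof.
have -> : (resol_d x = 0) <-> (augm (x : freemod (syzygy M i.+1)) = 0).
  split=> [h|h]; last by rewrite /resol_d h.
  exact: val_inj.
exact: (@resol_exact0 (syzygy M i.+1)).
Qed.

Definition cochain M N i : lmodType R := linhom (resol M i) N.

Definition codiff M N i : {linear cochain M N i -> cochain M N i.+1} :=
  @precomp R _ _ N (@resol_d M i).

Definition cocycle M N i : lmodType R := kermod (codiff M N i).

Definition is_coboundary M N i : cochain M N i -> Prop :=
  match i with
  | 0 => fun f => f = 0
  | i'.+1 => fun f => exists g, f = codiff M N i' g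
  end.

Definition cobound_pred M N i : {pred cocycle M N i} :=
  [pred z | `[< is_coboundary (val z) >]].

Lemma cobound_pred_closed M N i : submod_closed (@cobound_pred M N i).
Proof.
have E a (x y : cocycle M N i) : val (a *: x + y) = a *: val x + val y.
  by rewrite linearP.
split=> [|a x y /asboolP hx /asboolP hy]; apply/asboolP.
  by case: {E} i => [|i] //=; exists 0; rewrite raddf0.
rewrite E; case: {E} i x y hx hy => [|i] x y /=.
  by move=> -> ->; rewrite scaler0 addr0.
by move=> [g ->] [h ->]; exists (a *: g + h); rewrite linearP.
Qed.

HB.instance Definition _ M N i :=
  GRing.isSubmodClosed.Build R (cocycle M N i) (@cobound_pred M N i)
    (@cobound_pred_closed M N i).

Definition Ext i M N : lmodType R := quotmod (@cobound_pred M N i).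

End Ext.

Section GroupAlgebraModules.
Context (k : comNzRingType) (G : zmodType).
Local Notation R := (galg k G).

Section Conjugate.
Context (M : lmodType R).

Definition conjmod : Type := M.

HB.instance Definition _ := GRing.Zmodule.on conjmod.

Definition conj_scale (r : R) (m : conjmod) : conjmod := gbar r *: (m : M).

Lemma conj_scaleA r s m : conj_scale r (conj_scale s m) = conj_scale (r * s) m.
Proof. by rewrite /conj_scale scalerA rmorphM. Qed.

Lemma conj_scale1 : left_id 1 conj_scale.
Proof. by move=> m; rewrite /conj_scale rmorph1 scale1r. Qed.

Lemma conj_scaleDr : right_distributive conj_scale +%R.
Proof. by move=> r m n; rewrite /conj_scale scalerDr. Qed.

Lemma conj_scaleDl m : {morph conj_scale^~ m : r s / r + s}.
Proof. by move=> r s; rewrite /conj_scale rmorphD scalerDl. Qed.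

HB.instance Definition _ := GRing.Zmodule_isLmodule.Build R conjmod
  conj_scaleA conj_scale1 conj_scaleDr conj_scaleDl.

End Conjugate.

(* [E] has a [Q]-element basis over [k], where [k] acts through the constants
   of the group algebra. *)
Definition has_kdim (E : lmodType R) (Q : nat) : Prop :=
  exists b : 'I_Q -> E, forall e : E,
    exists! c : {ffun 'I_Q -> k}, e = \sum_(i < Q) gmonom (c i) 0 *: b i.

Definition stabilizer (E : lmodType R) (v : G) : Prop :=
  forall e : E, gmonom 1 v *: e = e.

Definition topological_css q a b
    (phiX : 'M[R]_(q, a)) (phiZ : 'M[R]_(q, b)) : Prop :=
  [/\ dagger phiX *m phiZ = 0,
      (forall v : 'cV[R]_q,
         (exists w : 'cV[R]_a, v = phiX *m w) <-> dagger phiZ *m v = 0)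
    & (forall v : 'cV[R]_q,
         (exists w : 'cV[R]_b, v = phiZ *m w) <-> dagger phiX *m v = 0)].

Definition coker_mx q a (phi : 'M[R]_(q, a)) : lmodType R :=
  cokermod (mulmx phi : {linear 'cV[R]_a -> 'cV[R]_q}).

End GroupAlgebraModules.

Section CoarseGraining.
Context (k : comNzRingType) (G : zmodType) (L : zmodClosed G).

Definition sublattice := {v : G | v \in L}.

HB.instance Definition _ := SubChoice.on sublattice.
HB.instance Definition _ := [SubChoice_isSubZmodule of sublattice by <:].

(* The finite indexing type makes [L] a subgroup of index [n]. *)
Definition coset_reps n (u : 'I_n -> G) : Prop :=
  forall v : G, exists! s : 'I_n, v - u s \in L.

Definition zbasis D (y : 'I_D -> sublattice) : Prop :=
  forall v : sublattice,
    exists! c : {ffun 'I_D -> int}, v = \sum_(i < D) y i *~ c i.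

Definition galg_incl (r : galg k sublattice) : galg k G :=
  \sum_(l <- msupp r) gmonom r@_l (val l).

(* The coordinate of [r] along the basis element x^u when k[G] is regarded as
   a free k[L]-module (see [coset_coordE]). *)
Definition coset_coord (u : G) (r : galg k G) : galg k sublattice :=
  \sum_(v <- msupp r)
    (if insub (v - u) is Some l then gmonom r@_v (l : sublattice) else 0).

Lemma sum_msupp_pick (H : choiceType) (r : {malg k[H]}) (w : H) :
  \sum_(v <- msupp r) r@_v *+ (v == w) = r@_w.
Proof.
rewrite [in RHS](monalgE r) raddf_sum; apply: eq_bigr => v _ /=.
by rewrite mcoeffU.
Qed.

Lemma mcoeff_mulmonom (r : galg k G) (u w : G) :
  (r * gmonom 1 u)@_w = r@_(w - u).
Proof.
rewrite [_ * _](@galg_mulw _ _ (msupp r) [fset u]) ?msuppU_le // raddf_sum /=.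
rewrite -[RHS]sum_msupp_pick; apply: eq_bigr => v _.
by rewrite big_seq_fset1 mcoeffUU mulr1 mcoeffU eq_sym -subr_eq eq_sym.
Qed.

Lemma mcoeff_coset_coord (u : G) (r : galg k G) (l : sublattice) :
  (coset_coord u r)@_l = r@_(val l + u).
Proof.
rewrite raddf_sum -[RHS]sum_msupp_pick; apply: eq_bigr => v _ /=.
rewrite -subr_eq; case: insubP => [l' _ <-|nL]; first by rewrite mcoeffU.
rewrite mcoeff0; case: eqP => // vl; case/negP: nL.
by rewrite vl (valP l).
Qed.

Lemma mcoeff_galg_incl (r : galg k sublattice) (w : G) :
  (galg_incl r)@_w = if insub w is Some l then r@_(l : sublattice) else 0.
Proof.
rewrite raddf_sum /=; case: insubP => [l _ <-|nL].
  rewrite -[RHS]sum_msupp_pick; apply: eq_bigr => v _.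
  by rewrite mcoeffU (inj_eq val_inj).
apply: big1 => v _; rewrite mcoeffU; case: eqP => // vw; case/negP: nL.
by rewrite -vw (valP v).
Qed.

Lemma coset_coordE n (u : 'I_n -> G) (r : galg k G) : coset_reps u ->
  r = \sum_(s < n) galg_incl (coset_coord (u s) r) * gmonom 1 (u s).
Proof.
move=> hu; apply/malgP => v.
have incl_coord s :
    (galg_incl (coset_coord (u s) r) * gmonom 1 (u s))@_v =
    if v - u s \in L then r@_v else 0.
  rewrite mcoeff_mulmonom mcoeff_galg_incl; case: insubP => [l -> vl|/negPf-> //].
  by rewrite mcoeff_coset_coord vl subrK.
rewrite raddf_sum /=; under eq_bigr do rewrite incl_coord.
have [s [hs us]] := hu v; rewrite (bigD1 s) //= hs big1 ?addr0 // => t ts.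
by case: ifP => // ht; rewrite (us t ht) eqxx in ts.
Qed.

(* Restriction of scalars: the block (i, j) is the matrix, in the basis x^(u s),
   of multiplication by the entry (i, j). *)
Definition coarse n (u : 'I_n -> G) q a (phi : 'M[galg k G]_(q, a)) :
    'M[galg k sublattice]_(\sum_(i < q) n, \sum_(j < a) n) :=
  \mxblock_(i < q, j < a)
    \matrix_(s < n, t < n) coset_coord (u s) (phi i j * gmonom 1 (u t)).

End CoarseGraining.

Section Koszul.
Context (A : comNzRingType) (D : nat) (f : 'I_D -> A).

(* The basis element e_{a_1} /\ ... /\ e_{a_i}, a_1 < ... < a_i, of the i-th
   exterior power is indexed by the set {a_1, ..., a_i}. *)
Definition ext_basis (i : nat) : {set {set 'I_D}} :=
  [set S : {set 'I_D} | #|S| == i].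

(* For a = a_k in S, the number of elements of S below a is k - 1. *)
Definition koszul_coef (T S : {set 'I_D}) : A :=
  \sum_(a in S | T == S :\ a) (-1) ^+ #|[set b in S | (b < a)%N]| * f a.

(* The matrix of K_i -> K_{i-1} for i > 0 (with a junk codomain at i = 0). *)
Definition koszul_d (i : nat) : 'M[A]_(#|ext_basis i.-1|, #|ext_basis i|) :=
  \matrix_(t, s) koszul_coef (enum_val t) (enum_val s).

End Koszul.

Definition toricX (k : comNzRingType) (G : zmodType) (L : zmodClosed G) (D : nat)
    (y : 'I_D -> sublattice L) (j : nat) :
    'M[galg k (sublattice L)]_(#|ext_basis D j|, #|ext_basis D j.-1|) :=
  dagger (koszul_d (fun i => gmonom 1 (y i) - 1) j).

Section Equivalence.
Context (A : comNzRingType).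

Definition mx_inverse n (W V : 'M[A]_n) : Prop := W *m V = 1%:M /\ V *m W = 1%:M.

Inductive elementary_group n : 'M[A]_n -> Prop :=
| Elem_gen (r : A) (i l : 'I_n) :
    i != l -> elementary_group (1%:M + r *: delta_mx i l)
| Elem_one : elementary_group 1%:M
| Elem_mul W V :
    elementary_group W -> elementary_group V -> elementary_group (W *m V)
| Elem_inv W V :
    elementary_group W -> mx_inverse W V -> elementary_group V.

(* Invertibility is spelled out because [A] carries no unitRingType structure. *)
Definition cl_equiv q a (phi phi' : 'M[A]_(q, a)) : Prop :=
  exists (W : 'M[A]_q) (Phi : 'M[A]_a),
    [/\ elementary_group W, (exists Psi, mx_inverse Phi Psi)
      & W *m phi *m Phi = phi'].

Definition dsum q a q' a' (phi : 'M[A]_(q, a)) (phi' : 'M[A]_(q', a')) :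
    'M[A]_(q + q', a + a') := block_mx phi 0 0 phi'.

Definition dsum_copies Q q a (phi : 'M[A]_(q, a)) :
    'M[A]_(\sum_(i < Q) q, \sum_(i < Q) a) :=
  \mxblock_(i < Q, j < Q) (if i == j then phi else 0).

Definition stab q a (phi : 'M[A]_(q, a)) (al be eta : nat) :
    'M[A]_(q + al + be, a + al + eta) :=
  dsum (dsum phi (1%:M : 'M[A]_al)) (0 : 'M[A]_(be, eta)).

Definition stable_cl_equiv q a q' a'
    (phi : 'M[A]_(q, a)) (phi' : 'M[A]_(q', a')) : Prop :=
  exists (al be eta al' be' eta' : nat)
    (eq_q : (q' + al' + be' = q + al + be)%N)
    (eq_a : (a' + al' + eta' = a + al + eta)%N),
    cl_equiv (stab phi al be eta)
             (castmx (eq_q, eq_a) (stab phi' al' be' eta')).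

End Equivalence.

Definition laurent (p D : nat) : comNzRingType := galg 'F_p 'rV[int]_D.

Definition ext_coker k G q a (l : nat) (phi : 'M[galg k G]_(q, a)) :
    lmodType (galg k G) :=
  Ext l (conjmod (coker_mx phi)) (galg k G)^o.

(* Main.v *)
Require Import Defs.
From HB Require Import structures.
From mathcomp Require Import all_boot all_order all_algebra.
From mathcomp Require Import finmap monalg boolp functions.

(* Let A = k[Lambda].  Dualizing a finite free resolution of the conjugate of
   coker phi_X gives a complex of free modules starting with phi_X^dagger, whose
   cohomology in degree l > 0 is Ext^l, i.e. E for l = j and 0 otherwise.  Beyond
   degree j it is exact and ends in 0 (Hilbert's syzygy theorem), so the cocycles
   in degree j are stably free and the part up to degree j is, up to a free
   summand, the beginning of a free resolution of E over A.  If Lambda acts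
   trivially, E = k^Q is also resolved by Q copies of the Koszul complex, and
   Schanuel's lemma identifies the j-th differentials phi_X^dagger and d_j^Q up
   to stabilization; Whitehead's lemma makes the row operations elementary.
   Conversely, each r = x^v - 1 with v in Lambda satisfies r d_j = d_j h d_j for
   some h; this relation is invariant under stable equivalence, and it passes
   along the resolution to show that r kills Ext^j. *)

Set Implicit Arguments.
Unset Strict Implicit.
Unset Printing Implicit Defensive.

Import GRing.Theory.
Local Open Scope ring_scope.

(** * Elementary matrices and stable equivalence *)

(** Two rings are in play: the resolution and Ext live over $R$, the equivalence over $A$. Ext over
    $A$ is never formed. Kernels and images of matrices survive restriction of scalars, so the
    resolution is coarse-grained matrix by matrix. This requires a resolution by matrices, whereas
    Ext is defined through free modules on whole underlying sets; a comparison of projective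
    resolutions links the two. The obstacle in degree $j$ is that $E$ is cocycles modulo
    coboundaries, and the module of cocycles need not be free, so the differential entering it does
    not present $E$. The free complement obtained from the finite tail repairs this; here the
    vanishing above $j$ enters. The vanishing below $j$ enters when Schanuel's argument is repeated
    down to the first matrix. Zero rows and zero columns in the stabilization absorb exactly the
    free summands that appear in cokernels and in kernels. For the converse, a statement about
    cohomology would involve two adjacent differentials, while the equivalence speaks of $\varphi_X$
    alone; the relation $r d = d h d$ involves a single matrix and still contains a null-homotopy of
    $r$. *)

Section Elementary.
Context (A : comNzRingType).

Lemma mx_inverse_sym n (W V : 'M[A]_n) : mx_inverse W V -> mx_inverse V W.
Proof. by case. Qed.

Lemma mx_inverseM n (W V W' V' : 'M[A]_n) :
  mx_inverse W V -> mx_inverse W' V' -> mx_inverse (W *m W') (V' *m V).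
Proof.
move=> [h1 h2] [h3 h4]; split.
  by rewrite mulmxA -(mulmxA W) h3 mulmx1.
by rewrite mulmxA -(mulmxA V') h2 mulmx1.
Qed.

Lemma elementary_invertible n (W : 'M[A]_n) :
  elementary_group W -> exists2 V, elementary_group V & mx_inverse W V.
Proof.
suff h : elementary_group W -> exists V, mx_inverse W V.
  by move=> eW; have [V iV] := h eW; exists V => //; apply: Elem_inv iV.
elim=> {W} [r i l il||W W' _ [V iV] _ [V' iV']|W V _ _ iV].
- exists (1%:M + (- r) *: delta_mx i l).
  have e s t : (1%:M + s *: delta_mx i l) *m (1%:M + t *: delta_mx i l)
      = 1%:M + (s + t) *: delta_mx i l :> 'M[A]_n.
    rewrite mulmxDl mul1mx mulmxDr mulmx1 -scalemxAl -scalemxAr.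
    rewrite mul_delta_mx_0 1?eq_sym // !scaler0 addr0 scalerDl addrAC -addrA.
    by rewrite (addrC (s *: _)).
  by split; rewrite e ?subrr ?addNr scale0r addr0.
- by exists 1%:M; split; rewrite mulmx1.
- by exists (V' *m V); apply: mx_inverseM.
- by exists W; apply: mx_inverse_sym.
Qed.

Lemma elementary_tr n (W : 'M[A]_n) : elementary_group W -> elementary_group W^T.
Proof.
elim=> {W} [r i l il||W V _ eW _ eV|W V _ eW [h1 h2]].
- by rewrite linearD linearZ /= trmx1 trmx_delta; apply: Elem_gen; rewrite eq_sym.
- by rewrite trmx1; apply: Elem_one.
- by rewrite trmx_mul; apply: Elem_mul.
- by apply: (Elem_inv eW); split; rewrite -trmx_mul ?h1 ?h2 trmx1.
Qed.

Lemma dsum1 m n : dsum (1%:M : 'M[A]_m) (1%:M : 'M[A]_n) = 1%:M.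
Proof. by rewrite /dsum -scalar_mx_block. Qed.

Lemma dsumM m n p m' n' p' (X : 'M[A]_(m, n)) (Y : 'M[A]_(n, p))
    (X' : 'M[A]_(m', n')) (Y' : 'M[A]_(n', p')) :
  dsum X X' *m dsum Y Y' = dsum (X *m Y) (X' *m Y').
Proof. by rewrite /dsum mulmx_block !mulmx0 !mul0mx !addr0 !add0r. Qed.

Lemma dsum_inverse m n (W V : 'M[A]_m) (W' V' : 'M[A]_n) :
  mx_inverse W V -> mx_inverse W' V' -> mx_inverse (dsum W W') (dsum V V').
Proof. by move=> [h1 h2] [h3 h4]; split; rewrite dsumM ?h1 ?h2 ?h3 ?h4 dsum1. Qed.

Lemma dsum_elementaryl m n (W : 'M[A]_m) :
  elementary_group W -> elementary_group (dsum W (1%:M : 'M_n)).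
Proof.
elim=> {W} [r i l il||W V _ eW _ eV|W V _ eW iV].
- rewrite (_ : dsum _ _ = 1%:M + r *: delta_mx (lshift n i) (lshift n l)).
    by apply: Elem_gen; rewrite (inj_eq (@lshift_inj _ _)).
  rewrite -[in RHS]dsum1 /dsum; apply/matrixP => x y; rewrite !mxE.
  case: (split_ordP x) => x' ->; rewrite ?row_mxEl ?row_mxEr ?block_mxEul ?mxE;
  case: (split_ordP y) => y' ->; rewrite ?row_mxEl ?row_mxEr !mxE
    ?eq_lshift ?eq_rshift ?eq_lrshift ?eq_rlshift ?andbF ?mulr0 ?addr0 //.
- by rewrite dsum1; apply: Elem_one.
- by rewrite -[1%:M]mulmx1 -dsumM; apply: Elem_mul.
- by apply: (Elem_inv eW); apply: dsum_inverse => //; split; rewrite mulmx1.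
Qed.

Lemma dsum_elementaryr m n (W : 'M[A]_n) :
  elementary_group W -> elementary_group (dsum (1%:M : 'M_m) W).
Proof.
elim=> {W} [r i l il||W V _ eW _ eV|W V _ eW iV].
- rewrite (_ : dsum _ _ = 1%:M + r *: delta_mx (rshift m i) (rshift m l)).
    by apply: Elem_gen; rewrite (inj_eq (@rshift_inj _ _)).
  rewrite -[in RHS]dsum1 /dsum; apply/matrixP => x y; rewrite !mxE.
  case: (split_ordP x) => x' ->; rewrite ?row_mxEl ?row_mxEr ?block_mxEul ?mxE;
  case: (split_ordP y) => y' ->; rewrite ?row_mxEl ?row_mxEr !mxE
    ?eq_lshift ?eq_rshift ?eq_lrshift ?eq_rlshift ?andbF ?mulr0 ?addr0 //.
- by rewrite dsum1; apply: Elem_one.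
- by rewrite -[1%:M]mulmx1 -dsumM; apply: Elem_mul.
- by apply: (Elem_inv eW); apply: dsum_inverse => //; split; rewrite mulmx1.
Qed.

(** Upper right blocks add under multiplication, so the matrix factors into one generator per entry
    of [X]. *)
Lemma elementary_upper m n (X : 'M[A]_(m, n)) :
  elementary_group (block_mx 1%:M X 0 1%:M).
Proof.
have h (Y Z : 'M[A]_(m, n)) : block_mx 1%:M (Y + Z) 0 1%:M
    = block_mx 1%:M Y 0 1%:M *m block_mx 1%:M Z 0 1%:M.
  by rewrite mulmx_block !mul1mx !mulmx0 !mulmx1 !mul0mx !addr0 add0r (addrC Z).
rewrite [X]matrix_sum_delta.
elim/big_rec: _ => [|i Y _ eY]; first by rewrite -scalar_mx_block; apply: Elem_one.
rewrite h; apply: Elem_mul => //; elim/big_rec: _ => [|j Z _ eZ].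
  by rewrite -scalar_mx_block; apply: Elem_one.
rewrite h; apply: Elem_mul => //.
rewrite (_ : block_mx _ _ _ _ = 1%:M + X i j *: delta_mx (lshift n i) (rshift m j)).
  by apply: Elem_gen; rewrite eq_lrshift.
rewrite -[in RHS]dsum1 /dsum; apply/matrixP => x y; rewrite !mxE.
by case: (split_ordP x) => x' ->; rewrite ?row_mxEl ?row_mxEr ?block_mxEul ?mxE;
  case: (split_ordP y) => y' ->; rewrite ?row_mxEl ?row_mxEr !mxE
    ?eq_lshift ?eq_rshift ?eq_lrshift ?eq_rlshift ?andbF ?mulr0 ?addr0 ?add0r.
Qed.

Lemma elementary_lower m n (X : 'M[A]_(n, m)) :
  elementary_group (block_mx 1%:M 0 X 1%:M).
Proof.
have := elementary_tr (elementary_upper X^T).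
by rewrite tr_block_mx !trmx1 trmx0 trmxK.
Qed.

Lemma elementary_swap n : elementary_group (block_mx 0 1%:M (- 1%:M) 0 : 'M[A]_(n + n)).
Proof.
pose U : 'M[A]_(n + n) := block_mx 1%:M 1%:M 0 1%:M.
pose L : 'M[A]_(n + n) := block_mx 1%:M 0 (- 1%:M) 1%:M.
have -> : block_mx 0 1%:M (- 1%:M) 0 = U *m (L *m U).
  rewrite /U /L !mulmx_block !mulmx1 !mul1mx !mulmx0 !mul0mx ?addr0 ?add0r.
  by rewrite addNr !subrr !addr0.
by do ?apply: Elem_mul; rewrite ?/U ?/L; apply: elementary_upper || apply: elementary_lower.
Qed.

(** Whitehead's factorization into three unitriangular block matrices and the signed swap. It makes
    any invertible row operation elementary after padding. *)
Lemma elementary_whitehead n (W V : 'M[A]_n) :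
  mx_inverse W V -> elementary_group (dsum W V).
Proof.
move=> [WV VW].
have -> : dsum W V = block_mx 1%:M (- W) 0 1%:M *m (block_mx 1%:M 0 V 1%:M
    *m (block_mx 1%:M (- W) 0 1%:M *m block_mx 0 1%:M (- 1%:M) 0)).
  rewrite /dsum !mulmx_block !mulmx1 !mul1mx !mulmx0 !mul0mx ?addr0 ?add0r.
  rewrite !mulmxN !mulNmx !opprK ?mulmx1 ?mul1mx.
  by rewrite !mulmxN VW WV !opprK !subrr mulmx0 subr0.
do ?apply: Elem_mul.
- exact: elementary_upper.
- exact: elementary_lower.
- exact: elementary_upper.
- exact: elementary_swap.
Qed.

End Elementary.

(** * Stable equivalence of matrices and Schanuel's lemma *)

Section Stable.
Context (A : comNzRingType).

(** Rectangular two-sided inverses spare every transport along equalities of sizes; [gl_equiv_sizes]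
    recovers these equalities. *)
Definition gl_equiv q a q' a' (X : 'M[A]_(q, a)) (X' : 'M[A]_(q', a')) : Prop :=
  exists (W : 'M_(q', q)) (W' : 'M_(q, q')) (F : 'M_(a, a')) (F' : 'M_(a', a)),
    [/\ W *m W' = 1%:M, W' *m W = 1%:M, F *m F' = 1%:M, F' *m F = 1%:M
      & W *m X *m F = X'].

(** The elementary group consists of square matrices, hence the explicit equality of row sizes; the
    column side stays rectangular. *)
Definition el_equiv q a q' a' (X : 'M[A]_(q, a)) (X' : 'M[A]_(q', a')) : Prop :=
  exists (e : q = q') (W : 'M_q') (F : 'M_(a, a')) (F' : 'M_(a', a)),
    [/\ elementary_group W, F *m F' = 1%:M, F' *m F = 1%:M
      & W *m castmx (e, erefl a) X *m F = X'].

Lemma el_gl_equiv q a q' a' (X : 'M[A]_(q, a)) (X' : 'M[A]_(q', a')) :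
  el_equiv X X' -> gl_equiv X X'.
Proof.
move=> [e [W [F [F' [eW h1 h2 <-]]]]]; case: q' / e X' W eW => _ W eW.
have [V _ [WV VW]] := elementary_invertible eW.
by exists W, V, F, F'; rewrite castmx_id.
Qed.

Lemma gl_equiv_refl q a (X : 'M[A]_(q, a)) : gl_equiv X X.
Proof. by exists 1%:M, 1%:M, 1%:M, 1%:M; rewrite !mulmx1 !mul1mx. Qed.

Lemma gl_equiv_sym q a q' a' (X : 'M[A]_(q, a)) (X' : 'M[A]_(q', a')) :
  gl_equiv X X' -> gl_equiv X' X.
Proof.
move=> [W [W' [F [F' [h1 h2 h3 h4 <-]]]]]; exists W', W, F', F; split => //.
by rewrite !mulmxA h2 mul1mx -mulmxA h3 mulmx1.
Qed.

Lemma gl_equiv_trans q a q' a' q'' a'' (X' : 'M[A]_(q', a')) (X : 'M[A]_(q, a))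
    (X'' : 'M[A]_(q'', a'')) :
  gl_equiv X X' -> gl_equiv X' X'' -> gl_equiv X X''.
Proof.
move=> [W [W' [F [F' [h1 h2 h3 h4 <-]]]]] [V [V' [G [G' [k1 k2 k3 k4 <-]]]]].
exists (V *m W), (W' *m V'), (F *m G), (G' *m F'); split; last by rewrite !mulmxA.
- by rewrite mulmxA -(mulmxA V) h1 mulmx1.
- by rewrite mulmxA -(mulmxA W') k2 mulmx1.
- by rewrite mulmxA -(mulmxA F) k3 mulmx1.
- by rewrite mulmxA -(mulmxA G') h4 mulmx1.
Qed.

Lemma gl_equiv_dsum q a q' a' r b r' b' (X : 'M[A]_(q, a)) (X' : 'M[A]_(q', a'))
    (Y : 'M[A]_(r, b)) (Y' : 'M[A]_(r', b')) :
  gl_equiv X X' -> gl_equiv Y Y' -> gl_equiv (dsum X Y) (dsum X' Y').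
Proof.
move=> [W [W' [F [F' [h1 h2 h3 h4 <-]]]]] [V [V' [G [G' [k1 k2 k3 k4 <-]]]]].
exists (dsum W V), (dsum W' V'), (dsum F G), (dsum F' G').
by rewrite !dsumM h1 h2 h3 h4 k1 k2 k3 k4 !dsum1.
Qed.

Lemma gl_equiv_dsumC q a r b (X : 'M[A]_(q, a)) (Y : 'M[A]_(r, b)) :
  gl_equiv (dsum X Y) (dsum Y X).
Proof.
exists (block_mx 0 1%:M 1%:M 0), (block_mx 0 1%:M 1%:M 0),
  (block_mx 0 1%:M 1%:M 0), (block_mx 0 1%:M 1%:M 0).
by rewrite /dsum !mulmx_block !(mulmx1, mul1mx, mulmx0, mul0mx, addr0, add0r) -!scalar_mx_block.
Qed.

Lemma el_equiv_cast q a q' a' (X : 'M[A]_(q, a)) (e : (q = q') * (a = a')) :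
  el_equiv X (castmx e X).
Proof.
case: e => e1 e2; case: q' / e1; case: a' / e2; exists erefl, 1%:M, 1%:M, 1%:M.
by rewrite castmx_id !mulmx1 mul1mx; split => //; apply: Elem_one.
Qed.

Lemma el_equiv_sym q a q' a' (X : 'M[A]_(q, a)) (X' : 'M[A]_(q', a')) :
  el_equiv X X' -> el_equiv X' X.
Proof.
move=> [e [W [F [F' [eW h1 h2 <-]]]]]; case: q' / e X' W eW => _ W eW.
have [V eV [WV VW]] := elementary_invertible eW.
exists erefl, V, F', F; split => //.
by rewrite !castmx_id !mulmxA VW mul1mx -mulmxA h1 mulmx1.
Qed.

Lemma el_equiv_trans q a q' a' q'' a'' (X' : 'M[A]_(q', a')) (X : 'M[A]_(q, a))
    (X'' : 'M[A]_(q'', a'')) :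
  el_equiv X X' -> el_equiv X' X'' -> el_equiv X X''.
Proof.
move=> [e [W [F [F' [eW h1 h2 <-]]]]]; case: q' / e X' W eW => _ W eW.
move=> [e [V [G [G' [eV k1 k2 <-]]]]]; case: q'' / e X'' V eV => _ V eV.
exists erefl, (V *m W), (F *m G), (G' *m F'); split.
- exact: Elem_mul.
- by rewrite mulmxA -(mulmxA F) k1 mulmx1.
- by rewrite mulmxA -(mulmxA G') h2 mulmx1.
- by rewrite !castmx_id !mulmxA.
Qed.

Lemma el_equiv_dsuml q a q' a' r b (X : 'M[A]_(q, a)) (X' : 'M[A]_(q', a'))
    (Y : 'M[A]_(r, b)) :
  el_equiv X X' -> el_equiv (dsum X Y) (dsum X' Y).
Proof.
move=> [e [W [F [F' [eW h1 h2 <-]]]]]; case: q' / e X' W eW => _ W eW.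
exists erefl, (dsum W 1%:M), (dsum F 1%:M), (dsum F' 1%:M).
by rewrite !castmx_id !dsumM h1 h2 !mulmx1 mul1mx !dsum1; split => //; apply: dsum_elementaryl.
Qed.

Lemma el_equiv_dsumr q a q' a' r b (X : 'M[A]_(q, a)) (X' : 'M[A]_(q', a'))
    (Y : 'M[A]_(r, b)) :
  el_equiv X X' -> el_equiv (dsum Y X) (dsum Y X').
Proof.
move=> [e [W [F [F' [eW h1 h2 <-]]]]]; case: q' / e X' W eW => _ W eW.
exists erefl, (dsum 1%:M W), (dsum 1%:M F), (dsum 1%:M F').
by rewrite !castmx_id !dsumM h1 h2 !mulmx1 mul1mx !dsum1; split => //; apply: dsum_elementaryr.
Qed.

Lemma el_equiv_dsumA q a r b s c (X : 'M[A]_(q, a)) (Y : 'M[A]_(r, b)) (Z : 'M[A]_(s, c)) :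
  el_equiv (dsum (dsum X Y) Z) (dsum X (dsum Y Z)).
Proof.
have := block_mxAx X 0 0 0 Y 0 0 0 Z; rewrite /= !row_mx0 !col_mx0 => E.
rewrite {2}/dsum; move: E; rewrite /dsum => ->; exact: el_equiv_cast.
Qed.

(** The signed row swap is elementary, the unsigned one need not be; the sign is absorbed by the
    column operation, which may be any invertible matrix. *)
Lemma el_equiv_swap q a b (X : 'M[A]_(q, a)) (Y : 'M[A]_(q, b)) :
  el_equiv (dsum X Y) (dsum Y X).
Proof.
exists erefl, (block_mx 0 1%:M (- 1%:M) 0), (block_mx 0 (- 1%:M) 1%:M 0),
   (block_mx 0 1%:M (- 1%:M) 0).
rewrite castmx_id /dsum !mulmx_block !(mulmx1, mul1mx, mulmx0, mul0mx, addr0, add0r, mulNmx, mulmxN, opprK).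
by rewrite oppr0 -!scalar_mx_block; split=> //; apply: elementary_swap.
Qed.

Lemma dsum0 m n m' n' : dsum (0 : 'M[A]_(m, n)) (0 : 'M[A]_(m', n')) = 0.
Proof. exact: block_mx0. Qed.

Lemma dsum_zero_rowr q a eta (Y : 'M[A]_(q, a)) :
  dsum Y (0 : 'M_(0, eta)) = castmx (esym (addn0 q), erefl) (row_mx Y 0).
Proof.
apply/matrixP => i j; rewrite castmxE /dsum block_mxEv cast_ord_id.
case: (split_ordP i) => [i' ->|[]//]; rewrite col_mxEu.
by congr (row_mx _ _ _ _); apply: val_inj.
Qed.

(* One zero row at a time: for blocks with equally many rows the signed swap is
   elementary. *)
Lemma el_equiv_zero_id be eta N :
  el_equiv (dsum (0 : 'M[A]_(be, eta)) (1%:M : 'M_N)) (dsum (1%:M : 'M_N) (0 : 'M[A]_(be, eta))).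
Proof.
have comm1 M : el_equiv (dsum (0 : 'M[A]_(1, 0)) (1%:M : 'M_M)) (dsum (1%:M : 'M_M) (0 : 'M[A]_(1, 0))).
  elim: M => [|M IH].
    by exists erefl, 1%:M, 1%:M, 1%:M; rewrite !mulmx1 castmx_id mul1mx; split => //;
      [apply: Elem_one | apply/matrixP => i []].
  rewrite -[M.+1]/(1 + M)%N -dsum1.
  apply: (el_equiv_trans (el_equiv_sym (el_equiv_dsumA _ _ _))).
  apply: (el_equiv_trans (el_equiv_dsuml _ (el_equiv_swap _ _))).
  apply: (el_equiv_trans (el_equiv_dsumA _ _ _)).
  apply: (el_equiv_trans (el_equiv_dsumr _ IH)).
  exact: (el_equiv_sym (el_equiv_dsumA _ _ _)).
elim: be => [|be IH].
  rewrite dsum_zero_rowr.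
  apply: el_equiv_trans (el_equiv_cast _ _).
  have -> : dsum (0 : 'M[A]_(0, eta)) (1%:M : 'M_N) = row_mx 0 1%:M :> 'M_(N, _).
    apply/matrixP => i j; rewrite /dsum block_mxEv.
    have e : i = rshift 0 i :> 'I_(0 + N) by apply: ord_inj.
    have -> : row_mx 0 1%:M i j = col_mx (row_mx 0 0) (row_mx 0 1%:M) (rshift 0 i) j :> A.
      by rewrite col_mxEd.
    by congr (col_mx _ _ _ _).
  exists erefl, 1%:M, (block_mx 0 1%:M 1%:M 0), (block_mx 0 1%:M 1%:M 0).
  rewrite castmx_id mul1mx mul_row_block !mulmx_block.
  rewrite !(mulmx1, mul1mx, mulmx0, mul0mx, addr0, add0r) -!scalar_mx_block.
  by split => //; exact: Elem_one.
suff : el_equiv (dsum (dsum (0 : 'M[A]_(1, 0)) (0 : 'M_(be, eta))) (1%:M : 'M_N))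
    (dsum (1%:M : 'M_N) (dsum (0 : 'M_(1, 0)) (0 : 'M_(be, eta)))) by rewrite dsum0.
apply: (el_equiv_trans (el_equiv_dsumA _ _ _)).
apply: (el_equiv_trans (el_equiv_dsumr _ IH)).
apply: (el_equiv_trans (el_equiv_sym (el_equiv_dsumA _ _ _))).
apply: (el_equiv_trans (el_equiv_dsuml _ (comm1 N))).
exact: el_equiv_dsumA.
Qed.

Lemma el_equiv_stab q a (phi : 'M[A]_(q, a)) al be eta N :
  el_equiv (dsum (stab phi al be eta) (1%:M : 'M_N)) (stab phi (al + N) be eta).
Proof.
rewrite /stab -dsum1.
apply: (el_equiv_trans (el_equiv_dsumA _ _ _)).
apply: (el_equiv_trans (el_equiv_dsumr _ (el_equiv_zero_id _ _ _))).
apply: (el_equiv_trans (el_equiv_sym (el_equiv_dsumA _ _ _))).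
apply: el_equiv_dsuml; exact: el_equiv_dsumA.
Qed.

Lemma gl_equiv_sizes q a q' a' (X : 'M[A]_(q, a)) (X' : 'M[A]_(q', a')) :
  gl_equiv X X' -> q = q' /\ a = a'.
Proof.
move=> [W [W' [F [F' [h1 h2 h3 h4 _]]]]].
by split; apply/eqP; rewrite eqn_leq;
  [rewrite (mulmx1_min h1) (mulmx1_min h2) | rewrite (mulmx1_min h3) (mulmx1_min h4)].
Qed.

(** The identity block makes room for [W'] beside [W], so that the row operation is elementary by
    Whitehead; the column operation [W] on that block restores the identity. *)
Lemma gl_el_equiv q a q' a' (X : 'M[A]_(q, a)) (X' : 'M[A]_(q', a')) :
  gl_equiv X X' -> el_equiv (dsum X (1%:M : 'M_q)) (dsum X' (1%:M : 'M_q)).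
Proof.
move=> E; have [eq ea] := gl_equiv_sizes E.
case: q' / eq X' E => X'; case: a' / ea X' => X' [W [W' [F [F' [h1 h2 h3 h4 <-]]]]].
exists erefl, (dsum W W'), (dsum F W), (dsum F' W').
rewrite castmx_id !dsumM h1 h2 h3 h4 mulmx1 h2 !dsum1; split => //.
exact: elementary_whitehead.
Qed.

Lemma el_equiv_cl_equiv q a q' a' (X : 'M[A]_(q, a)) (X' : 'M[A]_(q', a'))
    (eq : q' = q) (ea : a' = a) :
  el_equiv X X' -> cl_equiv X (castmx (eq, ea) X').
Proof.
case: q / eq X => X; case: a / ea X => X.
move=> [e [W [F [F' [eW h1 h2 <-]]]]]; exists W, F; rewrite castmx_id; split => //.
  by exists F'.
by rewrite (eq_axiomK e) castmx_id.
Qed.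

(** The working relation: row operations range over GL and no equality of sizes appears.
    [steq_stable_cl_equiv] returns to elementary operations at the price of further identity
    blocks. *)
Definition steq q a q' a' (X : 'M[A]_(q, a)) (X' : 'M[A]_(q', a')) : Prop :=
  exists al be eta al' be' eta', gl_equiv (stab X al be eta) (stab X' al' be' eta').

Theorem steq_stable_cl_equiv q a q' a' (X : 'M[A]_(q, a)) (X' : 'M[A]_(q', a')) :
  steq X X' -> stable_cl_equiv X X'.
Proof.
move=> [al [be [eta [al' [be' [eta' /gl_el_equiv]]]]]].
set N := (q + al + be)%N => E.
have {}E : el_equiv (stab X (al + N) be eta) (stab X' (al' + N) be' eta').
  apply: (el_equiv_trans (el_equiv_sym (el_equiv_stab _ _ _ _ _))).
  exact: (el_equiv_trans E (el_equiv_stab _ _ _ _ _)).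
exists (al + N)%N, be, eta, (al' + N)%N, be', eta'.
have [eq ea] := gl_equiv_sizes (el_gl_equiv E).
exists (esym eq), (esym ea); exact: el_equiv_cl_equiv.
Qed.

Lemma steq_sym q a q' a' (X : 'M[A]_(q, a)) (X' : 'M[A]_(q', a')) :
  steq X X' -> steq X' X.
Proof.
move=> [al [be [eta [al' [be' [eta' E]]]]]].
by exists al', be', eta', al, be, eta; apply: gl_equiv_sym.
Qed.

Lemma gl_equiv_stab_stab q a (X : 'M[A]_(q, a)) al be eta al' be' eta' :
  gl_equiv (stab (stab X al be eta) al' be' eta') (stab X (al + al') (be + be') (eta + eta')).
Proof.
rewrite /stab -dsum0.
apply: (@gl_equiv_trans _ _ _ _ _ _
  (dsum (dsum (dsum (dsum X 1%:M) 1%:M) (0 : 'M_(be, eta))) (0 : 'M_(be', eta')))).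
  apply: gl_equiv_dsum (gl_equiv_refl _).
  apply: (gl_equiv_trans (el_gl_equiv (el_equiv_dsumA _ _ _))).
  apply: (gl_equiv_trans _ (gl_equiv_sym (el_gl_equiv (el_equiv_dsumA _ _ _)))).
  exact: gl_equiv_dsum (gl_equiv_refl _) (gl_equiv_dsumC _ _).
apply: (gl_equiv_trans (el_gl_equiv (el_equiv_dsumA _ _ _))).
apply: gl_equiv_dsum (gl_equiv_refl _).
rewrite -(dsum1 _ al al'); exact: el_gl_equiv (el_equiv_dsumA _ _ _).
Qed.

Lemma gl_equiv_stab q a q' a' (X : 'M[A]_(q, a)) (X' : 'M[A]_(q', a')) al be eta :
  gl_equiv X X' -> gl_equiv (stab X al be eta) (stab X' al be eta).
Proof. by move=> E; do 2!apply: gl_equiv_dsum (gl_equiv_refl _). Qed.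

Lemma steq_trans q a q' a' q'' a'' (X' : 'M[A]_(q', a')) (X : 'M[A]_(q, a))
    (X'' : 'M[A]_(q'', a'')) :
  steq X X' -> steq X' X'' -> steq X X''.
Proof.
move=> [a1 [b1 [c1 [a2 [b2 [c2 E1]]]]]] [a3 [b3 [c3 [a4 [b4 [c4 E2]]]]]].
(* Each equivalence is padded by the other one's stabilization of [X'], so that [X'] ends up with
   both. *)
exists (a1 + a3)%N, (b1 + b3)%N, (c1 + c3)%N, (a4 + a2)%N, (b4 + b2)%N, (c4 + c2)%N.
apply: (gl_equiv_trans (gl_equiv_sym (gl_equiv_stab_stab _ _ _ _ _ _ _))).
apply: (gl_equiv_trans (gl_equiv_stab _ _ _ E1)).
apply: (gl_equiv_trans (gl_equiv_stab_stab _ _ _ _ _ _ _)).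
rewrite (addnC a2) (addnC b2) (addnC c2).
apply: (gl_equiv_trans (gl_equiv_sym (gl_equiv_stab_stab _ _ _ _ _ _ _))).
apply: (gl_equiv_trans (gl_equiv_stab _ _ _ E2)).
exact: gl_equiv_stab_stab.
Qed.

Lemma gl_equiv_dsum00 m n (Y : 'M[A]_(m, n)) (Z : 'M[A]_(0, 0)) : gl_equiv (dsum Y Z) Y.
Proof.
rewrite (_ : Z = 0); last by apply/matrixP => [] [].
rewrite dsum_zero_rowr; apply: gl_equiv_sym.
apply: gl_equiv_trans (el_gl_equiv (el_equiv_cast _ _)).
exists 1%:M, 1%:M, (row_mx 1%:M 0), (col_mx 1%:M 0).
rewrite !mulmx1 mul1mx mul_row_col mul_col_row !mulmx1 !mulmx0 addr0 mul_mx_row mulmx1 mulmx0.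
by split => //; rewrite [RHS]scalar_mx_block; congr block_mx; apply/matrixP => [] [].
Qed.

Lemma stab0 q a (X : 'M[A]_(q, a)) : gl_equiv (stab X 0 0 0) X.
Proof. exact: gl_equiv_trans (gl_equiv_dsum00 _ _) (gl_equiv_dsum00 _ _). Qed.

Lemma gl_steq q a q' a' (X : 'M[A]_(q, a)) (X' : 'M[A]_(q', a')) :
  gl_equiv X X' -> steq X X'.
Proof. by move=> E; exists 0, 0, 0, 0, 0, 0; apply: gl_equiv_stab. Qed.

Lemma steq_stab q a (X : 'M[A]_(q, a)) al be eta : steq X (stab X al be eta).
Proof.
exists al, be, eta, 0, 0, 0; apply: gl_equiv_sym; exact: stab0.
Qed.

Lemma steq_dsum1 q a (X : 'M[A]_(q, a)) n : steq X (dsum X (1%:M : 'M_n)).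
Proof. exact: steq_trans (steq_stab X n 0 0) (gl_steq (gl_equiv_dsum00 _ _)). Qed.

Lemma steq_dsum0 q a (X : 'M[A]_(q, a)) m n : steq X (dsum X (0 : 'M_(m, n))).
Proof.
apply: steq_trans (steq_stab X 0 m n) (gl_steq _).
exact: gl_equiv_dsum (gl_equiv_dsum00 _ _) (gl_equiv_refl _).
Qed.

(** Column operations turn (U | 0) into (U | U T) = (U | V), then into (U - V S | V) = (0 | V); a
    swap finishes. The zero columns come from stabilization. *)
Lemma steq_same_image q a a' (U : 'M[A]_(q, a)) (V : 'M[A]_(q, a')) S T :
  U = V *m S -> V = U *m T -> steq U V.
Proof.
move=> US VT; apply: (steq_trans (steq_dsum0 U 0 a')).
apply: steq_trans (steq_sym (steq_dsum0 V 0 a)); apply: gl_steq.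
rewrite !dsum_zero_rowr.
apply: gl_equiv_trans (el_gl_equiv (el_equiv_cast _ _)).
apply: (gl_equiv_trans (gl_equiv_sym (el_gl_equiv (el_equiv_cast _ _)))).
exists 1%:M, 1%:M,
  (block_mx 1%:M T 0 1%:M *m (block_mx 1%:M 0 (- S) 1%:M *m block_mx 0 1%:M 1%:M 0)),
  (block_mx 0 1%:M 1%:M 0 *m (block_mx 1%:M 0 S 1%:M *m block_mx 1%:M (- T) 0 1%:M)).
have k1 : block_mx 1%:M T 0 1%:M *m block_mx 1%:M (- T) 0 1%:M = 1%:M :> 'M_(a + a').
  rewrite mulmx_block !(mulmx1, mul1mx, mulmx0, mul0mx, addr0, add0r) addNr.
  by rewrite -scalar_mx_block.
have k2 : block_mx 1%:M (- T) 0 1%:M *m block_mx 1%:M T 0 1%:M = 1%:M :> 'M_(a + a').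
  rewrite mulmx_block !(mulmx1, mul1mx, mulmx0, mul0mx, addr0, add0r) subrr.
  by rewrite -scalar_mx_block.
have k3 : block_mx 1%:M 0 (- S) 1%:M *m block_mx 1%:M 0 S 1%:M = 1%:M :> 'M_(a + a').
  rewrite mulmx_block !(mulmx1, mul1mx, mulmx0, mul0mx, addr0, add0r) addNr.
  by rewrite -scalar_mx_block.
have k4 : block_mx 1%:M 0 S 1%:M *m block_mx 1%:M 0 (- S) 1%:M = 1%:M :> 'M_(a + a').
  rewrite mulmx_block !(mulmx1, mul1mx, mulmx0, mul0mx, addr0, add0r) subrr.
  by rewrite -scalar_mx_block.
have k5 m n : block_mx 0 1%:M 1%:M 0 *m block_mx 0 1%:M 1%:M 0 = 1%:M :> 'M[A]_(m + n).
  rewrite mulmx_block !(mulmx1, mul1mx, mulmx0, mul0mx, addr0, add0r).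
  by rewrite -scalar_mx_block.
have mul3 m n p q' (B1 : 'M[A]_(m, n)) B1' (B2 : 'M_(n, p)) B2' (B3 : 'M_(p, q')) B3' :
    B1 *m B1' = 1%:M -> B2 *m B2' = 1%:M -> B3 *m B3' = 1%:M ->
    B1 *m (B2 *m B3) *m (B3' *m (B2' *m B1')) = 1%:M.
  by move=> f1 f2 f3; rewrite -!mulmxA (mulmxA B3) f3 mul1mx (mulmxA B2) f2 mul1mx f1.
split; rewrite ?mulmx1 ?mul1mx //.
- exact: mul3.
- exact: mul3.
- rewrite !mulmxA !mul_row_block !(mulmx1, mul1mx, mulmx0, mul0mx, addr0, add0r) -VT.
  by rewrite mulmxN -US subrr.
Qed.

(* [W] and [V] induce inverse isomorphisms of the cokernels. *)
Lemma steq_coker q a q' a' (phi : 'M[A]_(q, a)) (phi' : 'M[A]_(q', a')) W V X Y S S' :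
  W *m phi = phi' *m X -> V *m phi' = phi *m Y ->
  1%:M - V *m W = phi *m S -> 1%:M - W *m V = phi' *m S' -> steq phi phi'.
Proof.
move=> hX hY hS hS'.
(* Schanuel's argument: the image of [U1] is the kernel of (x, y) |-> x + V y onto coker [phi], that
   of [U2] the kernel of (x, y) |-> W x + y onto coker [phi']. The isomorphism of cokernels makes
   them equal, and each matrix is a stabilization of one of the two given ones up to row
   operations. *)
pose U1 := block_mx phi (- V) 0 1%:M.
pose U2 := block_mx 1%:M 0 (- W) phi'.
have e1 : steq phi U1.
  apply: (steq_trans (steq_dsum1 phi q')); apply: gl_steq.
  exists (block_mx 1%:M (- V) 0 1%:M), (block_mx 1%:M V 0 1%:M), 1%:M, 1%:M.
  rewrite /dsum !mulmx_block !(mulmx1, mul1mx, mulmx0, mul0mx, addr0, add0r).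
  by rewrite addNr subrr -!scalar_mx_block.
have e2 : steq phi' U2.
  apply: (steq_trans (steq_dsum1 phi' q)); apply: gl_steq.
  apply: (gl_equiv_trans (gl_equiv_dsumC _ _)).
  exists (block_mx 1%:M 0 (- W) 1%:M), (block_mx 1%:M 0 W 1%:M), 1%:M, 1%:M.
  rewrite /dsum !mulmx_block !(mulmx1, mul1mx, mulmx0, mul0mx, addr0, add0r).
  by rewrite addNr subrr -!scalar_mx_block.
apply: (steq_trans e1); apply: steq_trans (steq_sym e2).
apply: (@steq_same_image _ _ _ _ _ (block_mx phi (- V) X S') (block_mx S Y (- W) phi')).
  rewrite /U1 /U2 mulmx_block !(mulmx1, mul1mx, mulmx0, mul0mx, addr0, add0r).
  by rewrite !mulNmx mulmxN hX addNr opprK -hS' addrC subrK.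
rewrite /U1 /U2 mulmx_block !(mulmx1, mul1mx, mulmx0, mul0mx, addr0, add0r).
by rewrite !mulNmx mulmxN hY subrr opprK -hS subrK.
Qed.

Definition exact_mx q a c (phi : 'M[A]_(q, a)) (psi : 'M[A]_(a, c)) : Prop :=
  phi *m psi = 0 /\ forall v : 'cV_a, phi *m v = 0 -> exists w, v = psi *m w.

Lemma image_cols q a n (psi : 'M[A]_(q, a)) (V : 'M[A]_(q, n)) :
  (forall i, exists w : 'cV_a, col i V = psi *m w) -> exists W, V = psi *m W.
Proof.
move=> /boolp.choice[w hw]; exists (\matrix_(i, j) w j i 0).
apply/matrixP => i j; have /matrixP/(_ i 0) := hw j.
by rewrite !mxE => ->; apply: eq_bigr => l _; rewrite !mxE.
Qed.

Lemma exact_mx_lift q a c n (phi : 'M[A]_(q, a)) (psi : 'M[A]_(a, c)) (V : 'M[A]_(a, n)) :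
  exact_mx phi psi -> phi *m V = 0 -> exists W, V = psi *m W.
Proof.
move=> [_ ex] V0; apply: image_cols => i; apply: ex.
by rewrite colE mulmxA V0 mul0mx.
Qed.

Lemma steq_col_mx0 q a (X : 'M[A]_(q, a)) n : steq X (col_mx X (0 : 'M_(n, a))).
Proof.
apply: (steq_trans (steq_dsum0 X n 0)); apply: gl_steq.
exists 1%:M, 1%:M, (col_mx 1%:M 0), (row_mx 1%:M 0).
rewrite !mulmx1 mul1mx mul_row_col mul_col_row !mulmx1 !mulmx0 addr0.
rewrite /dsum mul_block_col !(mulmx1, mul1mx, mulmx0, mul0mx, addr0, add0r).
split => //; rewrite [RHS]scalar_mx_block; congr block_mx; apply/matrixP => x y;
  by [case: x | case: y].
Qed.

(** Stabilizing [phi] enlarges its kernel only by the [eta] zero columns, so a matrix onto the new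
    kernel is [psi] with an identity block and zero rows. Two matrices onto the same kernel have the
    same image. *)
Lemma steq_syzygy q a c q' a' c' (phi : 'M[A]_(q, a)) (psi : 'M[A]_(a, c))
    (phi' : 'M[A]_(q', a')) (psi' : 'M[A]_(a', c')) :
  exact_mx phi psi -> exact_mx phi' psi' -> steq phi phi' -> steq psi psi'.
Proof.
move=> ex ex' [al [be [eta [al' [be' [eta' [W [W' [F [F' [h1 h2 h3 h4 h5]]]]]]]]]]].
have cover m n p (f : 'M[A]_(m, n)) (g : 'M[A]_(n, p)) al0 be0 eta0 : exact_mx f g ->
    exists h : 'M[A]_(n + al0 + eta0, p + eta0),
      steq g h /\ exact_mx (stab f al0 be0 eta0) h.
  move=> [fg0 fgex].
  exists (dsum (col_mx g 0) 1%:M); split.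
    apply: steq_trans (steq_dsum1 _ _).
    exact: steq_col_mx0.
  split.
    rewrite /stab dsumM mul0mx /dsum mul_block_col fg0 !mul0mx !mulmx0 !addr0 col_mx0.
    exact: block_mx0.
  move=> v; rewrite -(vsubmxK v) -(vsubmxK (usubmx v)).
  move: (usubmx (usubmx v)) (dsubmx (usubmx v)) (dsubmx v) => v1 v2 v3.
  rewrite /stab /dsum !mul_block_col !mul0mx !addr0 ?add0r mul1mx => /eqP.
  rewrite col_mx_eq0 col_mx_eq0 => /andP[/andP[/eqP/fgex[w ->] /eqP ->] _].
  exists (col_mx w v3).
  by rewrite mul_block_col mul_col_mx !mul0mx !addr0 add0r mul1mx.
have [Y [eY [Y0 exY]]] := cover _ _ _ _ _ al be eta ex.
have [Y' [eY' [Y0' exY']]] := cover _ _ _ _ _ al' be' eta' ex'.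
apply: (steq_trans eY); apply: steq_trans (steq_sym eY').
have exFY : exact_mx (stab phi al be eta) (F *m Y').
  split.
    have -> : stab phi al be eta = W' *m stab phi' al' be' eta' *m F'.
      by rewrite -h5 !mulmxA h2 mul1mx -mulmxA h3 mulmx1.
    by rewrite -!mulmxA (mulmxA F') h4 mul1mx Y0' mulmx0.
  move=> v v0; have [|w hw] := exY' (F' *m v).
    rewrite -h5 -!mulmxA (mulmxA F) h3 mul1mx v0 mulmx0 //.
  by exists w; rewrite -mulmxA -hw mulmxA h3 mul1mx.
apply: (@steq_trans _ _ _ _ _ _ (F *m Y')).
  have [S hS] := exact_mx_lift exFY Y0.
  have [T hT] := exact_mx_lift (conj Y0 exY) exFY.1.
  exact: steq_same_image hS hT.
apply: gl_steq; exists F', F, 1%:M, 1%:M.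
by rewrite !mulmx1 mulmxA h4 mul1mx.
Qed.

End Stable.

(** * Stably free kernels, and a relation that annihilates cohomology *)

Section SplitTail.
Context (A : comNzRingType).

Lemma col_mx_eq0P m n p (X : 'M[A]_(m, p)) (Y : 'M[A]_(n, p)) :
  col_mx X Y = 0 -> X = 0 /\ Y = 0.
Proof. by move/eqP; rewrite col_mx_eq0 => /andP[/eqP ? /eqP ?]. Qed.

(* The kernel of [g] is stably free: in the sum of the source of [g] with a
   free module it has a free complement. *)
Definition stably_free_kernel c b (g : 'M[A]_(c, b)) : Prop :=
  exists s t (tau : 'M[A]_(t, b + s)) (sigma : 'M[A]_(b + s, t)),
    tau *m sigma = 1%:M /\
    forall x : 'cV_(b + s), tau *m x = 0 <-> exists2 v, g *m v = 0 & x = col_mx v 0.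

Lemma stably_free_kernel0 c (g : 'M[A]_(c, 0)) : stably_free_kernel g.
Proof.
exists 0, 0, 0, 0; split=> [|x]; first by apply/matrixP => -[].
by split=> _; [exists 0; first (by rewrite mulmx0); apply/colP => -[] | apply/colP => -[]].
Qed.

(** [psi] maps onto ker [g], which is projective, so ker [psi] splits off. Explicitly, (v, w) |->
    (psi v, 0) + sigma w is a split surjection onto the free module of rank b + s, and
    [tau *m sigma = 1%:M] forces w = 0 on its kernel. *)
Lemma stably_free_kernel_step c b a (g : 'M[A]_(c, b)) (psi : 'M[A]_(b, a)) :
  exact_mx g psi -> stably_free_kernel g -> stably_free_kernel psi.
Proof.
move=> [gpsi ex] [s [t [tau [sigma [ts ker]]]]].
have tpsi n (v : 'M_(a, n)) : tau *m (col_mx psi 0 *m v) = 0.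
  apply/matrixP => i j.
  have : tau *m (col_mx psi 0 *m col j v) = 0.
    apply/ker; exists (psi *m col j v); first by rewrite mulmxA gpsi mul0mx.
    by rewrite mul_col_mx mul0mx.
  by move=> /colP/(_ i); rewrite !colE !mulmxA -colE !mxE.
have [Z hZ] : exists Z, 1%:M - sigma *m tau = col_mx psi (0 : 'M_(s, a)) *m Z.
  apply: image_cols => i.
  have /ker[v /ex[w ->] ->] : tau *m col i (1%:M - sigma *m tau) = 0.
    by rewrite colE mulmxA mulmxBr mulmx1 mulmxA ts mul1mx subrr mul0mx.
  by exists w; rewrite mul_col_mx mul0mx.
exists t, (b + s)%N, (row_mx (col_mx psi 0) sigma), (col_mx Z tau); split.
  by rewrite mul_row_col -hZ subrK.
move=> x; rewrite -(vsubmxK x); move: (usubmx x) (dsubmx x) => v w.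
rewrite mul_row_col; split=> [e|[v' psiv' e]]; last first.
  have [-> ->] := eq_col_mx e.
  by rewrite mulmx0 addr0 mul_col_mx psiv' mul0mx col_mx0.
have w0 : w = 0.
  by have := congr1 (mulmx tau) e; rewrite mulmxDr tpsi add0r mulmxA ts mul1mx mulmx0.
exists v; last by rewrite w0.
by move: e; rewrite w0 mulmx0 addr0 mul_col_mx mul0mx => /col_mx_eq0P[].
Qed.

(** Downward induction, starting where the source of [rho i] is zero. *)
Lemma stably_free_kernel_tail (n : nat -> nat) (rho : forall i, 'M[A]_(n i.+1, n i)) j m :
  (forall i, (j <= i)%N -> exact_mx (rho i.+1) (rho i)) ->
  (forall i, (m <= i)%N -> n i = 0%N) -> stably_free_kernel (rho j).
Proof.
move=> ex n0.
have base i : (m <= i)%N -> stably_free_kernel (rho i).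
  move=> /n0 e; move: (rho i); rewrite e => g; exact: stably_free_kernel0.
have [/base//|jm] := leqP m j.
suff h d i : (i + d = m)%N -> (j <= i)%N -> stably_free_kernel (rho i).
  by apply: (h (m - j)%N) => //; rewrite subnKC // ltnW.
elim: d i => [|d IH] i e ji; first by apply: base; rewrite -e addn0.
apply: (stably_free_kernel_step (ex _ ji)); apply: IH; last exact: leqW.
by rewrite addSnnS.
Qed.

(** The columns of [e] generate ker [g] modulo the image of [psi], with relations [kappa]. By the
    free complement, coker [psi] plus a free module of rank s is this quotient plus a free module of
    rank t; the zero rows put under [psi] and [kappa] account for these two summands. *)
Lemma steq_stably_free c b a N M (g : 'M[A]_(c, b)) (psi : 'M[A]_(b, a))
    (e : 'M[A]_(b, N)) (kappa : 'M[A]_(N, M)) :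
  g *m psi = 0 -> g *m e = 0 -> stably_free_kernel g ->
  (forall v : 'cV_b, g *m v = 0 -> exists c0 y, v = e *m c0 + psi *m y) ->
  (forall c0 : 'cV_N, (exists y, e *m c0 = psi *m y) <-> exists z, c0 = kappa *m z) ->
  steq psi kappa.
Proof.
move=> gpsi ge [s [t [tau [sigma [ts ker]]]]] gen rel.
have tcol n (X : 'M_(b, n)) : g *m X = 0 -> tau *m col_mx X (0 : 'M_(s, n)) = 0.
  move=> gX; apply/matrixP => i j.
  have : tau *m col_mx (col j X) 0 = 0.
    by apply/ker; exists (col j X) => //; rewrite colE mulmxA gX mul0mx.
  have -> : col_mx (col j X) 0 = col j (col_mx X (0 : 'M_(s, n))).
    by rewrite !colE mul_col_mx mul0mx.
  by move=> /colP/(_ i); rewrite colE mulmxA -colE !mxE.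
have lift n (X : 'M_(N, n)) Y : e *m X = psi *m Y -> exists Z, X = kappa *m Z.
  move=> h; apply: image_cols => i; apply/rel; exists (col i Y).
  by rewrite !colE !mulmxA h.
have [Y' hY'] : exists Y', e *m kappa = psi *m Y'.
  apply: image_cols => i.
  have [|y hy] := (rel (kappa *m delta_mx i 0)).2; first by exists (delta_mx i 0).
  by exists y; rewrite colE -mulmxA.
pose e0 : 'M_(b + s, N) := col_mx e 0.
pose psi0 : 'M_(b + s, a) := col_mx psi 0.
(* The projector onto ker [tau], written in generators and boundaries; its upper block [C] gives the
   map of cokernels inverse to [e0]. *)
have [CY hCY] : exists CY, 1%:M - sigma *m tau = row_mx e0 psi0 *m CY.
  apply: image_cols => i.
  have /ker[v /gen[c0 [y ->]] ->] : tau *m col i (1%:M - sigma *m tau) = 0.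
    by rewrite colE mulmxA mulmxBr mulmx1 mulmxA ts mul1mx subrr mul0mx.
  exists (col_mx c0 y).
  by rewrite mul_row_col !mul_col_mx !mul0mx add_col_mx addr0.
move: hCY; rewrite -(vsubmxK CY); move: (usubmx CY) (dsubmx CY) => C Y {CY}.
rewrite mul_row_col => hCY.
have eC n (X : 'M_(b + s, n)) : tau *m X = 0 -> X = e0 *m (C *m X) + psi0 *m (Y *m X).
  by move=> tX; rewrite !mulmxA -mulmxDl -hCY mulmxBl mul1mx -mulmxA tX mulmx0 subr0.
have up n (X : 'M_(b, n)) C' Y0 : col_mx X 0 = e0 *m C' + psi0 *m Y0 -> X = e *m C' + psi *m Y0.
  by rewrite !mul_col_mx !mul0mx add_col_mx addr0 => /eq_col_mx[].
have [X hX] : exists X, C *m psi0 = kappa *m X.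
  apply: (lift _ _ (1%:M - Y *m psi0)).
  have := up _ _ _ _ (eC _ _ (tcol _ _ gpsi)).
  by rewrite mulmxBr mulmx1 => {1}->; rewrite addrK.
have [S1 hS1] : exists X, 1%:M - C *m e0 = kappa *m X.
  apply: (lift _ _ (Y *m e0)).
  have := up _ _ _ _ (eC _ _ (tcol _ _ ge)).
  by rewrite mulmxBr mulmx1 => {1}->; rewrite addrC addKr.
have [S2 hS2] : exists X, - (C *m sigma) = kappa *m X.
  apply: (lift _ _ (Y *m sigma)).
  have : e0 *m (C *m sigma) + psi0 *m (Y *m sigma) = 0.
    by rewrite !mulmxA -mulmxDl -hCY mulmxBl mul1mx -mulmxA ts mulmx1 subrr.
  rewrite !mul_col_mx !mul0mx add_col_mx => /col_mx_eq0P[h _].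
  by rewrite mulmxN; apply/eqP; rewrite eq_sym -addr_eq0 addrC h.
apply: (steq_trans (steq_col_mx0 psi s)); apply: steq_trans (steq_sym (steq_col_mx0 kappa t)).
apply: (@steq_coker _ _ _ _ _ _ _ (col_mx C tau) (row_mx e0 sigma) X Y' Y (row_mx S1 S2)).
- by rewrite !mul_col_mx mul0mx hX tcol.
- by rewrite mul_row_col mulmx0 addr0 !mul_col_mx !mul0mx hY'.
- by rewrite mul_row_col (addrC (e0 *m C)) opprD addrA hCY addrC addKr.
- rewrite mul_col_row ts tcol // mul_col_mx mul0mx mul_mx_row -hS1 -hS2.
  rewrite -row_mx0 -/(block_mx _ _ _ _) scalar_mx_block opp_block_mx add_block_mx.
  by rewrite !sub0r subrr oppr0.
Qed.

(** Equivalently [r - h phi] maps into ker [phi]; in an exact complex this produces a null-homotopy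
    of multiplication by [r]. *)
Definition self_absorbing (r : A) q a (phi : 'M[A]_(q, a)) : Prop :=
  exists h, r *: phi = phi *m h *m phi.

(** [phi] kills [r - h phi], which is therefore some [psi h']; multiplication by [psi] on the right
    removes the term with [phi]. *)
Lemma self_absorbing_exact r q a c (phi : 'M[A]_(q, a)) (psi : 'M[A]_(a, c)) :
  exact_mx phi psi -> self_absorbing r phi -> self_absorbing r psi.
Proof.
move=> ex [h hh]; have [|h' hh'] := exact_mx_lift (V := r%:M - h *m phi) ex.
  by rewrite mulmxBr mul_mx_scalar hh mulmxA subrr.
exists h'; rewrite -hh' mulmxBl mul_scalar_mx -mulmxA.
by case: ex => -> _; rewrite mulmx0 subr0.
Qed.

Lemma self_absorbing_gl r q a q' a' (X : 'M[A]_(q, a)) (X' : 'M[A]_(q', a')) :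
  gl_equiv X X' -> self_absorbing r X -> self_absorbing r X'.
Proof.
move=> [W [W' [F [F' [h1 h2 h3 h4 <-]]]]] [h hh].
exists (F' *m h *m W').
have -> : W *m X *m F *m (F' *m h *m W') *m (W *m X *m F) = W *m (X *m h *m X) *m F.
  by rewrite !mulmxA -(mulmxA _ F F') h3 mulmx1 -(mulmxA _ W' W) h2 mulmx1.
by rewrite -hh -scalemxAr -scalemxAl.
Qed.

Lemma self_absorbing_dsum r q a q' a' (X : 'M[A]_(q, a)) (X' : 'M[A]_(q', a')) :
  self_absorbing r (dsum X X') <-> self_absorbing r X /\ self_absorbing r X'.
Proof.
split=> [[h]|[[h hh] [h' hh']]]; last first.
  by exists (dsum h h'); rewrite !dsumM -hh -hh' /dsum scale_block_mx !scaler0.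
rewrite -(submxK h) /dsum !mulmx_block !mul0mx !mulmx0 !addr0 !add0r scale_block_mx.
by move=> /eq_block_mx[e1 _ _ e2]; split; [exists (ulsubmx h) | exists (drsubmx h)].
Qed.

Lemma self_absorbing_stab r q a (X : 'M[A]_(q, a)) al be eta :
  self_absorbing r (stab X al be eta) <-> self_absorbing r X.
Proof.
rewrite /stab !self_absorbing_dsum; split=> [[[] //]|h]; split; first split=> //.
  by exists r%:M; rewrite mulmx1 mul1mx scalemx1.
by exists 0; rewrite mul0mx mul0mx scaler0.
Qed.

Lemma self_absorbing_stable r q a q' a' (X : 'M[A]_(q, a)) (X' : 'M[A]_(q', a')) :
  stable_cl_equiv X X' -> self_absorbing r X' -> self_absorbing r X.
Proof.
move=> [al [be [eta [al' [be' [eta' [eq [ea [W [F [eW [F' [F1 F2]] e]]]]]]]]]]] h.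
apply/(self_absorbing_stab r X al be eta).
have {h} := (self_absorbing_stab r X' al' be' eta').2 h.
apply: self_absorbing_gl.
apply: gl_equiv_trans (el_gl_equiv (el_equiv_cast _ (eq, ea))) _.
apply: gl_equiv_sym; have [V _ [WV VW]] := elementary_invertible eW.
by exists W, V, F, F'; split.
Qed.

End SplitTail.

(** * Finite free resolutions over Laurent polynomial rings *)

Section FreeResolutions.
Context (A : comNzRingType).

Definition submodule (V : lmodType A) (N : V -> Prop) : Prop :=
  N 0 /\ forall a x y, N x -> N y -> N (a *: x + y).

(** A finite free resolution with at most [d] free modules: length 0 means the zero module, and a
    nonzero free module has length 1. *)
Fixpoint ffr d n (N : 'rV[A]_n -> Prop) : Prop :=
  if d is d'.+1 then
    exists m (G : 'M[A]_(m, n)),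
      (forall v, N v <-> exists w, v = w *m G) /\ ffr d' (fun w => w *m G = 0)
  else forall v, N v -> v = 0.

(** The length may depend on [N]. Finite generation of every submodule is included, so noetherianity
    is proved along with Hilbert's theorem. *)
Definition regular : Prop :=
  forall n (N : 'rV[A]_n -> Prop), submodule N -> exists d, ffr d N.

Lemma submoduleD (V : lmodType A) (N : V -> Prop) x y : submodule N -> N x -> N y -> N (x + y).
Proof. by move=> [_ h] Nx Ny; rewrite -[x]scale1r; apply: h. Qed.

Lemma submoduleZ (V : lmodType A) (N : V -> Prop) a x : submodule N -> N x -> N (a *: x).
Proof. by move=> [h0 h] Nx; rewrite -[_ *: _]addr0; apply: h. Qed.

Lemma submoduleN (V : lmodType A) (N : V -> Prop) x : submodule N -> N x -> N (- x).
Proof. by move=> h Nx; rewrite -scaleN1r; apply: submoduleZ. Qed.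

Lemma submodule_sum (V : lmodType A) (N : V -> Prop) (I : Type) (r : seq I) (P : pred I) (F : I -> V) :
  submodule N -> (forall i, P i -> N (F i)) -> N (\sum_(i <- r | P i) F i).
Proof.
move=> h NF; elim/big_rec: _ => [|i x Pi Nx]; first exact: h.1.
by apply: submoduleD => //; apply: NF.
Qed.

Lemma submodule_mulmx n m (N : 'rV[A]_n -> Prop) (G : 'M[A]_(m, n)) w :
  submodule N -> (forall i, N (row i G)) -> N (w *m G).
Proof.
by move=> h NG; rewrite mulmx_sum_row; apply: submodule_sum => // i _; apply: submoduleZ.
Qed.

Lemma ker_submodule m n (G : 'M[A]_(m, n)) : submodule (fun w : 'rV_m => w *m G = 0).
Proof.
split=> [|a x y hx hy]; first by rewrite mul0mx.
by rewrite mulmxDl -scalemxAl hx hy scaler0 addr0.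
Qed.

Lemma ffr_ext d n (N N' : 'rV[A]_n -> Prop) :
  (forall v, N v <-> N' v) -> ffr d N -> ffr d N'.
Proof.
case: d => [|d] /= h => [N0 v /h/N0 //|[m [G [hG rG]]]].
by exists m, G; split => // v; rewrite -h.
Qed.

Lemma ffrS d n (N : 'rV[A]_n -> Prop) : submodule N -> ffr d N -> ffr d.+1 N.
Proof.
elim: d n N => [|d IH] n N hN.
  move=> /= N0; exists 0, (0 : 'M_(0, n)); split; last by move=> v _; apply/rowP=> -[].
  move=> v; split=> [/N0 ->|[w ->]]; first by exists 0; rewrite mul0mx.
  by rewrite mulmx0; case: hN.
move=> [m [G [hG rG]]]; exists m, G; split=> //.
by apply: IH rG; apply: ker_submodule.
Qed.

Lemma ffr_leq d d' n (N : 'rV[A]_n -> Prop) :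
  (d <= d')%N -> submodule N -> ffr d N -> ffr d' N.
Proof.
move=> le hN; rewrite -(subnKC le); elim: (d' - d)%N => [|e IH]; first by rewrite addn0.
by move=> /IH; rewrite addnS; apply: ffrS.
Qed.

(* [I] embeds [N] in [X], and [x |-> y] with [x P = y T] is a
   surjection of [X] onto [Y] with kernel [N I]. *)
Lemma ffr_horseshoe d l m r s (N : 'rV[A]_l -> Prop) (X : 'rV[A]_m -> Prop)
    (Y : 'rV[A]_r -> Prop) (I : 'M_(l, m)) (P : 'M_(m, s)) (T : 'M_(r, s)) :
  submodule X ->
  (forall w, N w -> X (w *m I) /\ w *m I *m P = 0) ->
  (forall w : 'rV_l, w *m I = 0 -> w = 0) ->
  (forall x, X x -> exists2 y, Y y & x *m P = y *m T) ->
  (forall y, Y y -> exists2 x, X x & x *m P = y *m T) ->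
  (forall y : 'rV_r, y *m T = 0 -> y = 0) ->
  (forall x, X x -> x *m P = 0 -> exists2 w, N w & x = w *m I) ->
  ffr d N -> ffr d Y -> ffr d X.
Proof.
elim: d l m r s N X Y I P T => [|d IH] l m r s N X Y I P T hX NX I0 XY YX T0 XN /=.
  move=> N0 Y0 x Xx; have [y /Y0 -> xP] := XY _ Xx.
  by have [|w /N0 -> ->] := XN _ Xx; rewrite ?xP mul0mx.
move=> [mN [G [hG rG]]] [mY [H [hH rH]]].
have rowY i : Y (row i H) by apply/hH; exists (delta_mx 0 i); rewrite -rowE.
(* Lifts of the generators of [Y]; together with the generators of [N] they generate [X]. The three
   relation modules again satisfy the hypotheses, with [I], [P] and [T] replaced by an inclusion, a
   projection and the identity. *)
have /boolp.choice[L hL] i : exists x, X x /\ x *m P = row i H *m T.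
  by have [x] := YX _ (rowY i); exists x.
pose M := \matrix_i L i.
have rM i : row i M = L i by apply/rowP => j; rewrite !mxE.
have MP : M *m P = H *m T.
  by apply/row_matrixP => i; rewrite !row_mul rM; case: (hL i).
have XM w : X (w *m M) by apply: submodule_mulmx => // i; rewrite rM; case: (hL i).
have NG w : N (w *m G) by apply/hG; exists w.
exists (mN + mY)%N, (col_mx (G *m I) M); split.
  move=> v; split=> [Xv|[w ->]].
    have [y /hH[c ->] vP] := XY _ Xv.
    have [||w /hG[u ->] e] := XN (v - c *m M).
    - by apply: submoduleD => //; apply: submoduleN.
    - by rewrite mulmxBl vP -!mulmxA MP subrr.
    by exists (row_mx u c); rewrite mul_row_col mulmxA -e subrK.
  rewrite -(hsubmxK w) mul_row_col mulmxA; apply: submoduleD => //.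
  by case: (NX _ (NG (lsubmx w))).
apply: (IH _ _ _ _ _ _ _ (row_mx 1%:M 0) (col_mx 0 1%:M) 1%:M _ _ _ _ _ _ _ rG rH).
- exact: ker_submodule.
- move=> w wG; rewrite mul_mx_row mulmx1 mulmx0 !mul_row_col mulmxA wG !mul0mx.
  by rewrite mulmx0 !addr0.
- by move=> w; rewrite mul_mx_row mulmx1 -[0 in X in _ = X -> _]row_mx0 => /eq_row_mx[].
- move=> x; rewrite -(hsubmxK x); move: (lsubmx x) (rsubmx x) => u c.
  rewrite mul_row_col mulmxA => e.
  have e2 : c *m M *m P = 0.
    have := congr1 (mulmx^~ P) e; rewrite mulmxDl mul0mx.
    by have [_ ->] := NX _ (NG u); rewrite add0r.
  exists c; last by rewrite mul_row_col mulmx0 add0r !mulmx1.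
  by apply: T0; rewrite -mulmxA -MP mulmxA.
- move=> c cH; have [||w /hG[u ->] e] := XN (c *m M).
  + exact: XM.
  + by rewrite -mulmxA MP mulmxA cH mul0mx.
  exists (row_mx (- u) c); first by rewrite mul_row_col mulNmx mulmxA e addNr.
  by rewrite mul_row_col mulmx0 add0r !mulmx1.
- by move=> y; rewrite mulmx1.
- move=> x; rewrite -(hsubmxK x); move: (lsubmx x) (rsubmx x) => u c.
  rewrite mul_row_col mulmxA => e; rewrite mul_row_col mulmx0 add0r mulmx1 => c0.
  exists u; last by rewrite mul_mx_row mulmx1 mulmx0 c0.
  by apply: I0; rewrite -e c0 mul0mx addr0.
Qed.

(** A submodule of rank 1 + n rows is an extension of an ideal, its first coordinates, by a
    submodule of rank n rows. *)
Lemma regular_of_ideals :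
  (forall N : 'rV[A]_1 -> Prop, submodule N -> exists d, ffr d N) -> regular.
Proof.
move=> hI; elim=> [|n IH] N hN.
  by exists 0%N => v _; apply/rowP => -[].
have NE a (v v' : 'rV[A]_1) (w w' : 'rV[A]_n) : N (row_mx v w) -> N (row_mx v' w') ->
    N (row_mx (a *: v + v') (a *: w + w')).
  by move=> h h'; rewrite -add_row_mx -scale_row_mx; apply: hN.2.
have N00 : N (row_mx (0 : 'rV[A]_1) (0 : 'rV[A]_n)) by rewrite row_mx0; case: hN.
have h1s : submodule (fun w : 'rV[A]_n => N (row_mx (0 : 'rV_1) w)).
  split=> // a x y hx hy; have := NE a _ _ _ _ hx hy.
  by rewrite scaler0 addr0.
have h2s : submodule (fun y : 'rV[A]_1 => exists w : 'rV_n, N (row_mx y w)).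
  split=> [|a x y [w hw] [z hz]]; first by exists 0.
  by exists (a *: w + z); apply: NE.
have [d1 h1] := IH _ h1s.
have [d2 h2] := hI _ h2s.
exists (maxn d1 d2).
apply: (@ffr_horseshoe _ n (1 + n) 1 1 (fun w => N (row_mx (0 : 'rV_1) w)) N
  (fun y => exists w : 'rV_n, N (row_mx y w)) (row_mx 0 1%:M) (col_mx 1%:M 0) 1%:M) => //.
- move=> w; rewrite mul_mx_row mulmx0 mulmx1 mul_row_col mul0mx mulmx0 addr0.
  by split.
- by move=> w; rewrite mul_mx_row mulmx1 -[0 in X in _ = X -> _]row_mx0 => /eq_row_mx[].
- move=> x; rewrite -(hsubmxK (x : 'rV_(1 + n))); exists (lsubmx (x : 'rV_(1 + n))).
    by exists (rsubmx (x : 'rV_(1 + n))).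
  by rewrite mul_row_col mulmx0 addr0.
- by move=> y [w hw]; exists (row_mx y w) => //; rewrite mul_row_col mulmx0 addr0.
- by move=> y; rewrite mulmx1.
- move=> x; rewrite -(hsubmxK (x : 'rV_(1 + n))) mul_row_col mulmx0 addr0 mulmx1 => hx x0.
  move: hx; rewrite x0 => hx; exists (rsubmx (x : 'rV_(1 + n))) => //.
  by rewrite mul_mx_row mulmx0 mulmx1.
- exact: ffr_leq (leq_maxl _ _) h1s h1.
- exact: ffr_leq (leq_maxr _ _) h2s h2.
Qed.

End FreeResolutions.

Lemma field_regular (k : fieldType) : regular k.
Proof.
apply: regular_of_ideals => N hN; exists 1%N.
have [[v [Nv v0]]|h] := EM (exists v, N v /\ v != 0).
  exists 1%N, 1%:M; split=> [x|x]; last by rewrite mulmx1.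
  split=> [_|_]; first by exists x; rewrite mulmx1.
  have v00 : v 0 0 != 0 by apply: contra_neq v0 => e; apply/rowP => i; rewrite ord1 e mxE.
  rewrite (_ : x = (x 0 0 / v 0 0) *: v); first exact: submoduleZ.
  by apply/rowP => i; rewrite ord1 mxE divfK.
apply: ffrS => // v Nv; apply/eqP/negPn/negP => v0; apply: h.
by exists v.
Qed.

(** * Finite free resolutions under localization *)

Section Localization.
Context (S B : comNzRingType) (f : {rmorphism S -> B}).

Lemma regular_localization :
  injective f -> (forall b, exists s t t', f t * t' = 1 /\ f t * b = f s) ->
  regular S -> regular B.
Proof.
move=> f_inj loc hS n N hN.
have locv m (v : 'rV[B]_m) : exists s t t', f t * t' = 1 /\ f t *: v = map_mx f s.
  elim: m v => [|m IH] v.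
    by exists 0, 1, 1; split; rewrite ?rmorph1 ?mulr1 //; apply/rowP => -[].
  rewrite -[m.+1]/(1 + m)%N in v *.
  have [s [t [t' [tt' e]]]] := IH (rsubmx v).
  have [s1 [t1 [t1' [tt1' e1]]]] := loc (v 0 0).
  exists (row_mx (t * s1)%:M (t1 *: s) : 'rV_(1 + m)), (t * t1), (t1' * t'); split.
    by rewrite rmorphM -mulrA (mulrA (f t1)) tt1' mul1r.
  rewrite -[in LHS](hsubmxK v) map_row_mx scale_row_mx; congr row_mx.
    apply/rowP => i; rewrite ord1 !mxE eqxx mulr1n !rmorphM -mulrA.
    by congr (_ * _); rewrite -e1; congr (_ * v _ _); apply: val_inj.
  by rewrite map_mxZ -e scalerA rmorphM mulrC.
(* The extension of [X] to [B]. Clearing denominators shows that generators of [X] generate it and,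
   since [f] is injective, that its relations are extended from [S] too. *)
pose ext m (X : 'rV[S]_m -> Prop) (v : 'rV[B]_m) :=
  exists s t t', [/\ f t * t' = 1, X s & f t *: v = map_mx f s].
have ext_ffr d m (X : 'rV[S]_m -> Prop) : submodule X -> ffr d X -> ffr d (ext m X).
  elim: d m X => [|d IH] m X hX.
    move=> X0 v [s [t [t' [tt' /X0 -> e]]]].
    by rewrite -[v]scale1r -tt' mulrC -scalerA e map_mx0 scaler0.
  move=> [q [G [hG rG]]]; exists q, (map_mx f G); split.
    move=> v; split=> [[s [t [t' [tt' /hG[w ->] e]]]]|[w ->]].
      exists (t' *: map_mx f w); rewrite -scalemxAl -map_mxM -e scalerA mulrC tt'.
      by rewrite scale1r.
    have [s [t [t' [tt' e]]]] := locv _ w.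
    exists (s *m G), t, t'; split => //; first by apply/hG; exists s.
    by rewrite scalemxAl e map_mxM.
  apply: ffr_ext (IH _ _ (ker_submodule _) rG) => v; split.
    move=> [s [t [t' [tt' sG e]]]].
    rewrite -[v]scale1r -tt' mulrC -scalerA e -scalemxAl -map_mxM sG map_mx0.
    by rewrite scaler0.
  move=> vG; have [s [t [t' [tt' e]]]] := locv _ v.
  exists s, t, t'; split => //; apply/matrixP => i j; apply: f_inj.
  suff /matrixP/(_ i j) : map_mx f (s *m G) = map_mx f 0 by rewrite !mxE.
  by rewrite map_mxM -e -scalemxAl vG scaler0 map_mx0.
(* Every submodule over [B] is the extension of its contraction to [S]. *)
have hX : submodule (fun s => N (map_mx f s)).
  split=> [|a x y hx hy]; first by rewrite map_mx0; case: hN.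
  by rewrite map_mxD map_mxZ; apply: hN.2.
have [d /(ext_ffr _ _ _ hX) r] := hS _ _ hX; exists d; apply: ffr_ext r => v; split.
  move=> [s [t [t' [tt' Ns e]]]].
  by rewrite -[v]scale1r -tt' mulrC -scalerA e; apply: submoduleZ.
move=> Nv; have [s [t [t' [tt' e]]]] := locv _ v.
by exists s, t, t'; split => //; rewrite -e; apply: submoduleZ.
Qed.

End Localization.

(** * Hilbert's syzygy theorem: from A to A[X] *)

Section PolynomialRegular.
Context (A : comNzRingType).
Local Notation B := {poly A}.

Definition coefv n (i : nat) (v : 'rV[B]_n) : 'rV[A]_n := \row_j (v 0 j)`_i.

Lemma coefv_is_zmod n i : zmod_morphism (@coefv n i).
Proof. by move=> v w; apply/rowP => j; rewrite !mxE coefB. Qed.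

HB.instance Definition _ n i :=
  GRing.isZmodMorphism.Build 'rV[B]_n 'rV[A]_n (@coefv n i) (@coefv_is_zmod n i).

Lemma coefvP n (v w : 'rV[B]_n) : (forall i, coefv i v = coefv i w) -> v = w.
Proof.
move=> h; apply/rowP => j; apply/polyP => i.
by have /rowP/(_ j) := h i; rewrite !mxE.
Qed.

Lemma coefv_mul m n i (v : 'rV[B]_m) (G : 'M[A]_(m, n)) :
  coefv i (v *m map_mx polyC G) = coefv i v *m G.
Proof.
apply/rowP => j; rewrite !mxE coef_sum; apply: eq_bigr => l _.
by rewrite !mxE coefMC.
Qed.

Lemma coefv_bound n (v : 'rV[B]_n) : exists s, forall i, (s <= i)%N -> coefv i v = 0.
Proof.
exists (\max_j size (v 0%R j)) => i le; apply/rowP => j; rewrite !mxE nth_default //.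
apply: leq_trans le; exact: (leq_bigmax (F := fun j => size (v 0%R j))).
Qed.

Definition coefv_row n s (F : nat -> 'rV[A]_n) : 'rV[B]_n :=
  \row_j \poly_(i < s) F i 0 j.

Lemma coefv_rowE n s (F : nat -> 'rV[A]_n) i :
  coefv i (coefv_row s F) = if (i < s)%N then F i else 0.
Proof.
by apply/rowP => j; rewrite !mxE coef_poly; case: ifP; rewrite ?mxE.
Qed.

(** The module N[X], that is, [N] extended from A to A[X]. *)
Definition poly_ext n (N : 'rV[A]_n -> Prop) (v : 'rV[B]_n) : Prop :=
  forall i, N (coefv i v).

Lemma poly_ext_image m n (N : 'rV[A]_n -> Prop) (G : 'M[A]_(m, n)) :
  (forall v, N v <-> exists w, v = w *m G) ->
  forall v, poly_ext N v <-> exists w, v = w *m map_mx polyC G.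
Proof.
move=> hG v; split=> [Nv|[w ->] i]; last by apply/hG; exists (coefv i w); rewrite coefv_mul.
have /boolp.choice[w hw] i : exists w, coefv i v = w *m G by apply/hG.
have [s hs] := coefv_bound v.
exists (coefv_row s w); apply: coefvP => i; rewrite coefv_mul coefv_rowE.
by case: ltnP => // /hs ->; rewrite mul0mx.
Qed.

Lemma poly_ext_ker m n (G : 'M[A]_(m, n)) (w : 'rV[B]_m) :
  poly_ext (fun w => w *m G = 0) w <-> w *m map_mx polyC G = 0.
Proof.
split=> [h|h i]; first by apply: coefvP => i; rewrite coefv_mul h raddf0.
by rewrite -coefv_mul h raddf0.
Qed.

Lemma ffr_poly d n (N : 'rV[A]_n -> Prop) : ffr d N -> ffr d (poly_ext N).
Proof.
elim: d n N => [|d IH] n N /=.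
  by move=> N0 v Nv; apply: coefvP => i; rewrite raddf0; apply: N0.
move=> [m [G [hG rG]]]; exists m, (map_mx polyC G); split; first exact: poly_ext_image.
exact: ffr_ext (@poly_ext_ker _ _ G) (IH _ _ rG).
Qed.

(* [row_X v] and [row_1 v] are the coefficient rows of ['X * rVpoly v] and [rVpoly v]
   in one more variable, so [subX_mx] is the matrix of multiplication by [z - 'X]
   from polynomials in [z] of size [<= d] to polynomials in [z] of size [<= d.+1]. *)
Definition row_X d : 'M[A]_(d, d.+1) := \matrix_k delta_mx 0 (lift ord0 k).
Definition row_1 d : 'M[A]_(d, d.+1) := \matrix_k delta_mx 0 (widen_ord (leqnSn d) k).
Definition subX_mx d : 'M[B]_(d, d.+1) :=
  map_mx polyC (row_X d) - 'X *: map_mx polyC (row_1 d).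
Definition powers d : 'M[B]_(d, 1) := \col_k 'X^k.

Lemma rVpoly_mul m n (v : 'rV[A]_m) (M : 'M[A]_(m, n)) :
  rVpoly (v *m M) = \sum_k v 0 k *: rVpoly (row k M).
Proof. by rewrite mulmx_sum_row linear_sum; apply: eq_bigr => k _; rewrite linearZ. Qed.

Lemma rVpolyE n (v : 'rV[A]_n) : rVpoly v = \sum_k v 0 k *: 'X^k.
Proof.
rewrite -[in LHS](mulmx1 v) rVpoly_mul; apply: eq_bigr => k _.
by rewrite rowE mulmx1 rVpoly_delta.
Qed.

Lemma rVpoly_row_X d (v : 'rV[A]_d) : rVpoly (v *m row_X d) = 'X * rVpoly v.
Proof.
rewrite rVpoly_mul rVpolyE mulr_sumr; apply: eq_bigr => k _.
by rewrite rowK rVpoly_delta /= /bump add1n exprS scalerAr.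
Qed.

Lemma rVpoly_row_1 d (v : 'rV[A]_d) : rVpoly (v *m row_1 d) = rVpoly v.
Proof.
rewrite rVpoly_mul rVpolyE; apply: eq_bigr => k _.
by rewrite rowK rVpoly_delta.
Qed.

Lemma rVpoly_powers d (v : 'rV[A]_d) : map_mx polyC v *m powers d = (rVpoly v)%:M.
Proof.
apply/rowP => i; rewrite ord1 !mxE eqxx mulr1n rVpolyE; apply: eq_bigr => k _.
by rewrite !mxE mul_polyC.
Qed.

Lemma coefv_X n i (v : 'rV[B]_n) :
  coefv i ('X *: v) = if i is i'.+1 then coefv i' v else 0.
Proof. by apply/rowP => j; rewrite !mxE coefXM; case: i => [|i] /=; rewrite !mxE. Qed.

Lemma rVpoly_subX_mx d i (xi : 'rV[B]_d) :
  rVpoly (coefv i (xi *m subX_mx d)) =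
  'X * rVpoly (coefv i xi) - (if i is i'.+1 then rVpoly (coefv i' xi) else 0).
Proof.
rewrite /subX_mx mulmxBr -scalemxAr raddfB /= raddfB /= coefv_mul rVpoly_row_X.
rewrite coefv_X; case: i => [|i]; first by rewrite raddf0.
by rewrite coefv_mul rVpoly_row_1.
Qed.

Lemma subX_mx_powers d : subX_mx d *m powers d.+1 = 0.
Proof.
apply/row_matrixP => k; rewrite row0 row_mul /subX_mx raddfB /= [row k (_ *: _)]linearZ /=.
rewrite -!map_row !rowK mulmxBl -scalemxAl !rVpoly_powers !rVpoly_delta /=.
by rewrite /bump add1n scale_scalar_mx -exprS subrr.
Qed.

(** In ascending powers of ['X] the coefficients satisfy z xi_0 = 0 and z xi_(i+1) = xi_i, and z is
    a nonzerodivisor. *)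
Lemma subX_mx_inj d (xi : 'rV[B]_d) : xi *m subX_mx d = 0 -> xi = 0.
Proof.
move=> h; apply: coefvP => i; rewrite raddf0; apply: (can_inj rVpolyK); rewrite raddf0.
elim: i => [|i IH].
  have := rVpoly_subX_mx 0 xi; rewrite h !raddf0 ?subr0 ?addr0 => /esym/polyP e.
  by apply/polyP => l; have := e l.+1; rewrite coefXM !coef0.
have := rVpoly_subX_mx i.+1 xi; rewrite h IH !raddf0 ?subr0 ?addr0 => /esym/polyP e.
by apply/polyP => l; have := e l.+1; rewrite coefXM !coef0.
Qed.

Lemma eval_powers d (eta : 'rV[B]_d) s : (forall i, (s <= i)%N -> coefv i eta = 0) ->
  eta *m powers d = (\sum_(k < s) 'X^k * rVpoly (coefv k eta))%:M.
Proof.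
move=> hs; apply/rowP => i; rewrite ord1 !mxE eqxx mulr1n.
under [RHS]eq_bigr do rewrite rVpolyE mulr_sumr.
rewrite exchange_big /=; apply: eq_bigr => j _; rewrite mxE.
under [RHS]eq_bigr => k _ do rewrite -scalerAr scalerAl.
rewrite -mulr_suml; congr (_ * _).
apply/polyP => k; rewrite coef_sum.
under eq_bigr => l _ do rewrite coefZ coefXn mxE.
case: (ltnP k s) => ks; last first.
  rewrite big1 => [|l _].
    by have /rowP/(_ j) := hs _ ks; rewrite !mxE.
  by case: eqP => e; rewrite ?mulr0 //; move: (ltn_ord l); rewrite -e ltnNge ks.
rewrite (bigD1 (Ordinal ks)) //= eqxx mulr1 big1 ?addr0 // => l lk.
case: eqP => e; rewrite ?mulr0 //; case/eqP: lk; exact: val_inj.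
Qed.

Section Ideal.
Context (regA : regular A) (N : 'rV[B]_1 -> Prop) (hN : submodule N).

Local Notation I f := (N (f : B)%:M).

Lemma ideal_mulD p f g : I f -> I g -> I (p * f + g).
Proof. by move=> If Ig; rewrite raddfD /= -scale_scalar_mx; apply: hN.2. Qed.

Lemma ideal0 : I 0.
Proof. by rewrite raddf0; apply: hN.1. Qed.

Lemma ideal_mul p f : I f -> I (p * f).
Proof. by move=> If; rewrite -[_ * _]addr0; apply: ideal_mulD => //; apply: ideal0. Qed.

Lemma idealB f g : I f -> I g -> I (f - g).
Proof. by move=> If Ig; rewrite addrC -mulN1r; apply: ideal_mulD. Qed.

Lemma ideal_sum (J : Type) (r : seq J) (P : pred J) F :
  (forall i, P i -> I (F i)) -> I (\sum_(i <- r | P i) F i).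
Proof.
move=> h; elim/big_rec: _ => [|i x Pi Ix]; first exact: ideal0.
by rewrite -[F i]mul1r; apply: ideal_mulD => //; apply: h.
Qed.

Definition bounded_part n (v : 'rV[A]_n) : Prop := I (rVpoly v).

Lemma bounded_part_submodule n : submodule (@bounded_part n).
Proof.
split=> [|a x y hx hy]; rewrite /bounded_part ?raddf0; first exact: hN.1.
by rewrite linearP /= -mul_polyC; apply: ideal_mulD.
Qed.

(* Hilbert's basis argument on leading coefficients. *)
Lemma lead_bound : exists d, forall f, I f -> (d < size f)%N ->
  exists g, [/\ I g, (size g <= d.+1)%N & g`_d = lead_coef f].
Proof.
pose L e (c : 'rV[A]_1) := exists f, [/\ I f, (size f <= e.+1)%N & f`_e = c 0 0].
have LS e e' c : (e <= e')%N -> L e c -> L e' c.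
  move=> le [f [If sf fe]]; exists ('X^(e' - e) * f); split.
  - exact: ideal_mul.
  - by apply: leq_trans (size_polyMleq _ _) _; rewrite size_polyXn /=; apply: leq_trans (leq_add (leqnn _) sf) _; rewrite addnS subnK.
  - by rewrite coefXnM ltnNge leq_subr /= subKn.
have hL : submodule (fun c => exists e, L e c).
  split=> [|a x y [e hx] [e' hy]].
    by exists 0%N, 0; split; rewrite ?size_poly0 ?coef0 ?mxE //; apply: ideal0.
  exists (maxn e e').
  have [f [If sf fe]] := LS _ _ _ (leq_maxl e e') hx.
  have [g [Ig sg ge]] := LS _ _ _ (leq_maxr e e') hy.
  exists (a%:P * f + g); split; first exact: ideal_mulD.
    apply: leq_trans (size_polyD _ _) _; rewrite geq_max sg andbT mul_polyC.
    exact: leq_trans (size_scale_leq _ _) sf.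
  by rewrite coefD mul_polyC coefZ fe ge !mxE.
have [d0 rL] := regA hL.
have [m [G [hG _]]] := ffrS hL rL.
have /boolp.choice[e he] i : exists e, L e (row i G).
  by apply/hG; exists (delta_mx 0 i); rewrite -rowE.
pose d := \max_i e i; exists d => f If sf.
have Lsub : submodule (L d).
  split=> [|a x y [f1 [If1 sf1 fe]] [g [Ig sg ge]]].
    by exists 0; split; rewrite ?size_poly0 ?coef0 ?mxE //; apply: ideal0.
  exists (a%:P * f1 + g); split; first exact: ideal_mulD.
    apply: leq_trans (size_polyD _ _) _; rewrite geq_max sg andbT mul_polyC.
    exact: leq_trans (size_scale_leq _ _) sf1.
  by rewrite coefD mul_polyC coefZ fe ge !mxE.
have [w hw] : exists w, (lead_coef f)%:M = w *m G.
  apply/hG; exists (size f).-1; exists f; split=> //; first exact: leqSpred.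
  by rewrite mxE eqxx mulr1n.
have [g [Ig sg ge]] : L d (w *m G).
  apply: submodule_mulmx => // i; apply: (LS _ _ _ _ (he i)).
  exact: (leq_bigmax (F := e)).
by exists g; split; rewrite // ge -hw mxE eqxx mulr1n.
Qed.

(** Let I be the ideal, generated in degree at most d. The sequence 0 -> I_{<d}[X] -> I_{<=d}[X] ->
    I -> 0 is exact, where elements of I_{<=d} are polynomials in z, the first map is multiplication
    by z - X and the second is z := X. Its first two terms are extended from A, where resolutions
    exist. *)
Lemma ideal_ffr : exists d, ffr d N.
Proof.
have [d hd] := lead_bound.
have [e1 r1] := regA (bounded_part_submodule d).
have [e2 r2] := regA (bounded_part_submodule d.+1).
(* [r2] is taken at length [e.+2], so that its first syzygies and [r1] both have length [e.+1], as
   the horseshoe requires. *)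
pose e := maxn e1 e2; exists e.+2.
have {}r1 := ffr_leq (leqW (leq_maxl e1 e2)) (bounded_part_submodule d) r1.
have {}r2 := ffr_leq (leqW (leqW (leq_maxr e1 e2))) (bounded_part_submodule d.+1) r2.
rewrite -/e in r1 r2.
have [m [G [hG rG]]] := r2.
exists m, (map_mx polyC G *m powers d.+1); split.
  move=> v; split; last first.
    move=> [w ->]; apply: submodule_mulmx => // i.
    rewrite row_mul -map_row rVpoly_powers.
    suff : bounded_part (row i G) by [].
    by apply/hG; exists (delta_mx 0 i); rewrite -rowE.
  rewrite (mx11_scalar v); move: (v 0 0) => {v}f.
  have [s] := ubnP (size f); elim: s f => // s IH f /ltnSE sf If.
  have small g : I g -> (size g <= d.+1)%N -> exists w, g%:M = w *m (map_mx polyC G *m powers d.+1).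
    move=> Ig sg; have [w hw] : exists w, poly_rV g = w *m G.
      by apply/hG; rewrite /bounded_part poly_rV_K.
    by exists (map_mx polyC w); rewrite mulmxA -map_mxM -hw rVpoly_powers poly_rV_K.
  have [le|lt] := leqP (size f) d.+1; first exact: small.
  have [g [Ig sg ge]] := hd f If (ltnW lt).
  have [w1 hw1] := small g Ig sg.
  have ef : ((size f).-1 = d + ((size f).-1 - d))%N by rewrite subnKC // -ltnS prednK ?(leq_trans _ lt) // ltnW.
  have [||w2 hw2] := IH (f - 'X^((size f).-1 - d) * g).
  - have f0 : (0 < size f)%N by apply: leq_trans lt.
    apply: leq_trans sf; rewrite -{2}(prednK f0) ltnS.
    apply/leq_sizeP => j; rewrite leq_eqVlt => /orP[/eqP <-|hj].
      rewrite coefB coefXnM ltnNge leq_subr /= subKn; last by rewrite ef leq_addr.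
      by rewrite ge subrr.
    rewrite coefB nth_default; last by rewrite -(prednK f0).
    rewrite nth_default ?subrr //; apply: leq_trans (size_polyMleq _ _) _.
    rewrite size_polyXn /=; apply: leq_trans hj; rewrite {2}ef addnC -addSn.
    by rewrite leq_add2r.
  - by apply: idealB => //; apply: ideal_mul.
  exists (w2 + 'X^((size f).-1 - d) *: w1); rewrite mulmxDl -hw2 -scalemxAl -hw1.
  by rewrite scale_scalar_mx -raddfD /= subrK.
have hP := poly_ext_image hG.
(* Among the relations between the generators of I, those holding already in I_{<=d}[X] form the
   submodule; the quotient is I_{<d}[X] by exactness in the middle. *)
apply: (@ffr_horseshoe _ _ _ _ _ _ (fun w => w *m map_mx polyC G = 0) _
  (poly_ext (@bounded_part d)) 1%:M (map_mx polyC G) (subX_mx d)).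
- exact: ker_submodule.
- by move=> w hw; rewrite mulmx1 mulmxA hw mul0mx.
- by move=> w; rewrite mulmx1.
- move=> w; rewrite mulmxA; set eta := w *m _ => heta.
  have Yeta : poly_ext (@bounded_part d.+1) eta by apply/hP; exists w.
  have [s hs] := coefv_bound eta.
  move: heta; rewrite (eval_powers hs) => /rowP/(_ 0); rewrite !mxE eqxx mulr1n => sum0.
  pose h k := rVpoly (coefv k eta).
  (* The coefficient of ['X^i] in the quotient of [eta] by [z - 'X]. This form shows that it lies in
     the ideal; the form in [Xx], due to the vanishing of the whole sum, bounds its size. *)
  pose x i := - \sum_(k < s | (i < k)%N) 'X^(k - i.+1) * h k.
  have Ix i : I (x i).
    rewrite /x -sub0r; apply: idealB; first exact: ideal0.
    by apply: ideal_sum => k _; apply: ideal_mul; apply: Yeta.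
  have Xx i : 'X^(i.+1) * x i = \sum_(k < s | (k <= i)%N) 'X^k * h k.
    rewrite /x mulrN mulr_sumr; apply/eqP; rewrite eq_sym -subr_eq0 opprK.
    rewrite -[X in _ == X]sum0 [X in _ == X](bigID (fun k : 'I_s => (k <= i)%N)) /=.
    apply/eqP; congr (_ + _).
    apply: eq_big => [k|k ik]; first by rewrite ltnNge.
    by rewrite mulrA -exprD subnKC.
  have sx i : (size (x i) <= d)%N.
    apply/leq_sizeP => j dj.
    have -> : (x i)`_j = ('X^(i.+1) * x i)`_(j + i.+1) by rewrite coefXnM ltnNge leq_addl /= addnK.
    rewrite Xx coef_sum big1 // => k ki; rewrite coefXnM; case: ifP => // _.
    rewrite /h coef_rVpoly insubF //; apply/negbTE; rewrite -leqNgt.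
    by rewrite -addnBA ?(leqW ki) // subSn // addnS ltnS (leq_trans dj) ?leq_addr.
  exists (coefv_row s (fun i => poly_rV (x i))).
    move=> i; rewrite coefv_rowE; case: ifP => _; last by case: (bounded_part_submodule d).
    by rewrite /bounded_part poly_rV_K.
  have xs i : rVpoly (coefv i (coefv_row s (fun i => poly_rV (x i) : 'rV_d))) = x i.
    rewrite coefv_rowE; case: ltnP => si; first by rewrite poly_rV_K.
    rewrite raddf0 /x big1 ?oppr0 // => k ik.
    by have := ltn_trans (ltn_ord k) (leq_ltn_trans si ik); rewrite ltnn.
  apply: coefvP => i; apply: (can_inj rVpolyK); rewrite rVpoly_subX_mx xs.
  case: i => [|i]; last rewrite xs.
    rewrite subr0 -[X in X * _]expr1 Xx -/(h 0%N).
    case: (posnP s) => [s0|s0].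
      rewrite big1 => [|k _]; last by have := leq_trans (ltn_ord k) (eq_leq s0).
      by rewrite /h hs ?s0 // raddf0.
    rewrite (big_pred1 (Ordinal s0)) ?expr0 ?mul1r // => k.
    by rewrite /= leqn0.
  rewrite -/(h i.+1) /x mulrN opprK mulr_sumr addrC.
  have [si|si] := ltnP i.+1 s.
    rewrite (bigD1 (Ordinal si)) //= subnn expr0 mul1r -addrA.
    rewrite -[LHS]addr0; congr (_ + _); apply/esym/eqP; rewrite subr_eq0; apply/eqP.
    apply: eq_big => [k|k].
      by rewrite [RHS]ltn_neqAle andbC eq_sym.
    move=> /andP[ik ki]; rewrite mulrA -exprS; congr ('X^_ * _).
    have : (i.+1 < k)%N by rewrite ltn_neqAle ik andbT; apply: contra ki => /eqP ek; apply/eqP/val_inj; rewrite /= ek.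
    by move=> lt; rewrite -subSn.
  rewrite !big1 ?subr0; first by rewrite /h hs // raddf0.
  - by move=> k ik; have := leq_trans ik (ltnW (leq_trans (ltn_ord k) si)); rewrite ltnn.
  - by move=> k ik; have := leq_trans (ltn_ord k) (leq_trans si ik); rewrite ltnn.
- move=> xi hxi; have [w hw] : exists w, xi *m subX_mx d = w *m map_mx polyC G.
    apply/hP => i; rewrite /bounded_part rVpoly_subX_mx.
    apply: idealB; first by apply: ideal_mul; apply: hxi.
    by case: i => [|i]; [apply: ideal0 | apply: hxi].
  by exists w => //; rewrite mulmxA -hw -mulmxA subX_mx_powers mulmx0.
- exact: subX_mx_inj.
- by move=> w _ hw; exists w; rewrite ?mulmx1.
- exact: (@ffr_ext _ e.+1 _ _ _ (@poly_ext_ker _ _ G) (@ffr_poly e.+1 _ _ rG)).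
- exact: ffr_poly r1.
Qed.

End Ideal.

Theorem regular_poly : regular A -> regular {poly A}.
Proof. by move=> regA; apply: regular_of_ideals => N hN; apply: ideal_ffr. Qed.

End PolynomialRegular.

(** * Functoriality of group algebras, and monomials *)

Section PushForward.
Local Open Scope fset_scope.
Local Open Scope ring_scope.
Context (k : comNzRingType) (G H : zmodType) (f : {additive G -> H}).

Definition gpush (r : galg k G) : galg k H := \sum_(v <- msupp r) gmonom r@_v (f v).

Lemma gpushw (d : {fset G}) (r : galg k G) : msupp r `<=` d ->
  gpush r = \sum_(v <- d) gmonom r@_v (f v).
Proof.
move=> le; rewrite /gpush; apply/big_fset_incl => // v _ /mcoeff_outdom ->.
by rewrite /gmonom monalgU0.
Qed.

Lemma gpushU c v : gpush (gmonom c v) = gmonom c (f v).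
Proof. by rewrite (@gpushw [fset v]) ?msuppU_le // big_seq_fset1 mcoeffUU. Qed.

Lemma gpush_is_zmod_morphism : zmod_morphism gpush.
Proof.
move=> r s; set d := msupp r `|` msupp s.
rewrite (@gpushw d r) ?fsubsetUl // (@gpushw d s) ?fsubsetUr //.
rewrite (@gpushw d) ?msuppB_le // -sumrB; apply: eq_bigr => v _.
by rewrite mcoeffB /gmonom monalgUB.
Qed.

HB.instance Definition _ := GRing.isZmodMorphism.Build (galg k G) (galg k H)
  gpush gpush_is_zmod_morphism.

Lemma gpush_is_monoid_morphism : monoid_morphism gpush.
Proof.
split; first by rewrite gpushU raddf0.
move=> r s; rewrite (galg_sumE r) (galg_sumE s) mulr_suml !(raddf_sum gpush).
rewrite mulr_suml; apply: eq_bigr => v _.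
rewrite !mulr_sumr !(raddf_sum gpush); apply: eq_bigr => w _ /=.
by rewrite gmonomM !gpushU gmonomM raddfD.
Qed.

HB.instance Definition _ := GRing.isMonoidMorphism.Build (galg k G) (galg k H)
  gpush gpush_is_monoid_morphism.

Lemma gpush_monomB1 v : gpush (gmonom 1 v - 1) = gmonom 1 (f v) - 1.
Proof. by rewrite raddfB /= gpushU rmorph1. Qed.

Lemma mcoeff_gpush (r : galg k G) w :
  (gpush r)@_w = \sum_(v <- msupp r) r@_v *+ (f v == w).
Proof. by rewrite raddf_sum; apply: eq_bigr => v _ /=; rewrite mcoeffU. Qed.

End PushForward.

Lemma galg_mulmonom_pow (k : comNzRingType) (G : zmodType) (c : k) (v : G) n :
  gmonom c v ^+ n = gmonom (c ^+ n) (v *+ n).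
Proof.
elim: n => [|n IH]; first by rewrite !expr0 mulr0n.
by rewrite !exprS IH gmonomM mulrS.
Qed.

Section Monomials.
Context (k : comNzRingType) (G : zmodType).
Implicit Types (v w : G) (c : k).

Lemma gmonom1 : gmonom 1 0 = 1 :> galg k G.
Proof. by []. Qed.

Lemma gmonomV v : gmonom 1 v * gmonom 1 (- v) = 1 :> galg k G.
Proof. by rewrite gmonomM subrr mulr1 gmonom1. Qed.

Lemma gmonom1M c v w : gmonom 1 v * gmonom c w = gmonom c (v + w) :> galg k G.
Proof. by rewrite gmonomM mul1r. Qed.

Lemma gmonomM1 c v w : gmonom c w * gmonom 1 v = gmonom c (v + w) :> galg k G.
Proof. by rewrite mulrC gmonom1M. Qed.

Lemma mcoeff_gmonom c v w : (gmonom c v : galg k G)@_w = c *+ (v == w).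
Proof. exact: mcoeffU. Qed.

Lemma gbar_monomB1 v : gbar (gmonom 1 v - 1 : galg k G) = gmonom 1 (- v) - 1.
Proof. by rewrite raddfB /= gbarU rmorph1. Qed.

Lemma gmonom_inj c c' v : gmonom c v = gmonom c' v :> galg k G -> c = c'.
Proof. by move=> e; have := congr1 (mcoeff v) e; rewrite !mcoeff_gmonom eqxx. Qed.

End Monomials.

(** * Laurent polynomials: adjoining one invertible variable *)

Section LaurentStep.
Context (k : comNzRingType) (D : nat).
Local Notation A := (galg k 'rV[int]_D).
Local Notation B := (galg k 'rV[int]_(1 + D)).

Let emb (v : 'rV[int]_D) : 'rV[int]_(1 + D) := row_mx 0 v.

Fact emb_is_zmod_morphism : zmod_morphism emb.
Proof. by move=> v w; rewrite /emb opp_row_mx add_row_mx subrr. Qed.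

HB.instance Definition _ := GRing.isZmodMorphism.Build _ _ emb emb_is_zmod_morphism.

Let e0 : 'rV[int]_(1 + D) := row_mx (const_mx 1) 0.
Let x : B := gmonom 1 e0.

Fact x_comm : commr_rmorph (gpush (k := k) emb) x.
Proof. by move=> r; apply: mulrC. Qed.

Let iota : {rmorphism {poly A} -> B} := horner_morph x_comm.

Let xn n : x ^+ n = gmonom 1 (e0 *+ n).
Proof. by rewrite galg_mulmonom_pow expr1n. Qed.

Let e0n n : e0 *+ n = row_mx (const_mx n%:Z) 0.
Proof.
apply/rowP => i; rewrite mulmxnE !mxE; case: fintype.split => j; rewrite !mxE ?mul0rn //.
by rewrite natz.
Qed.

Let mcoeff_iota (p : {poly A}) (n : nat) (v : 'rV[int]_D) :
  (iota p)@_(row_mx (const_mx n%:Z) v) = (p`_n)@_v.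
Proof.
rewrite /iota /= /horner_morph horner_coef raddf_sum /=.
have coef (i : nat) : ((map_poly (gpush emb) p)`_i * x ^+ i)@_(row_mx (const_mx n%:Z) v)
    = (p`_i)@_v *+ (i == n).
  rewrite coef_map xn mcoeff_mulmonom e0n opp_row_mx add_row_mx subr0 /= mcoeff_gpush.
  rewrite -(sum_msupp_pick p`_i v) -sumrMnl; apply: eq_bigr => w _.
  rewrite -mulrnA mulnb; congr (_ *+ (nat_of_bool _)).
  rewrite /emb; apply/eqP/andP => [/eq_row_mx[h ->]|[/eqP -> /eqP ->]]; last first.
    by congr row_mx; apply/rowP => i'; rewrite !mxE subrr.
  split => //; have /rowP/(_ 0) := h; rewrite !mxE => /esym/eqP.
  by rewrite subr_eq0 eqz_nat eq_sym.
under eq_bigr do rewrite coef.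
have [lt|le] := ltnP n (size (map_poly (gpush emb) p)).
  rewrite (bigD1 (Ordinal lt)) //= eqxx big1 ?addr0 // => i ni.
  by rewrite (_ : (_ == _) = false) //; apply/negbTE.
rewrite big1 => [|i _]; last first.
  by rewrite (_ : (_ == _) = false) //; apply/ltn_eqF/(leq_trans (ltn_ord i)).
move: le => /leq_sizeP/(_ n (leqnn _)); rewrite coef_map /= => h.
have := congr1 (mcoeff (emb v)) h; rewrite mcoeff0 mcoeff_gpush => h0.
rewrite -h0 -(sum_msupp_pick p`_n v); apply: eq_bigr => w _.
congr (_ *+ (nat_of_bool _)); apply/eqP/eqP => [/eq_row_mx[]|->] //.
Qed.

Let iota_inj : injective iota.
Proof.
apply: raddf_inj => p p0; apply/polyP => n; apply/malgP => v.
by rewrite -mcoeff_iota (p0 : iota p = 0) coef0 !mcoeff0.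
Qed.

Let iotaX : iota 'X = x.
Proof. exact: horner_morphX. Qed.

Let iotaC r : iota r%:P = gpush emb r.
Proof. exact: horner_morphC. Qed.

Let iota_loc b : exists s t t', iota t * t' = 1 /\ iota t * b = iota s.
Proof.
(* The powers of [x] suffice as denominators: one of them clears the negative exponents of the
   finitely many monomials of [b]. *)
suff [n [s e]] : exists n s, x ^+ n * b = iota s.
  exists s, ('X^n), (gmonom 1 (- (e0 *+ n))); rewrite (rmorphXn iota) /= iotaX; split; last exact: e.
  by rewrite xn; exact: gmonomV.
rewrite (galg_sumE b); elim/big_rec: _ => [|w c _ [n [s e]]].
  by exists 0%N, 0; rewrite mulr0 raddf0.
move: (b@_w) => a; rewrite -(hsubmxK w); move: (lsubmx w) (rsubmx w) => {w} w v.
pose l := w 0 0.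
have [m hm] : exists m : nat, l + `|l|%N%:Z = m%:Z.
  by case: l => l; [exists (l + l)%N | exists 0%N; rewrite NegzE /= addNr].
pose N := `|l|%N.
have e1 : x ^+ N * gmonom a (row_mx w v) = gpush emb (gmonom a v) * x ^+ m.
  rewrite !xn [RHS](congr1 (fun r => r * _) (gpushU _ _ _)).
  apply: etrans (gmonom1M _ _ _) (etrans _ (esym (gmonomM1 _ _ _))).
  rewrite !e0n /emb; congr gmonom.
  rewrite !add_row_mx !addr0 !add0r; congr row_mx; apply/rowP => i.
  by rewrite ord1 !mxE addrC hm.
have comb (C : comNzRingType) (y z g c' q : C) : y * g = q -> y * z * (g + c') = y * (z * c') + z * q.
  by move=> <-; rewrite mulrDr addrC (mulrC y z) -!mulrA (mulrCA z y c').
exists (N + n)%N, ('X^N * s + 'X^n * ((gmonom a v : A)%:P * 'X^m)).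
rewrite exprD (comb _ _ _ _ _ _ e1) e raddfD /= !rmorphM /= !rmorphXn /= iotaX iotaC.
by [].
Qed.

Lemma regular_laurent_step : regular A -> regular B.
Proof.
move=> hA; apply: (@regular_localization _ _ iota iota_inj iota_loc).
exact: regular_poly.
Qed.

End LaurentStep.

Lemma laurent_regular (k : fieldType) D : regular (galg k 'rV[int]_D).
Proof.
elim: D => [|D IH]; last exact: regular_laurent_step IH.
(* For [D = 0] the group is trivial and the group algebra is [k] itself, handled as a localization
   with denominator 1. *)
pose c (a : k) : galg k 'rV[int]_0 := gmonom a 0.
have cZ : zmod_morphism c by move=> a b; rewrite /c /gmonom monalgUB.
have cM : monoid_morphism c by split => // a b; rewrite /c gmonomM addr0.
pose cm := GRing.isZmodMorphism.Build _ _ c cZ.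
pose cm' := GRing.isMonoidMorphism.Build _ _ c cM.
pose cr : {rmorphism k -> galg k 'rV[int]_0} := HB.pack c cm cm'.
suff [h1 h2] : injective cr /\ forall b : galg k 'rV[int]_0,
    exists s t t', cr t * t' = 1 /\ cr t * b = cr s.
  exact: (@regular_localization k (galg k 'rV[int]_0) cr h1 h2 (@field_regular k)).
split=> [a b e|b].
  have {}e : gmonom a 0 = gmonom b 0 :> galg k 'rV[int]_0 by exact: e.
  exact: gmonom_inj e.
exists b@_0, 1, 1; rewrite (rmorph1 cr) !mul1r; split; first by [].
suff e : b = gmonom b@_0 0 by exact: e.
by apply/malgP => v; rewrite [v](_ : _ = 0) ?mcoeff_gmonom ?eqxx //; apply/rowP => -[].
Qed.

(** * Ext from a free resolution by matrices *)

Section Comparison.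
Local Open Scope fset_scope.
Local Open Scope ring_scope.
Context (R : comNzRingType).

Lemma linear_packed (V W : lmodType R) (f : V -> W) :
  linear f -> exists g : {linear V -> W}, forall x, g x = f x.
Proof.
move=> lf; pose m := GRing.isLinear.Build R V W *:%R f lf.
by exists (HB.pack f m : {linear V -> W}).
Qed.

(** Projectivity, with [g] onto the image of [f] only; this applies to a differential without
    forming its kernel or image as a module. *)
Definition lifting (P : lmodType R) : Prop :=
  forall (V W : lmodType R) (g : {linear W -> V}) (f : {linear P -> V}),
    (forall x, exists w, g w = f x) ->
    exists h : {linear P -> W}, forall x, g (h x) = f x.

Lemma lifting_rV n : lifting 'rV[R]_n.
Proof.
move=> V W g f gf.
have /boolp.choice[w hw] i : exists w, g w = f (delta_mx 0 i) by [].
have [|h hh] := @linear_packed 'rV[R]_n W (fun x => \sum_i x 0 i *: w i).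
  move=> a x y; rewrite scaler_sumr -big_split; apply: eq_bigr => i _.
  by rewrite !mxE scalerDl scalerA.
exists h => x; rewrite hh linear_sum [x in f x]row_sum_delta linear_sum.
by apply: eq_bigr => i _; rewrite !linearZ /= hw.
Qed.

Lemma lifting_freemod (M : lmodType R) : lifting (freemod M).
Proof.
move=> V W g f gf.
have /boolp.choice[w hw] m : exists w, g w = f << 1 *g m >> by [].
have sumw (d : {fset M}) (x : freemod M) : msupp x `<=` d ->
    \sum_(m <- msupp x) x@_m *: w m = \sum_(m <- d) x@_m *: w m.
  by move=> le; apply/big_fset_incl => // m _ /mcoeff_outdom ->; rewrite scale0r.
have [|h hh] := @linear_packed (freemod M) W (fun x => \sum_(m <- msupp x) x@_m *: w m).
  move=> a x y; set d := msupp x `|` msupp y.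
  rewrite (sumw d x) ?fsubsetUl // (sumw d y) ?fsubsetUr // (sumw d).
    rewrite scaler_sumr -big_split; apply: eq_bigr => m _ /=.
    by rewrite mcoeffD mcoeffZ scalerDl scalerA.
  by apply: fsubset_trans (msuppD_le _ _) _; apply: fsetSU; exact: msuppZ_le.
exists h => x; rewrite hh linear_sum [in RHS](monalgE x) linear_sum.
apply: eq_bigr => m _; rewrite linearZ /= hw -linearZ /=; congr (f _).
by apply/malgP => l; rewrite mcoeffZ !mcoeffU mulr_natr.
Qed.

Section Complexes.
Context (P P' : nat -> lmodType R).
Context (d : forall i, {linear P i.+1 -> P i}) (d' : forall i, {linear P' i.+1 -> P' i}).
Hypothesis (projP : forall i, lifting (P i)) (projP' : forall i, lifting (P' i)).
Hypothesis exP : forall i x, d i x = 0 <-> exists y, d i.+1 y = x.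
Hypothesis exP' : forall i x, d' i x = 0 <-> exists y, d' i.+1 y = x.

(* [r] stands for the summand [s \o d] of a chain homotopy from [b \o a] to the identity. *)
Definition homotopic i (a : {linear P i -> P' i}) (b : {linear P' i -> P i})
    (r : {linear P i -> P i}) (r' : {linear P' i -> P' i}) : Prop :=
  [/\ forall y, exists z, a (d i y) = d' i z,
      forall z, exists y, b (d' i z) = d i y,
      (forall y, r (d i y) = 0) /\ (forall z, r' (d' i z) = 0),
      forall x, exists y, x - b (a x) - r x = d i y
    & forall x, exists z, x - a (b x) - r' x = d' i z].

(** The comparison theorem one degree at a time: [a1] and [b1] lift [a] and [b] along the
    differentials, and [s], [s'] lift the defects left in degree [i]. *)
Lemma homotopicS i a b r r' : @homotopic i a b r r' ->
  exists a1 b1 r1 r1', [/\ @homotopic i.+1 a1 b1 r1 r1',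
    (forall x, d' i (a1 x) = a (d i x)) /\ (forall x, d i (b1 x) = b (d' i x)),
    exists s : {linear P i -> P i.+1}, forall x, r1 x = s (d i x)
  & exists s : {linear P' i -> P' i.+1}, forall x, r1' x = s (d' i x)].
Proof.
move=> [h1 h2 [h3 h3'] h4 h4'].
have [a1 ha1] : exists a1 : {linear P i.+1 -> P' i.+1}, forall x, d' i (a1 x) = a (d i x).
  have [|a1 ha1] := @projP i.+1 _ _ (d' i) (a \o d i : {linear _ -> _}).
    by move=> x; have [z hz] := h1 x; exists z; rewrite /= hz.
  by exists a1.
have [b1 hb1] : exists b1 : {linear P' i.+1 -> P i.+1}, forall x, d i (b1 x) = b (d' i x).
  have [|b1 hb1] := @projP' i.+1 _ _ (d i) (b \o d' i : {linear _ -> _}).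
    by move=> x; have [z hz] := h2 x; exists z; rewrite /= hz.
  by exists b1.
have [s hs] : exists s : {linear P i -> P i.+1}, forall x, d i (s x) = x - b (a x) - r x.
  have [|s hs] := @projP i _ _ (d i) ((idfun \- (b \o a)) \- r : {linear _ -> _}).
    by move=> x; have [z hz] := h4 x; exists z; rewrite /= hz.
  by exists s.
have [s' hs'] : exists s : {linear P' i -> P' i.+1}, forall x, d' i (s x) = x - a (b x) - r' x.
  have [|s' hs'] := @projP' i _ _ (d' i) ((idfun \- (a \o b)) \- r' : {linear _ -> _}).
    by move=> x; have [z hz] := h4' x; exists z; rewrite /= hz.
  by exists s'.
have dd y : d i (d i.+1 y) = 0 by apply/exP; exists y.
have dd' y : d' i (d' i.+1 y) = 0 by apply/exP'; exists y.
exists a1, b1, (s \o d i : {linear _ -> _}), (s' \o d' i : {linear _ -> _}).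
split=> //; last 2 first.
- by exists s.
- by exists s'.
split.
- move=> y; have /exP'[z hz] : d' i (a1 (d i.+1 y)) = 0 by rewrite ha1 dd raddf0.
  by exists z.
- move=> y; have /exP[z hz] : d i (b1 (d' i.+1 y)) = 0 by rewrite hb1 dd' raddf0.
  by exists z.
- by split=> y /=; rewrite ?dd ?dd' raddf0.
- move=> x; have /exP[z hz] : d i (x - b1 (a1 x) - s (d i x)) = 0.
    rewrite !raddfB /= hs hb1 ha1 h3 subr0 subrr //.
  by exists z.
- move=> x; have /exP'[z hz] : d' i (x - a1 (b1 x) - s' (d' i x)) = 0.
    rewrite !raddfB /= hs' ha1 hb1 h3' subr0 subrr //.
  by exists z.
Qed.

Section Resolutions.
Context (M : lmodType R) (e : {linear P 0 -> M}) (e' : {linear P' 0 -> M}).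
Hypothesis (surj : forall m, exists x, e x = m) (surj' : forall m, exists x, e' x = m).
Hypothesis exM : forall x, e x = 0 <-> exists y, d 0 y = x.
Hypothesis exM' : forall x, e' x = 0 <-> exists y, d' 0 y = x.

Lemma homotopic_exists i : exists a b r r', @homotopic i a b r r'.
Proof.
elim: i => [|i [a [b [r [r' h]]]]]; last first.
  by have [a1 [b1 [r1 [r1' [h1 _ _ _]]]]] := homotopicS h; exists a1, b1, r1, r1'.
have [|a ha] := @projP 0 _ _ e' e; first by move=> x; apply: surj'.
have [|b hb] := @projP' 0 _ _ e e'; first by move=> x; apply: surj.
exists a, b, (\0 : {linear _ -> _}), (\0 : {linear _ -> _}); split.
- move=> y; have /exM'[z hz] : e' (a (d 0 y)) = 0 by rewrite ha; apply/exM; exists y.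
  by exists z.
- move=> y; have /exM[z hz] : e (b (d' 0 y)) = 0 by rewrite hb; apply/exM'; exists y.
  by exists z.
- by [].
- move=> x; have /exM[z hz] : e (x - b (a x) - \0 x) = 0.
    by rewrite !raddfB /= hb ha subrr sub0r raddf0 oppr0.
  by exists z.
- move=> x; have /exM'[z hz] : e' (x - a (b x) - \0 x) = 0.
    by rewrite !raddfB /= ha hb subrr sub0r raddf0 oppr0.
  by exists z.
Qed.

(** Pullback along [a] is an isomorphism on the cohomology of Hom into [N]: the clauses say that
    cocycles go to cocycles, coboundaries to coboundaries, and that the map on classes is injective
    and surjective. *)
Lemma cohomology_comparison i (N : lmodType R) :
  exists a : {linear P i.+1 -> P' i.+1},
  [/\ forall v : {linear P' i.+1 -> N}, (forall z, v (d' i.+1 z) = 0) ->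
        forall y, v (a (d i.+1 y)) = 0,
      forall g : {linear P' i -> N}, exists h : {linear P i -> N},
        forall x, g (d' i (a x)) = h (d i x),
      forall (v : {linear P' i.+1 -> N}) (h : {linear P i -> N}),
        (forall z, v (d' i.+1 z) = 0) -> (forall x, v (a x) = h (d i x)) ->
        exists g : {linear P' i -> N}, forall x, v x = g (d' i x)
    & forall f : {linear P i.+1 -> N}, (forall y, f (d i.+1 y) = 0) ->
        exists (v : {linear P' i.+1 -> N}) (h : {linear P i -> N}),
          (forall z, v (d' i.+1 z) = 0) /\ forall x, f x = v (a x) + h (d i x)].
Proof.
have [a [b [r [r' h]]]] := homotopic_exists i.
have [a1 [b1 [r1 [r1' [[h1 h2 [h3 h3'] h4 h4'] [ha hb] [s hs] [s' hs']]]]]] := homotopicS h.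
exists a1; split.
- by move=> v hv y; have [z ->] := h1 y.
- by move=> g; exists (g \o a : {linear _ -> _}) => x; rewrite ha.
- move=> v g hv hg; exists ((v \o s') \+ (g \o b) : {linear _ -> _}) => x /=.
  have [z hz] := h4' x; have := hv z; rewrite -hz !raddfB /= hs' hg hb => /eqP.
  by rewrite subr_eq0 subr_eq addrC => /eqP ->; rewrite addrC.
- move=> f hf; exists (f \o b1 : {linear _ -> _}), (f \o s : {linear _ -> _}).
  split=> [z|x] /=; first by have [y ->] := h2 z.
  have [z hz] := h4 x; have := hf z; rewrite -hz !raddfB /= hs => /eqP.
  by rewrite subr_eq0 subr_eq addrC => /eqP.
Qed.

End Resolutions.
End Complexes.
End Comparison.

(** * Resolutions by matrices, and Ext computed from them *)

Section Resolution.
Context (R : comNzRingType).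

(* The maps act on row vectors: [rho i] goes from ['rV_(n i.+1)] to ['rV_(n i)]. *)
Definition row_exact (n : nat -> nat) (rho : forall i, 'M[R]_(n i.+1, n i)) : Prop :=
  forall i (w : 'rV_(n i.+1)), w *m rho i = 0 <-> exists z, w = z *m rho i.+1.

Lemma free_resolution q a (psi : 'M[R]_(a, q)) : regular R ->
  exists (n : nat -> nat) (rho : forall i, 'M[R]_(n i.+1, n i)) (eq : n 0%N = q) (ea : n 1%N = a),
    [/\ castmx (ea, eq) (rho 0%N) = psi, row_exact rho
      & exists m, forall i, (m <= i)%N -> n i = 0%N].
Proof.
move=> regR.
(* A state holds one differential and a bound on the length of its kernel. The target size of the
   next state is convertible to the source size of the present one, so the matrices form a family
   without casts. *)
pose T := {d : nat & {n0 : nat & {n1 : nat & {G : 'M[R]_(n1, n0) |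
             ffr d (fun w : 'rV_n1 => w *m G = 0)}}}}.
have [d0 r0] := regR _ _ (ker_submodule psi).
pose mk d n0 n1 G r : T := existT _ d (existT _ n0 (existT _ n1 (exist _ G r))).
pose dd (t : T) := projT1 t.
pose n0 (t : T) := projT1 (projT2 t).
pose n1 (t : T) := projT1 (projT2 (projT2 t)).
pose GG (t : T) : 'M_(n1 t, n0 t) := sval (projT2 (projT2 (projT2 t))).
have next (t : T) : {c : nat * {n2 : nat & 'M[R]_(n2, n1 t)} |
    [/\ ffr c.1 (fun w : 'rV_(projT1 c.2) => w *m projT2 c.2 = 0),
        forall w : 'rV_(n1 t), w *m GG t = 0 <-> exists z, w = z *m projT2 c.2
      & c.1 = (dd t).-1 /\ (dd t = 0%N -> projT1 c.2 = 0%N)]}.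
  apply: boolp.cid; case: t => d [m0 [m1 [G r]]]; rewrite /n1 /GG /dd /=.
  case: d r => [|d] /= r.
    exists (0%N, existT _ 0%N (0 : 'M_(0, m1))); split => //=.
      by move=> v _; apply/rowP => -[].
    move=> w; split=> [h|[z ->]]; first by exists 0; rewrite mul0mx; apply: r h.
    by rewrite mulmx0 mul0mx.
  case: r => m2 [G2 [h r]].
  by exists (d, existT _ m2 G2).
pose nx (t : T) : T := mk (sval (next t)).1 (n1 t) (projT1 (sval (next t)).2)
  (projT2 (sval (next t)).2) (let: And3 h _ _ := svalP (next t) in h).
pose st i := iter i nx (mk d0 q a psi r0).
exists (fun i => n0 (st i)), (fun i => GG (st i)), erefl, erefl.
rewrite castmx_id; split => //.
  by move=> i w; case: (svalP (next (st i))).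
have hd i : dd (st i) = (d0 - i)%N.
  elim: i => [|i IH]; first by rewrite subn0.
  by rewrite subnS -IH; case: (svalP (next (st i))) => _ _ [].
(* State [d0] has bound 0, so the module covering its kernel is zero; this module becomes the target
   two states later. *)
exists d0.+2 => i; case: i => // -[//|i]; rewrite !ltnS => le.
by case: (svalP (next (st i))) => _ _ [_]; apply; rewrite hd; apply/eqP.
Qed.

Section ExtComparison.
Context (M : lmodType R) (n : nat -> nat) (rho : forall i, 'M[R]_(n i.+1, n i)).
Context (pi : {linear 'rV[R]_(n 0%N) -> M}).
Hypothesis (pi_surj : forall m, exists x, pi x = m).
Hypothesis (pi_ker : forall x, pi x = 0 <-> exists y, x = y *m rho 0).
Hypothesis (rho_exact : row_exact rho).

Lemma linear_form m (f : {linear 'rV[R]_m -> R^o}) :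
  exists v : 'cV[R]_m, forall x, f x = (x *m v) 0 0.
Proof.
exists (\col_i f (delta_mx 0 i)) => x.
rewrite [x in LHS]row_sum_delta linear_sum mxE; apply: eq_bigr => i _.
by rewrite linearZ mxE.
Qed.

Lemma column_form m (v : 'cV[R]_m) :
  exists f : {linear 'rV[R]_m -> R^o}, forall x, f x = (x *m v) 0 0.
Proof.
apply: (@linear_packed _ 'rV[R]_m R^o (fun x => (x *m v) 0 0)) => a x y.
by rewrite mulmxDl -scalemxAl !mxE.
Qed.

Lemma row_eq0_col m l (G : 'M[R]_(m, l)) (v : 'cV[R]_l) :
  (forall x : 'rV_m, (x *m G *m v) 0 0 = 0) <-> G *m v = 0.
Proof.
split=> [h|e x]; last by rewrite -mulmxA e mulmx0 mxE.
apply/colP => i; have := h (delta_mx 0 i); rewrite -rowE -row_mul => e.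
by rewrite [RHS]mxE -[RHS]e !mxE.
Qed.

(** A column [v] is the linear form x |-> x v; [theta] pulls it back to the canonical resolution and
    takes its class. As the modules consist of rows, the dual complex is left multiplication by the
    same [rho], with no transpose. *)
Lemma Ext_matrix i : exists theta : 'cV[R]_(n i.+1) -> Ext i.+1 M R^o,
  [/\ forall a v w, rho i.+1 *m v = 0 -> rho i.+1 *m w = 0 ->
        theta (a *: v + w) = a *: theta v + theta w,
      forall v, rho i.+1 *m v = 0 -> theta v = 0 <-> exists w, v = rho i *m w
    & forall e, exists2 v, rho i.+1 *m v = 0 & theta v = e].
Proof.
have := @cohomology_comparison R (resol M) (fun i => 'rV[R]_(n i))
  (fun i => @resol_d R M i) (fun i => mulmxr (rho i))
  (fun i => @lifting_freemod R (syzygy M i)) (fun i => @lifting_rV R (n i)).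
case/(_ _ _ M (augm (M := M)) pi _ _ _ _ i R^o).
- exact: resol_exact.
- move=> l x /=; rewrite rho_exact; split=> -[y] h; exists y; exact: esym.
- exact: augm_surj.
- exact: pi_surj.
- exact: resol_exact0.
- move=> x /=; rewrite pi_ker; split=> -[y] h; exists y; exact: esym.
move=> al [h1 h2 h3 h4].
have cf (v : 'cV[R]_(n i.+1)) : {f : {linear 'rV[R]_(n i.+1) -> R^o} | forall x, f x = (x *m v) 0 0}.
  by apply: boolp.cid; apply: column_form.
have cfi (v : 'cV[R]_(n i)) : {f : {linear 'rV[R]_(n i) -> R^o} | forall x, f x = (x *m v) 0 0}.
  by apply: boolp.cid; apply: column_form.
have clin (v : 'cV[R]_(n i.+1)) : sval (cf v) \o al \in @linhom_pred R (resol M i.+1) R^o.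
  by apply/boolp.asboolP => a x y /=; rewrite !linearP.
pose c (v : 'cV[R]_(n i.+1)) : cochain M R^o i.+1 := Sub (sval (cf v) \o al) (clin v).
have cE v x : val (c v) x = (al x *m v) 0 0 by rewrite /= (svalP (cf v)).
have cP a v w : c (a *: v + w) = a *: c v + c w.
  apply: val_inj; apply/boolp.funext => x; rewrite cE mulmxDr -scalemxAr [LHS]mxE [X in X + _ = _]mxE.
  by rewrite -(cE v) -(cE w).
have zc (v : 'cV[R]_(n i.+1)) : rho i.+1 *m v = 0 -> c v \in ker_pred (codiff M R^o i.+1).
  move=> hv; rewrite inE; apply/eqP; apply: val_inj; apply/boolp.funext => y /=.
  apply: h1 => z /=; rewrite (svalP (cf v)).
  exact: (row_eq0_col (rho i.+1) v).2 hv z.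
(* [theta] is defined on all columns through the default value 0, which is why its clauses are
   restricted to cocycles. *)
pose k (v : 'cV[R]_(n i.+1)) : cocycle M R^o i.+1 := insubd (0 : cocycle M R^o i.+1) (c v).
have kE (v : 'cV[R]_(n i.+1)) : rho i.+1 *m v = 0 -> val (k v) = c v.
  by move=> hv; rewrite /k insubdK //; apply: zc.
exists (fun v => qproj _ (k v)); split.
- move=> a v w hv hw; rewrite -linearP /=; congr (qproj _ _).
  have hvw : rho i.+1 *m (a *: v + w) = 0.
    by rewrite mulmxDr -scalemxAr hv hw scaler0 addr0.
  apply: val_inj; rewrite kE // cP linearP /= !kE //.
- move=> v hv; rewrite -[X in _ = X](raddf0 (qproj (@cobound_pred R M R^o i.+1))).
  have cob : qproj (@cobound_pred R M R^o i.+1) (k v) = qproj _ 0 <->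
      exists g, c v = codiff M R^o i g.
    split=> [/qprojP|[g hg]]; [rewrite subr0|apply/qprojP; rewrite subr0].
      by rewrite inE => /boolp.asboolP /=; rewrite kE.
    by rewrite inE; apply/boolp.asboolP => /=; exists g; rewrite kE.
  rewrite cob; split=> [[g hg]|[w hw]].
    have [gl hgl] := linear_packed (linhom_linear g).
    have [|x|g' hg'] := h3 (sval (cf v)) gl.
    + by move=> z /=; rewrite (svalP (cf v)); exact: (row_eq0_col (rho i.+1) v).2 hv z.
    + by rewrite (svalP (cf v)) -cE hg hgl.
    have [w hw] := linear_form g'; exists w.
    apply/eqP; rewrite -subr_eq0 -[_ - _]mul1mx; apply/eqP; apply/row_eq0_col => x.
    rewrite mulmx1 mulmxBr [LHS]mxE [X in _ + X]mxE.
    by rewrite -(svalP (cf v)) hg' hw /= -mulmxA subrr.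
  have [h hh] := h2 (sval (cfi w)).
  have hlin : (h : resol M i -> R^o) \in @linhom_pred R (resol M i) R^o.
    by apply/boolp.asboolP => a x y; rewrite linearP.
  exists (Sub (h : resol M i -> R^o) hlin).
  apply: val_inj; apply/boolp.funext => x; rewrite cE /= -hh (svalP (cfi w)) hw /=.
  by rewrite mulmxA.
- move=> e; have [z ->] := qproj_surj e.
  have [f hf] := linear_packed (linhom_linear (val z)).
  have [y|v [h [hv hh]]] := h4 f.
    rewrite hf; have := valP z; rewrite inE => /eqP/(congr1 val) /=.
    by move=> /(congr1 (fun g => g y)).
  have [w hw] := linear_form v.
  have hw0 : rho i.+1 *m w = 0.
    by apply/row_eq0_col => x; rewrite -hw; apply: hv.
  exists w => //; apply/qprojP; rewrite inE; apply/boolp.asboolP => /=.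
  have hlin : (fun x => - h x : R^o) \in @linhom_pred R (resol M i) R^o.
    by apply/boolp.asboolP => a x y; rewrite linearP opprD scalerN.
  exists (Sub (fun x => - h x : R^o) hlin).
  apply: val_inj; apply/boolp.funext => x.
  rewrite raddfB /= kE //.
  have -> (F G : resol M i.+1 -> R^o) : (F - G) x = F x - G x by [].
  by rewrite cE -hw -hf hh opprD addrA subrr sub0r.
Qed.

End ExtComparison.
End Resolution.

(** * Coarse graining *)

Section RestrictionOfScalars.
Local Open Scope fset_scope.
Local Open Scope ring_scope.
Context (k : comNzRingType) (G : zmodType) (L : zmodClosed G).
Local Notation R := (galg k G).
Local Notation A := (galg k (sublattice L)).

Lemma mcoeff_monomM (H : zmodType) c (w x : H) (r : galg k H) :
  (gmonom c w * r)@_x = c * r@_(x - w).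
Proof.
rewrite [_ * _](@galg_mulw _ _ [fset w] (msupp r)) ?msuppU_le // raddf_sum /=.
rewrite big_seq_fset1 mcoeffUU -[in RHS](sum_msupp_pick r) mulr_sumr.
rewrite raddf_sum; apply: eq_bigr => v _ /=.
by rewrite mcoeffU mulrnAr [in RHS]eq_sym subr_eq [in LHS]eq_sym (addrC w).
Qed.

Lemma coset_coord_is_zmod_morphism u : zmod_morphism (@coset_coord k G L u).
Proof.
move=> r s; apply/malgP => l; apply: etrans (mcoeff_coset_coord _ _ _) _.
apply: etrans (mcoeffB _ _ _) _; apply: esym; apply: etrans (mcoeffB _ _ _) _.
by congr (_ - _); apply: mcoeff_coset_coord.
Qed.

HB.instance Definition _ u := GRing.isZmodMorphism.Build R A
  (@coset_coord k G L u) (coset_coord_is_zmod_morphism u).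

Lemma coset_coordD u (r s : R) :
  coset_coord L u (r + s) = coset_coord L u r + coset_coord L u s.
Proof. exact: (raddfD (coset_coord L u)). Qed.

Lemma galg_inclE (a : A) : galg_incl a = gpush (\val : sublattice L -> G) a.
Proof. by []. Qed.

Lemma coset_coord_incl u (a : A) (r : R) :
  coset_coord L u (galg_incl a * r) = a * coset_coord L u r.
Proof.
rewrite [X in _ = X * _](galg_sumE a) /galg_incl !mulr_suml raddf_sum.
apply: eq_bigr => l _; apply/malgP => l'; rewrite /=.
by rewrite mcoeff_coset_coord !mcoeff_monomM mcoeff_coset_coord raddfB /= addrAC.
Qed.

Section Coarse.
Context (n : nat) (u : 'I_n -> G) (hu : coset_reps L u).

Lemma coset_coord_rep s t : coset_coord L (u s) (gmonom 1 (u t) : R) = (s == t)%:R.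
Proof.
apply/malgP => l; rewrite mcoeff_coset_coord mcoeff_gmonom.
have [s0 [hs0 us0]] := hu (u t).
have tE : s0 = t by apply: us0; rewrite subrr rpred0.
have [->|st] := eqVneq s t.
  rewrite -[X in X == _]add0r (inj_eq (addIr _)) -gmonom1 mcoeff_gmonom.
  by rewrite -(inj_eq val_inj).
rewrite mcoeff0; case: eqP => // e; case/eqP: st.
by rewrite -tE; apply/esym/us0; rewrite e addrK; apply: valP.
Qed.

Lemma coset_coord_mul s (r r' : R) : coset_coord L (u s) (r * r') =
  \sum_t coset_coord L (u s) (r * gmonom 1 (u t)) * coset_coord L (u t) r'.
Proof.
rewrite [in LHS](coset_coordE r' hu) mulr_sumr raddf_sum; apply: eq_bigr => t _.
apply: etrans (congr1 _ (mulrCA _ _ _)) _.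
exact: etrans (coset_coord_incl _ _ _) (mulrC _ _).
Qed.

Definition restrict q (v : 'cV[R]_q) : 'cV[A]_(\sum_(i < q) n) :=
  \mxcol_(i < q) \col_s coset_coord L (u s) (v i 0).

Definition unrestrict q (V : 'cV[A]_(\sum_(i < q) n)) : 'cV[R]_q :=
  \col_i \sum_s galg_incl (submxcol V i s 0) * gmonom 1 (u s).

Lemma restrictK q : cancel (@restrict q) (@unrestrict q).
Proof.
move=> v; apply/colP => i; rewrite mxE [RHS](coset_coordE _ hu).
by apply: eq_bigr => s _; rewrite /restrict mxcolK mxE.
Qed.

Lemma unrestrictK q : cancel (@unrestrict q) (@restrict q).
Proof.
move=> V; rewrite -[RHS]submxcolK; apply: eq_mxcol => i.
apply/colP => s; rewrite !mxE raddf_sum.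
transitivity (\sum_t submxcol V i t 0 * (s == t)%:R).
  by apply: eq_bigr => t _; rewrite /= coset_coord_incl coset_coord_rep.
rewrite [LHS](bigD1 s) //= eqxx mulr1 big1 ?addr0 ?mxE // => t ts.
by rewrite eq_sym (negbTE ts) mulr0.
Qed.

Lemma restrictD q (v w : 'cV[R]_q) : restrict (v + w) = restrict v + restrict w.
Proof.
rewrite /restrict -mxcolD; apply: eq_mxcol => i; apply/colP => s.
rewrite mxE [RHS]mxE.
rewrite [X in _ = X + _]mxE.
rewrite [X in _ = _ + X]mxE.
rewrite mxE.
exact: coset_coordD.
Qed.

Lemma restrictZ q (a : A) (v : 'cV[R]_q) : restrict (galg_incl a *: v) = a *: restrict v.
Proof.
have e i : \col_s coset_coord L (u s) ((galg_incl a *: v) i 0) =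
    a *: \col_s coset_coord L (u s) (v i 0).
  by apply/colP => s; rewrite !mxE coset_coord_incl.
transitivity (\mxcol_(i < q) (a *: \col_s coset_coord L (u s) (v i 0))).
  by apply: eq_mxcol => i; apply: e.
by apply/matrixP => i j; rewrite [LHS]mxE [LHS]mxE [RHS]mxE [X in _ = _ * X]mxE.
Qed.

Lemma coarse_restrict q a (phi : 'M[R]_(q, a)) (v : 'cV[R]_a) :
  coarse L u phi *m restrict v = restrict (phi *m v).
Proof.
rewrite /coarse /restrict mul_mxblock_mxrow; apply: eq_mxcol => i.
apply/colP => s; rewrite summxE !mxE raddf_sum; apply: eq_bigr => j _.
by rewrite /= coset_coord_mul mxE; apply: eq_bigr => t _; rewrite !mxE.
Qed.

End Coarse.

Lemma mcoeff_gbar (H : zmodType) (r : galg k H) v : (gbar r)@_v = r@_(- v).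
Proof.
rewrite raddf_sum -[in RHS](sum_msupp_pick r); apply: eq_bigr => w _ /=.
by rewrite mcoeffU eqr_oppLR.
Qed.

(** In block position (s, t), the coefficient at [l] is that of [phi] at l + u s - u t; the dagger
    exchanges s and t and changes every sign. *)
Lemma dagger_coarse n (u : 'I_n -> G) q a (phi : 'M[R]_(q, a)) :
  dagger (coarse L u phi) = coarse L u (dagger phi).
Proof.
apply/matrixP => i j; rewrite !mxE; apply/malgP => l.
rewrite mcoeff_gbar !mcoeff_coset_coord !mcoeff_mulmonom mcoeff_gbar.
have -> : - (val l + u (tagnat.sig2 i) - u (tagnat.sig2 j)) =
    val (- l) + u (tagnat.sig2 j) - u (tagnat.sig2 i); last by [].
by rewrite raddfN /= !opprD opprK addrAC.
Qed.

End RestrictionOfScalars.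

(** * Exactness of the Koszul complex *)

Section KoszulExact.
Context (A : comNzRingType) (D : nat) (f : 'I_D -> A).
Implicit Types (c a b : {set 'I_D} -> A) (S T : {set 'I_D}) (o l : 'I_D) (i m : nat).

Definition below T o : nat := #|[set x in T | (x < o)%N]|.

(** The Koszul differential on functions of all subsets, all degrees at once. Degree and number of
    variables become the predicates [homog] and [supported], which frees the induction on variables
    from dependent sizes. *)
Definition kz c T : A := \sum_(l | l \notin T) (-1) ^+ below T l * f l * c (l |: T).

Definition supported m c : Prop := forall S l, c S != 0 -> l \in S -> (l < m)%N.
Definition homog i c : Prop := forall S, c S != 0 -> #|S| = i.

Lemma kzD c a T : kz (fun S => c S + a S) T = kz c T + kz a T.
Proof. by rewrite /kz -big_split; apply: eq_bigr => l _; rewrite mulrDr. Qed.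

Lemma kzZ r c T : kz (fun S => r * c S) T = r * kz c T.
Proof. by rewrite /kz mulr_sumr; apply: eq_bigr => l _; rewrite mulrCA. Qed.

Lemma kz_ext c a T : (forall S, c S = a S) -> kz c T = kz a T.
Proof. by move=> h; apply: eq_bigr => l _; rewrite h. Qed.

Lemma kz0 c T : (forall S, c S = 0) -> kz c T = 0.
Proof. by move=> h; rewrite /kz big1 // => l _; rewrite h mulr0. Qed.

Lemma kz_signed c T : kz (fun S => (-1) ^+ #|S| * c S) T = - ((-1) ^+ #|T| * kz c T).
Proof.
rewrite /kz mulr_sumr -sumrN; apply: eq_bigr => l lT.
by rewrite cardsU1 lT exprS mulN1r mulNr mulrN mulrCA.
Qed.

Lemma supported_kz m c : supported m c -> supported m (kz c).
Proof.
move=> sc S l /eqP kz_neq lS; apply/negPn/negP => lm; apply: kz_neq.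
rewrite /kz big1 // => l' _; have [->|/sc/(_ _)-/(_ l)] := eqVneq (c (l' |: S)) 0.
  by rewrite mulr0.
by rewrite (setU1r _ lS) => /(_ isT) h; rewrite h in lm.
Qed.

Section Split.
Context (m : nat) (o : 'I_D) (om : o = m :> nat).

(** With [o] the largest index in use, a chain is [part0] plus the wedge of [part1] with e_o on the
    right; [join] is the converse. *)
Definition part0 c S : A := if o \in S then 0 else c S.
Definition part1 c S : A := if o \in S then 0 else c (o |: S).
Definition join a b S : A := if o \in S then b (S :\ o) else a S.

Lemma supported_out c T : supported m c -> o \in T -> c T = 0.
Proof.
move=> sc oT; apply/eqP/negPn/negP => h.
by have := sc _ _ h oT; rewrite om ltnn.
Qed.

Lemma below_top T : (forall l, l \in T -> (l < m)%N) -> below T o = #|T|.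
Proof.
move=> hT; apply: eq_card => l; rewrite inE om.
by case: (boolP (l \in T)) => // /hT ->.
Qed.

(** The complex in one more variable is the cone of multiplication by [f o]. The sign is that of [o]
    standing above every element of [T]. *)
Lemma kz_split0 c T : supported m.+1 c -> o \notin T ->
  kz c T = kz (part0 c) T + (-1) ^+ #|T| * (f o * part1 c T).
Proof.
move=> sc oT; rewrite /kz (bigD1 o) //= [in RHS](bigD1 o) //= addrC.
rewrite [X in _ = X + _ + _](_ : _ = 0) ?add0r; last by rewrite /part0 setU11 mulr0.
congr (_ + _).
  apply: eq_bigr => l /andP[lT lo]; rewrite /part0 in_setU1 (negbTE oT) orbF.
  by rewrite eq_sym (negbTE lo).
rewrite /part1 (negbTE oT) -mulrA.
have [->|cn0] := eqVneq (c (o |: T)) 0; first by rewrite !mulr0.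
rewrite below_top // => l lT.
have := sc _ l cn0; rewrite (setU1r _ lT) => /(_ isT); rewrite ltnS leq_eqVlt.
by case/orP => // /eqP e; move: oT; rewrite (_ : o = l) ?lT //; apply: val_inj; rewrite /= om.
Qed.

Lemma kz_split1 c T : supported m.+1 c -> o \notin T -> kz c (o |: T) = kz (part1 c) T.
Proof.
move=> sc oT; rewrite /kz [in RHS](bigD1 o) //= /part1 setU11 mulr0 add0r.
apply: eq_big => [l|l].
  by rewrite in_setU1 negb_or andbC.
rewrite in_setU1 negb_or => /andP[lo lT].
rewrite in_setU1 (negbTE oT) eq_sym (negbTE lo) /= setUCA.
have [->|cn0] := eqVneq (c (o |: (l |: T))) 0; first by rewrite !mulr0.
have lm : (l < m)%N.
  have := sc _ l cn0; rewrite !inE eqxx orbT => /(_ isT); rewrite ltnS leq_eqVlt.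
  by case/orP => // /eqP e; case/eqP: lo; apply: val_inj; rewrite /= om.
congr (_ ^+ _ * _ * _); apply: eq_card => x; rewrite !inE.
by case: (eqVneq x o) => [->|//]; rewrite om ltnNge (ltnW lm) (negbTE oT).
Qed.

Lemma supported_part0 c : supported m.+1 c -> supported m (part0 c).
Proof.
move=> sc S l; rewrite /part0; case: ifP => [_|oS]; first by rewrite eqxx.
move=> /sc h lS; have := h l lS; rewrite ltnS leq_eqVlt => /orP[/eqP e|//].
by move: oS; rewrite (_ : o = l) ?lS //; apply: val_inj; rewrite /= om.
Qed.

Lemma supported_part1 c : supported m.+1 c -> supported m (part1 c).
Proof.
move=> sc S l; rewrite /part1; case: ifP => [_|oS]; first by rewrite eqxx.
move=> /sc h lS; have := h l (setU1r _ lS); rewrite ltnS leq_eqVlt => /orP[/eqP e|//].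
by move: oS; rewrite (_ : o = l) ?lS //; apply: val_inj; rewrite /= om.
Qed.

Lemma kz_kz_step c : (forall c, supported m c -> forall T, kz (kz c) T = 0) ->
  supported m.+1 c -> forall T, kz (kz c) T = 0.
Proof.
move=> IH sc T; have sk := supported_kz sc.
have s0 := supported_part0 sc; have s1 := supported_part1 sc.
have k1 S : kz (part1 (kz c)) S = kz (kz (part1 c)) S.
  apply: kz_ext => S'; rewrite /part1; case: ifP => [oS|/negbT oS].
    by rewrite (supported_out (supported_kz s1)).
  exact: kz_split1.
case: (boolP (o \in T)) => oT.
  rewrite -(setD1K oT) kz_split1 ?setD11 //; rewrite k1; exact: IH.
rewrite kz_split0 //.
have -> : kz (part0 (kz c)) T =
    kz (fun S => kz (part0 c) S + (-1) ^+ #|S| * (f o * part1 c S)) T.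
  apply: eq_bigr => l lT; rewrite /part0; case: ifP => [oS|/negbT oS]; last first.
    by congr (_ * _); rewrite kz_split0.
  have -> : kz (part0 c) (l |: T) = 0.
    exact: supported_out (supported_kz s0) oS.
  by rewrite /part1 oS !mulr0 addr0 mulr0.
rewrite kzD (IH _ s0) add0r kz_signed kzZ.
have -> : part1 (kz c) T = kz (part1 c) T.
  by rewrite {1}/part1 (negbTE oT) kz_split1.
by rewrite addNr.
Qed.

Lemma part0_join a b S : supported m a -> part0 (join a b) S = a S.
Proof.
move=> sa; rewrite /part0 /join; case: (boolP (o \in S)) => // oS.
by rewrite (supported_out sa).
Qed.

Lemma part1_join a b S : supported m b -> part1 (join a b) S = b S.
Proof.
move=> sb; rewrite /part1 /join; case: (boolP (o \in S)) => oS.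
  by rewrite (supported_out sb).
by rewrite setU11 setU1K.
Qed.

Lemma supported_join a b : supported m a -> supported m b -> supported m.+1 (join a b).
Proof.
move=> sa sb S l; rewrite /join; case: ifP => oS h lS; last by apply/leqW/(sa _ _ h).
have [->|lo] := eqVneq l o; first by rewrite om.
by apply/leqW/(sb _ _ h); rewrite !inE lo.
Qed.

End Split.

Lemma kz_kz c T : kz (kz c) T = 0.
Proof.
suff h m : (m <= D)%N -> forall c, supported m c -> forall T, kz (kz c) T = 0.
  by apply: (h D) => // S l _ _; apply: ltn_ord.
elim: m => [|m IH] mD {}c sc {}T; last first.
  exact: (@kz_kz_step m (Ordinal mD) erefl c (IH (ltnW mD))).
have c0 S l : l \in S -> c S = 0.
  by move=> lS; apply/eqP/negPn/negP => h; have := sc _ _ h lS.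
rewrite kz0 // => S; rewrite /kz big1 // => l _.
by rewrite (c0 _ l) ?mulr0 // setU11.
Qed.

Hypothesis regular_seq : forall (o : 'I_D) (be : A) (g : 'I_D -> A),
  f o * be = \sum_(l : 'I_D | (l < o)%N) f l * g l ->
  exists g', be = \sum_(l : 'I_D | (l < o)%N) f l * g' l.

Lemma kz_set0 c : kz c set0 = \sum_l f l * c [set l].
Proof.
rewrite /kz; apply: eq_big => l; first by rewrite inE.
move=> _; rewrite setU0 (_ : below set0 l = 0%N) ?expr0 ?mul1r //.
by apply: eq_card0 => x; rewrite !inE.
Qed.

(** The long exact sequence of the cone, on cycles: [b] is a cycle, hence a boundary of some [b'],
    and [a] corrected by a multiple of [f o * b'] is a cycle in fewer variables. *)
Lemma kz_exact_supported m i c : (m <= D)%N -> supported m c -> homog i.+1 c ->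
  (forall T, kz c T = 0) ->
  exists c', [/\ supported m c', homog i.+2 c' & forall T, kz c' T = c T].
Proof.
elim: m i c => [|m IH] i c mD sc hc kc.
  exists (fun=> 0); split=> [S l|S|T]; rewrite ?eqxx //.
  rewrite kz0 //; apply/esym/eqP/negPn/negP => cT.
  have := hc _ cT; have [->|[l lT]] := set_0Vmem T; first by rewrite cards0.
  by have := sc _ _ cT lT.
pose o : 'I_D := Ordinal mD; have om : o = m :> nat by [].
pose a := part0 o c; pose b := part1 o c.
have sa : supported m a := supported_part0 om sc.
have sb : supported m b := supported_part1 om sc.
have hb : homog i b.
  move=> S; rewrite /b /part1; case: ifP => oS; first by rewrite eqxx.
  by move=> /hc; rewrite cardsU1 oS add1n => -[].
have ha : homog i.+1 a.
  by move=> S; rewrite /a /part0; case: ifP => oS; [rewrite eqxx | apply: hc].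
have out g (sg : supported m g) T : o \in T -> g T = 0.
  by move=> oT; exact: (supported_out om sg oT).
have kb T : kz b T = 0.
  case: (boolP (o \in T)) => oT; first exact: out (supported_kz sb) _ oT.
  by rewrite -(kz_split1 om).
have ka T : kz a T = - ((-1) ^+ i * (f o * b T)).
  case: (boolP (o \in T)) => oT.
    by rewrite (out _ (supported_kz sa)) // (out _ sb) // !mulr0 oppr0.
  have := kc T; rewrite (kz_split0 om) // => /eqP; rewrite addr_eq0 => /eqP ->.
  rewrite -/b; have [->|bT] := eqVneq (b T) 0; first by rewrite !mulr0.
  by rewrite (hb _ bT).
have [b' [sb' hb' kb']] : exists b', [/\ supported m b', homog i.+1 b' & forall T, kz b' T = b T].
  case: i hb {hc ha} ka => [|i] hb ka; last exact: (IH i b (ltnW mD) sb hb kb).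
  have ksum c1 : supported m c1 -> kz c1 set0 = \sum_(l : 'I_D | (l < o)%N) f l * c1 [set l].
    move=> s1; rewrite kz_set0 (bigID (fun l : 'I_D => (l < o)%N)) /=.
    rewrite [X in _ + X]big1 ?addr0 // => l lo; have [->|n0] := eqVneq (c1 [set l]) 0.
      by rewrite mulr0.
    by have := s1 _ l n0; rewrite inE eqxx => /(_ isT) h; rewrite h in lo.
  have [|g' hg'] := regular_seq (o := o) (be := b set0) (g := fun l => - a [set l]).
    under eq_bigr do rewrite mulrN.
    by rewrite sumrN -ksum // ka expr0 mul1r opprK.
  pose b' S := \sum_(l : 'I_D | (l < o)%N && (S == [set l])) g' l.
  have b'1 l : (l < o)%N -> b' [set l] = g' l.
    move=> lo; rewrite /b' (big_pred1 l) // => x; rewrite (inj_eq set1_inj) /=.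
    by case: eqVneq => [<-|_]; rewrite ?lo ?andbF.
  have b'0 S : (forall l, (l < o)%N -> S <> [set l]) -> b' S = 0.
    by move=> h; rewrite /b' big_pred0 // => l; apply/negP => /andP[/h h' /eqP].
  have sS S : b' S != 0 -> exists2 l : 'I_D, (l < o)%N & S = [set l].
    move=> n0; apply: contrapT => h; case/eqP: n0; apply: b'0 => l lo Sl.
    by apply: h; exists l.
  have s' : supported m b' by move=> S l /sS[x xo ->]; rewrite inE => /eqP ->.
  have h' : homog 1 b' by move=> S /sS[x xo ->]; rewrite cards1.
  exists b'; split=> // T.
  have [->|[l lT]] := set_0Vmem T.
    by rewrite ksum // hg'; apply: eq_bigr => l lo; rewrite b'1.
  have T0 : (#|T| != 0)%N by rewrite cards_eq0; apply/set0Pn; exists l.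
  have -> : b T = 0 by apply/eqP/negPn/negP => /hb e; rewrite e in T0.
  rewrite /kz big1 // => x xT; rewrite b'0 ?mulr0 // => y _ e.
  have := congr1 (fun S : {set 'I_D} => #|S|) e; rewrite cardsU1 xT cards1 add1n => -[e'].
  by rewrite e' in T0.
have [||||a' [sa' ha' ka']] := IH i (fun S => a S + (-1) ^+ i * (f o * b' S)).
- exact: ltnW.
- move=> S l; have [->|/sb' h _ lS] := eqVneq (b' S) 0; last exact: h.
  by rewrite !mulr0 addr0; apply: sa.
- move=> S; have [->|/hb' h _] := eqVneq (b' S) 0; last exact: h.
  by rewrite !mulr0 addr0; apply: ha.
- by move=> T; rewrite kzD !kzZ kb' ka addNr.
exists (join o a' b'); have sj := supported_join om sa' sb'; split=> //.
  move=> S; rewrite /join; case: ifP => oS; last exact: ha'.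
  by move=> /hb' h; rewrite (cardsD1 o) oS h.
move=> T; case: (boolP (o \in T)) => oT.
  rewrite -[in LHS](setD1K oT) (kz_split1 om) // ?setD11 //.
  rewrite (kz_ext _ (fun S => part1_join om a' S sb')) kb' /b /part1 setD11.
  by rewrite setD1K.
rewrite (kz_split0 om) // (kz_ext _ (fun S => part0_join om b' S sa')) ka'.
rewrite (part1_join om) // /a /part0 (negbTE oT) -addrA.
have [->|b'T] := eqVneq (b' T) 0; first by rewrite !mulr0 !addr0.
by rewrite (hb' _ b'T) exprS mulN1r mulNr subrr addr0.
Qed.

Definition vec_of i c : 'cV[A]_(#|ext_basis D i|) := \col_s c (enum_val s).
Definition fun_of i (v : 'cV[A]_(#|ext_basis D i|)) S : A :=
  \sum_(s | enum_val s == S) v s 0.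

Lemma vec_ofK i c : homog i c -> forall S, fun_of (vec_of i c) S = c S.
Proof.
move=> hc S; rewrite /fun_of; case: (boolP (#|S| == i)) => Si.
  have Sb : S \in ext_basis D i by rewrite inE.
  rewrite (big_pred1 (enum_rank_in Sb S)) ?mxE ?enum_rankK_in // => s.
  by rewrite -[S in X in X = _](enum_rankK_in Sb Sb) (inj_eq enum_val_inj).
rewrite big1 => [|s /eqP e]; last by have := enum_valP s; rewrite e inE (negbTE Si).
by apply/esym/eqP/negPn/negP => /hc/eqP; rewrite (negbTE Si).
Qed.

Lemma fun_ofK i (v : 'cV[A]_(#|ext_basis D i|)) : vec_of i (fun_of v) = v.
Proof.
apply/colP => s; rewrite mxE /fun_of (big_pred1 s) // => x.
by rewrite (inj_eq enum_val_inj).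
Qed.

Lemma homog_fun_of i (v : 'cV[A]_(#|ext_basis D i|)) : homog i (fun_of v).
Proof.
move=> S; rewrite /fun_of; have [s /eqP e|e] := pickP (fun s : 'I_#|ext_basis D i| => enum_val s == S).
  by have := enum_valP s; rewrite e inE => /eqP.
by rewrite big_pred0 ?eqxx.
Qed.

Lemma koszul_dE i c : homog i.+1 c -> koszul_d f i.+1 *m vec_of i.+1 c = vec_of i (kz c).
Proof.
move=> hc; apply/colP => t; rewrite !mxE.
under eq_bigr do rewrite !mxE.
set T := enum_val t.
have Ti : #|T| = i by have := enum_valP t; rewrite inE => /eqP.
transitivity (\sum_(S in ext_basis D i.+1) koszul_coef f T S * c S).
  by rewrite [RHS]big_enum_val.
transitivity (\sum_S koszul_coef f T S * c S).
  rewrite [RHS](bigID (mem (ext_basis D i.+1))) /= [X in _ = _ + X]big1 ?addr0 // => S.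
  rewrite inE => Sn; have [->|/hc/eqP] := eqVneq (c S) 0; first by rewrite mulr0.
  by rewrite (negbTE Sn).
rewrite /kz /koszul_coef.
under eq_bigr => S _ do rewrite mulr_suml big_mkcondr.
rewrite (exchange_big_dep xpredT) //= [RHS]big_mkcond /=; apply: eq_bigr => l _.
case: ifP => lT; last first.
  rewrite big1 // => S lS; case: eqP => // e.
  by move: lT; rewrite e setD11.
rewrite (bigD1 (l |: T)) ?setU11 //= setU1K // eqxx big1 ?addr0.
  rewrite /below; congr (_ ^+ _ * _ * _); apply: eq_card => x; rewrite !inE.
  by case: (eqVneq x l) => [->|//]; rewrite ltnn !andbF.
move=> S /andP[lS SlT]; case: eqP => // e; case/eqP: SlT.
by rewrite e setD1K.
Qed.

Lemma homog_kz i c : homog i.+1 c -> homog i (kz c).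
Proof.
move=> hc S; apply: contra_neq_eq => Si; rewrite /kz big1 // => l lS.
have [->|/hc] := eqVneq (c (l |: S)) 0; first by rewrite mulr0.
by rewrite cardsU1 lS add1n => -[e]; rewrite e eqxx in Si.
Qed.

Theorem koszul_exact i : exact_mx (koszul_d f i.+1) (koszul_d f i.+2).
Proof.
have vE j (v : 'cV_(#|ext_basis D j.+1|)) : koszul_d f j.+1 *m v = vec_of j (kz (fun_of v)).
  by rewrite -koszul_dE ?fun_ofK //; apply: homog_fun_of.
split=> [|v].
  apply/matrixP => x y.
  suff /colP/(_ x) : koszul_d f i.+1 *m (koszul_d f i.+2 *m (delta_mx y 0 : 'cV_ _)) = 0.
    by rewrite mulmxA -colE !mxE.
  rewrite [X in _ *m X]vE koszul_dE; last by apply: homog_kz; apply: homog_fun_of.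
  by apply/colP => s; rewrite !mxE kz_kz.
rewrite vE => v0.
have [|||c' [_ hc' kc']] := @kz_exact_supported D i (fun_of v) (leqnn D).
- by move=> S l _ _; apply: ltn_ord.
- exact: homog_fun_of.
- move=> T; have hk := homog_kz (@homog_fun_of i.+1 v).
  by rewrite -(vec_ofK hk) v0 /fun_of big1 // => s _; rewrite mxE.
exists (vec_of i.+2 c'); rewrite koszul_dE // -[LHS]fun_ofK.
by apply/colP => s; rewrite !mxE kc'.
Qed.

(** The empty set is the only basis element in degree 0, but that cardinal is not convertible to 1,
    hence the quantification over [t]. *)
Lemma koszul_d1_image (v : 'cV[A]_(#|ext_basis D 0|)) :
  (exists w, v = koszul_d f 1 *m w) <-> (forall t, exists g, v t 0 = \sum_l f l * g l).
Proof.
have e0 (t : 'I_(#|ext_basis D 0|)) : enum_val t = set0.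
  by apply/eqP; have := enum_valP t; rewrite inE cards_eq0.
split=> [[w ->] t|/boolp.choice[g hg]].
  exists (fun l => fun_of w [set l]).
  rewrite -{1}(fun_ofK w) koszul_dE; last exact: homog_fun_of.
  by rewrite mxE e0 kz_set0.
have [D0|] := posnP #|ext_basis D 0|.
  exists 0; rewrite mulmx0; apply/colP => t; case: t => x hx; exfalso.
  by move: hx; rewrite D0.
case/card_gt0P => S0 hS0; pose t0 := enum_rank_in hS0 S0.
pose c S := \sum_(l | S == [set l]) g t0 l.
have c1 l : c [set l] = g t0 l.
  by rewrite /c (big_pred1 l) // => x; rewrite (inj_eq set1_inj) eq_sym.
have hc : homog 1 c.
  move=> S; rewrite /c; have [l /eqP -> _|e] := pickP (fun l => S == [set l]).
    by rewrite cards1.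
  by rewrite big_pred0 ?eqxx.
exists (vec_of 1 c); rewrite koszul_dE //; apply/colP => t; rewrite mxE e0 kz_set0.
have -> : t = t0 by apply: enum_val_inj; rewrite !e0.
by rewrite hg; apply: eq_bigr => l _; rewrite c1.
Qed.

End KoszulExact.

(** * The monomials of a basis, minus 1, form a regular sequence *)

Section RegularSequence.
Context (k : comNzRingType) (H : zmodType) (D : nat) (y : 'I_D -> H).
Hypothesis y_basis : forall v : H, exists! c : {ffun 'I_D -> int}, v = \sum_(i < D) y i *~ c i.
Local Notation A := (galg k H).

Definition ygen (l : 'I_D) : A := gmonom 1 (y l) - 1.

Definition in_ideal (m : nat) (r : A) : Prop :=
  exists g, r = \sum_(l < D | (l < m)%N) ygen l * g l.

Lemma in_ideal0 m : in_ideal m 0.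
Proof. by exists (fun=> 0); rewrite big1 // => l _; rewrite mulr0. Qed.

Lemma in_idealD m r s : in_ideal m r -> in_ideal m s -> in_ideal m (r + s).
Proof.
move=> [g ->] [h ->]; exists (fun l => g l + h l).
by rewrite -big_split; apply: eq_bigr => l _; rewrite mulrDr.
Qed.

Lemma in_idealM m r s : in_ideal m s -> in_ideal m (r * s).
Proof.
move=> [g ->]; exists (fun l => r * g l).
by rewrite mulr_sumr; apply: eq_bigr => l _; rewrite mulrCA.
Qed.

Lemma in_ideal_sum m (I : Type) (s : seq I) (P : pred I) (F : I -> A) :
  (forall i, P i -> in_ideal m (F i)) -> in_ideal m (\sum_(i <- s | P i) F i).
Proof.
move=> h; elim/big_rec: _ => [|i x Pi hx]; first exact: in_ideal0.
by apply: in_idealD => //; apply: h.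
Qed.

Lemma in_ideal_ygen m (l : 'I_D) : (l < m)%N -> in_ideal m (ygen l).
Proof.
move=> lm; exists (fun x => if x == l then 1 else 0).
rewrite (bigD1 l) //= eqxx mulr1 big1 ?addr0 // => x /andP[_ /negbTE ->].
by rewrite mulr0.
Qed.

Lemma in_ideal_monomD m v w : in_ideal m (gmonom 1 v - 1) -> in_ideal m (gmonom 1 w - 1) ->
  in_ideal m (gmonom 1 (v + w) - 1).
Proof.
move=> hv hw.
have -> : gmonom 1 (v + w) - 1 = gmonom 1 v * (gmonom 1 w - 1) + (gmonom 1 v - 1) :> A.
  by rewrite mulrBr mulr1 addrA subrK gmonom1M.
by apply: in_idealD => //; apply: in_idealM.
Qed.

Lemma in_ideal_monomN m v : in_ideal m (gmonom 1 v - 1) -> in_ideal m (gmonom 1 (- v) - 1).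
Proof.
move=> hv.
have -> : gmonom 1 (- v) - 1 = (- gmonom 1 (- v)) * (gmonom 1 v - 1) :> A.
  by rewrite mulNr mulrBr mulr1 opprB mulrC gmonomV.
exact: in_idealM.
Qed.

Lemma in_ideal_monom m (c : 'I_D -> int) :
  in_ideal m (gmonom 1 (\sum_(i < D | (i < m)%N) y i *~ c i) - 1).
Proof.
elim/big_rec: _ => [|i v im hv]; first by rewrite gmonom1 subrr; apply: in_ideal0.
apply: in_ideal_monomD => //.
have hn n : in_ideal m (gmonom 1 (y i *+ n) - 1).
  elim: n => [|n IH]; first by rewrite mulr0n gmonom1 subrr; apply: in_ideal0.
  by rewrite mulrS; apply: in_ideal_monomD => //; apply: in_ideal_ygen.
by case: (c i) => n; [apply: hn | apply: in_ideal_monomN; apply: hn].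
Qed.

Lemma coords_exist : exists c : H -> {ffun 'I_D -> int},
  (forall v, v = \sum_(i < D) y i *~ c v i) /\
  forall v (d : {ffun 'I_D -> int}), v = \sum_(i < D) y i *~ d i -> c v = d.
Proof.
have /boolp.choice[c hc] v : exists c : {ffun 'I_D -> int}, v = \sum_(i < D) y i *~ c i /\
    forall d : {ffun 'I_D -> int}, v = \sum_(i < D) y i *~ d i -> c = d.
  by have [c] := y_basis v; exists c.
by exists c; split=> v; case: (hc v).
Qed.

Definition coords := sval (boolp.cid coords_exist).
Lemma coordsE v : v = \sum_(i < D) y i *~ coords v i.
Proof. by rewrite /coords; case: boolp.cid => c []. Qed.
Lemma coords_uniq v (d : 'I_D -> int) : v = \sum_(i < D) y i *~ d i -> forall i, coords v i = d i.
Proof.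
move=> e i; rewrite /coords; case: boolp.cid => c [_ /= h].
rewrite (h v [ffun i => d i]) ?ffunE // e; apply: eq_bigr => j _; by rewrite ffunE.
Qed.

(** Its push-forward realizes the quotient by the first [m] generators as a retraction inside the
    group algebra, so no quotient ring is formed. *)
Definition proj m (v : H) : H := \sum_(i < D | (m <= i)%N) y i *~ coords v i.

Lemma proj_is_zmod_morphism m : zmod_morphism (proj m).
Proof.
move=> v w.
have cB i : coords (v - w) i = coords v i - coords w i.
  apply: (@coords_uniq (v - w) (fun i => coords v i - coords w i)).
  rewrite {1}(coordsE v) {1}(coordsE w) -[LHS]sumrB; apply: eq_bigr => j _.
  by rewrite mulrzBr.
by rewrite /proj -[RHS]sumrB; apply: eq_bigr => i _; rewrite cB mulrzBr.
Qed.

HB.instance Definition _ m := GRing.isZmodMorphism.Build H H (proj m) (proj_is_zmod_morphism m).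

Lemma proj_y m (l : 'I_D) : proj m (y l) = if (m <= l)%N then y l else 0.
Proof.
have c i : coords (y l) i = (i == l)%:R.
  apply: (@coords_uniq (y l) (fun i => (i == l)%:R)).
  rewrite (bigD1 l) //= eqxx mulr1z big1 ?addr0 // => j /negbTE ->.
  by rewrite mulr0z.
rewrite /proj; case: ifP => ml.
  rewrite (bigD1 l) //= c eqxx mulr1z big1 ?addr0 // => j /andP[_ /negbTE jl].
  by rewrite c jl mulr0z.
rewrite big1 // => j mj; rewrite c; case: eqVneq => [e|_]; last by rewrite mulr0z.
by rewrite e ml in mj.
Qed.

Lemma sub_gpush_proj m (r : A) : in_ideal m (r - gpush (proj m) r).
Proof.
have -> : r - gpush (proj m) r =
    \sum_(v <- msupp r) (gmonom r@_v v - gmonom r@_v (proj m v)).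
  by rewrite sumrB; congr (_ - _); apply: galg_sumE.
apply: in_ideal_sum => v _.
have -> : gmonom r@_v v - gmonom r@_v (proj m v) =
    gmonom r@_v (proj m v) * (gmonom 1 (v - proj m v) - 1) :> A.
  by rewrite mulrBr mulr1 gmonomM1 subrK.
apply: in_idealM.
have -> : v - proj m v = \sum_(i < D | (i < m)%N) y i *~ coords v i.
  rewrite [X in X - _](coordsE v) (bigID (fun i : 'I_D => (i < m)%N)) /= -addrA.
  rewrite /proj; set s := \sum_(i < D | ~~ _) _; set t := \sum_(i < D | _) _.
  have -> : s = t by apply: eq_bigl => i; rewrite -leqNgt.
  by rewrite subrr addr0.
exact: in_ideal_monom.
Qed.

Lemma gpush_proj_ygen m (l : 'I_D) :
  gpush (proj m) (ygen l) = if (m <= l)%N then ygen l else 0.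
Proof.
rewrite /ygen raddfB /= gpushU rmorph1 /= proj_y; case: ifP => // _.
by rewrite gmonom1 subrr.
Qed.

Lemma y_torsion_free (l : 'I_D) n n' : y l *+ n = y l *+ n' -> n = n'.
Proof.
move=> e.
have c (m : nat) i : coords (y l *+ m) i = if i == l then m%:Z else 0.
  apply: (@coords_uniq _ (fun i => if i == l then m%:Z else 0)).
  rewrite (bigD1 l) //= eqxx -pmulrn big1 ?addr0 // => j /negbTE ->.
  by rewrite mulr0z.
have := c n l; rewrite e c eqxx => -[].
by move=> ->.
Qed.

(** The coefficients of [r] are constant along translates by [y l], which has infinite order, while
    the support is finite. *)
Lemma ygen_regular (l : 'I_D) (r : A) : ygen l * r = 0 -> r = 0.
Proof.
move=> e; apply/malgP => v; rewrite mcoeff0.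
have shift w : r@_(w - y l) = r@_w.
  have := congr1 (mcoeff w) e; rewrite /ygen mulrBl mul1r mcoeffB mcoeff0 mcoeff_monomM mul1r.
  by move/eqP; rewrite subr_eq0 => /eqP.
have shiftn n : r@_(v + y l *+ n) = r@_v.
  elim: n => [|n IH]; first by rewrite mulr0n addr0.
  by rewrite -shift mulrSr addrA addrK.
apply/eqP/negPn/negP => rv.
have := @uniq_leq_size _ (map (fun n => v + y l *+ n) (iota 0 (size (msupp r)).+1)) (msupp r).
rewrite size_map size_iota ltnn => h; suff : false by []. apply: h.
  rewrite map_inj_uniq ?iota_uniq // => n n' /addrI; exact: y_torsion_free.
by move=> w /mapP[n _ ->]; rewrite -mcoeff_neq0 shiftn.
Qed.

(** The retraction kills the earlier generators and fixes [ygen o], so it sends [be] to 0 by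
    [ygen_regular]; an element differs from its retraction by a member of the ideal. *)
Lemma ygen_regular_seq (o : 'I_D) (be : A) (g : 'I_D -> A) :
  ygen o * be = \sum_(l < D | (l < o)%N) ygen l * g l ->
  exists g', be = \sum_(l < D | (l < o)%N) ygen l * g' l.
Proof.
move=> e; have := congr1 (gpush (proj o)) e.
rewrite rmorphM raddf_sum big1 => [|l lo]; last first.
  by rewrite [LHS](rmorphM (gpush (proj o))) /= gpush_proj_ygen leqNgt lo mul0r.
rewrite /= gpush_proj_ygen leqnn => /ygen_regular be0.
by have := sub_gpush_proj o be; rewrite be0 subr0.
Qed.

Lemma monom_in_ideal v : in_ideal D (gmonom 1 v - 1).
Proof.
rewrite [v]coordsE (_ : \sum_(i < D) _ = \sum_(i < D | (i < D)%N) y i *~ coords v i).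
  exact: in_ideal_monom.
by apply: eq_bigl => i; rewrite ltn_ord.
Qed.

Lemma in_idealE r : in_ideal D r <-> exists g, r = \sum_l ygen l * g l.
Proof.
have e (F : 'I_D -> A) : \sum_(l < D | (l < D)%N) F l = \sum_l F l.
  by apply: eq_bigl => i; rewrite ltn_ord.
by split=> -[g ->]; exists g; rewrite e.
Qed.

Definition augmentation (s : A) : k := \sum_(l <- msupp s) s@_l.

(** Every monomial is 1 modulo the ideal. *)
Lemma sub_augmentation s : in_ideal D (s - gmonom (augmentation s) 0).
Proof.
have -> : s - gmonom (augmentation s) 0 = \sum_(l <- msupp s) gmonom s@_l 0 * (gmonom 1 l - 1).
  under eq_bigr do rewrite mulrBr mulr1 gmonomM1 addr0.
  rewrite sumrB -galg_sumE; congr (_ - _).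
  rewrite /augmentation; elim/big_rec2: _ => [|l x c _ <-]; first by rewrite /gmonom monalgU0.
  by rewrite /gmonom monalgUD.
by apply: in_ideal_sum => l _; apply: in_idealM; apply: monom_in_ideal.
Qed.

End RegularSequence.

(** * The equivalence *)

Section Dagger.
Context (k : comNzRingType) (G : zmodType).
Local Notation R := (galg k G).

Lemma daggerK m n (X : 'M[R]_(m, n)) : dagger (dagger X) = X.
Proof. by apply/matrixP => i j; rewrite !mxE gbarK. Qed.

Lemma daggerM m n p (X : 'M[R]_(m, n)) (Y : 'M[R]_(n, p)) :
  dagger (X *m Y) = dagger Y *m dagger X.
Proof. by rewrite /dagger map_mxM trmx_mul. Qed.

Lemma dagger1 n : dagger (1%:M : 'M[R]_n) = 1%:M.
Proof. by rewrite /dagger map_mx1 trmx1. Qed.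

Lemma dagger0 m n : dagger (0 : 'M[R]_(m, n)) = 0.
Proof. by rewrite /dagger map_mx0 trmx0. Qed.

Lemma daggerZ m n r (X : 'M[R]_(m, n)) : dagger (r *: X) = gbar r *: dagger X.
Proof. by rewrite /dagger map_mxZ linearZ. Qed.

Lemma daggerD m n (X Y : 'M[R]_(m, n)) : dagger (X + Y) = dagger X + dagger Y.
Proof. by rewrite /dagger map_mxD linearD. Qed.

Lemma daggerB m n (X Y : 'M[R]_(m, n)) : dagger (X - Y) = dagger X - dagger Y.
Proof. by rewrite /dagger map_mxB linearB. Qed.

Lemma dagger_dsum m n p q (X : 'M[R]_(m, n)) (Y : 'M[R]_(p, q)) :
  dagger (dsum X Y) = dsum (dagger X) (dagger Y).
Proof. by rewrite /dagger /dsum map_block_mx tr_block_mx !map_mx0 !trmx0. Qed.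

Lemma dagger_stab q a (X : 'M[R]_(q, a)) al be eta :
  dagger (stab X al be eta) = stab (dagger X) al eta be.
Proof. by rewrite /stab !dagger_dsum dagger1 dagger0. Qed.

Lemma gl_equiv_dagger q a q' a' (X : 'M[R]_(q, a)) (X' : 'M[R]_(q', a')) :
  gl_equiv X X' -> gl_equiv (dagger X) (dagger X').
Proof.
move=> [W [W' [F [F' [h1 h2 h3 h4 <-]]]]].
exists (dagger F), (dagger F'), (dagger W), (dagger W'); rewrite -!daggerM ?h1 ?h2 ?h3 ?h4 !dagger1.
by rewrite !mulmxA.
Qed.

Lemma steq_dagger q a q' a' (X : 'M[R]_(q, a)) (X' : 'M[R]_(q', a')) :
  steq X X' -> steq (dagger X) (dagger X').
Proof.
move=> [al [be [eta [al' [be' [eta' E]]]]]]; exists al, eta, be, al', eta', be'.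
by rewrite -!dagger_stab; apply: gl_equiv_dagger.
Qed.

Lemma self_absorbing_dagger r q a (X : 'M[R]_(q, a)) :
  self_absorbing r X -> self_absorbing (gbar r) (dagger X).
Proof. by move=> [h hh]; exists (dagger h); rewrite -daggerZ hh !daggerM mulmxA. Qed.

End Dagger.

(** * Direct sums of copies *)

Section Copies.
Context (A : comNzRingType) (Q : nat).

Lemma dsum_copies_col q a (phi : 'M[A]_(q, a)) (v : 'I_Q -> 'cV[A]_a) :
  dsum_copies Q phi *m (\mxcol_(i < Q) v i) = \mxcol_(i < Q) (phi *m v i).
Proof.
rewrite /dsum_copies mul_mxblock_mxrow; apply: eq_mxcol => i.
rewrite [LHS](bigD1 i) //= eqxx big1 ?addr0 // => l li.
by rewrite eq_sym (negbTE li) mul0mx.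
Qed.

Lemma dsum_copiesM q a c (phi : 'M[A]_(q, a)) (psi : 'M[A]_(a, c)) :
  dsum_copies Q phi *m dsum_copies Q psi = dsum_copies Q (phi *m psi).
Proof.
rewrite /dsum_copies mul_mxblock; apply: eq_mxblock => i l.
rewrite [LHS](bigD1 i) //= eqxx big1 ?addr0 => [|x xi].
  by case: eqP; rewrite ?mulmx0.
by rewrite eq_sym (negbTE xi) mul0mx.
Qed.

Lemma dsum_copies_scale r q a (phi : 'M[A]_(q, a)) :
  r *: dsum_copies Q phi = dsum_copies Q (r *: phi).
Proof.
apply/matrixP => i l; rewrite [LHS]mxE [X in _ * X]mxE [RHS]mxE.
by case: eqP => _; rewrite mxE ?mulr0 ?mxE.
Qed.

Lemma self_absorbing_copies r q a (phi : 'M[A]_(q, a)) :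
  self_absorbing r phi -> self_absorbing r (dsum_copies Q phi).
Proof. by move=> [h hh]; exists (dsum_copies Q h); rewrite dsum_copies_scale hh !dsum_copiesM. Qed.

Lemma dsum_copies_image q a (phi : 'M[A]_(q, a)) (V : 'cV[A]_(\sum_(i < Q) q)) :
  (exists w, V = dsum_copies Q phi *m w) <-> forall i, exists w, submxcol V i = phi *m w.
Proof.
split=> [[w ->] i|/boolp.choice[w hw]].
  exists (submxcol w i); rewrite -[X in _ *m X](submxcolK w) dsum_copies_col.
  by rewrite mxcolK.
exists (\mxcol_(i < Q) w i); rewrite dsum_copies_col -[LHS]submxcolK.
by apply: eq_mxcol => i; rewrite hw.
Qed.

Lemma exact_copies q a c (phi : 'M[A]_(q, a)) (psi : 'M[A]_(a, c)) :
  exact_mx phi psi -> exact_mx (dsum_copies Q phi) (dsum_copies Q psi).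
Proof.
move=> [phipsi ex]; split=> [|V].
  rewrite dsum_copiesM phipsi; apply/matrixP => i l; rewrite mxE [RHS]mxE.
  by case: eqP; rewrite mxE.
rewrite -[X in _ *m X](submxcolK V) dsum_copies_col => e.
apply/dsum_copies_image => i; apply: ex.
by rewrite -[LHS](mxcolK (fun i => phi *m submxcol V i)) e submxcol0.
Qed.

End Copies.

Lemma dagger_copies (k : comNzRingType) (G : zmodType) Q q a (phi : 'M[galg k G]_(q, a)) :
  dagger (dsum_copies Q phi) = dsum_copies Q (dagger phi).
Proof.
apply/matrixP => i j; rewrite mxE mxE mxE [RHS]mxE eq_sym.
by case: eqP => _; [rewrite mxE mxE | rewrite !mxE raddf0].
Qed.

Lemma mx_eq0_cols (A : comNzRingType) m n (X : 'M[A]_(m, n)) :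
  (forall v : 'cV_n, X *m v = 0) -> X = 0.
Proof.
move=> h; apply/matrixP => i j; have /colP/(_ i) := h (delta_mx j 0).
by rewrite -colE !mxE.
Qed.

(** * Kernels and images under coarse graining *)

Section CoarseExact.
Context (k : comNzRingType) (G : zmodType) (L : zmodClosed G).
Context (n : nat) (u : 'I_n -> G) (hu : coset_reps L u).
Local Notation R := (galg k G).
Local Notation A := (galg k (sublattice L)).

Lemma restrict0 q : restrict L u (0 : 'cV[R]_q) = 0.
Proof. by have := restrictD L u (0 : 'cV[R]_q) 0; rewrite addr0 => /eqP; rewrite -subr_eq0 opprD addrA subrr sub0r oppr_eq0 => /eqP. Qed.

Lemma restrict_comb (I : finType) q (a : I -> A) (v : I -> 'cV[R]_q) :
  restrict L u (\sum_x galg_incl (a x) *: v x) = \sum_x a x *: restrict L u (v x).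
Proof.
rewrite (big_morph (@restrict k G L n u q) (restrictD L u (q := q)) (restrict0 q)).
by apply: eq_bigr => x _; rewrite restrictZ.
Qed.

Lemma coarse_eq0 q a (phi : 'M[R]_(q, a)) v : coarse L u phi *m restrict L u v = 0 <-> phi *m v = 0.
Proof.
rewrite coarse_restrict //; split=> [e|->]; last exact: restrict0.
by rewrite -[LHS](restrictK hu) e -[X in unrestrict u X](@restrict0 q) restrictK.
Qed.

Lemma coarse_image q a (phi : 'M[R]_(q, a)) v :
  (exists w, restrict L u v = coarse L u phi *m w) <-> exists w, v = phi *m w.
Proof.
split=> [[w e]|[w ->]]; last by exists (restrict L u w); rewrite coarse_restrict.
exists (unrestrict u w); rewrite -[LHS](restrictK hu) e -[X in _ *m X](unrestrictK hu).
by rewrite coarse_restrict // restrictK.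
Qed.

Lemma exact_coarse q a c (phi : 'M[R]_(q, a)) (psi : 'M[R]_(a, c)) :
  exact_mx phi psi -> exact_mx (coarse L u phi) (coarse L u psi).
Proof.
move=> [phipsi ex]; split=> [|V].
  apply: mx_eq0_cols => V; rewrite -(unrestrictK hu V) -mulmxA !coarse_restrict //.
  by rewrite mulmxA phipsi mul0mx restrict0.
by rewrite -(unrestrictK hu V) => /coarse_eq0/ex/coarse_image.
Qed.

End CoarseExact.

(** * Both implications, for a fixed resolution over R *)

Section Main.
Context (k : comNzRingType) (G : zmodType) (L : zmodClosed G).
Context (N : nat) (u : 'I_N -> G) (hu : coset_reps L u).
Context (D : nat) (y : 'I_D -> sublattice L) (hy : zbasis y).
Local Notation R := (galg k G).
Local Notation A := (galg k (sublattice L)).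
Local Notation koszul := (koszul_d (ygen k y)).

Context (n : nat -> nat) (rho : forall i, 'M[R]_(n i.+1, n i)).
Context (rho_exact : row_exact rho).
Context (phi : 'M[R]_(n 0%N, n 1%N)) (phiE : dagger phi = rho 0%N).
Local Notation Mbar := (conjmod (coker_mx phi)).

Lemma rho_rho i : rho i.+1 *m rho i = 0.
Proof.
apply/row_matrixP => l; rewrite row_mul row0; apply/rho_exact.
by exists (delta_mx 0 l); rewrite rowE.
Qed.

(** The dagger conjugates scalars, so this map is linear into the conjugate module; as [rho 0] is
    [dagger phi], it augments [rho] to a resolution of the conjugate cokernel. *)
Definition conj_proj (w : 'rV[R]_(n 0%N)) : Mbar := qproj _ (dagger w).

Lemma conj_proj_is_linear : linear conj_proj.
Proof.
move=> a v w; rewrite /conj_proj daggerD daggerZ raddfD; congr (_ + _).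
exact: qproj_is_scalable.
Qed.

HB.instance Definition _ := GRing.isLinear.Build R 'rV[R]_(n 0%N) Mbar *:%R
  conj_proj conj_proj_is_linear.

Lemma conj_proj_surj (m : Mbar) : exists w, conj_proj w = m.
Proof.
have [v ->] := qproj_surj (m : coker_mx phi).
by exists (dagger v); rewrite /conj_proj daggerK.
Qed.

Lemma conj_proj_ker w : conj_proj w = 0 <-> exists z, w = z *m rho 0.
Proof.
rewrite -phiE.
have -> : conj_proj w = 0 <-> exists z, dagger w = phi *m z.
  split=> [e|[z e]].
    have /qprojP : qproj (im_pred (mulmx phi : {linear 'cV_(n 1%N) -> 'cV_(n 0%N)})) (dagger w) = qproj _ 0.
      by rewrite raddf0.
    by rewrite subr0 => /boolp.asboolP.
  rewrite /conj_proj -[RHS](raddf0 (qproj (im_pred (mulmx phi : {linear 'cV_(n 1%N) -> 'cV_(n 0%N)})))).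
  by apply/qprojP; rewrite subr0; apply/boolp.asboolP; exists z.
split=> -[z e]; exists (dagger z); last by rewrite e daggerM daggerK.
by rewrite -daggerM -e daggerK.
Qed.

Section Theta.
Context (i : nat) (theta : 'cV[R]_(n i.+1) -> ext_coker i.+1 phi).
Hypothesis thetaP : forall a v w, rho i.+1 *m v = 0 -> rho i.+1 *m w = 0 ->
  theta (a *: v + w) = a *: theta v + theta w.
Hypothesis theta_ker : forall v, rho i.+1 *m v = 0 -> theta v = 0 <-> exists w, v = rho i *m w.

Lemma theta0 : theta 0 = 0.
Proof. by apply/theta_ker; [rewrite mulmx0 | exists 0; rewrite mulmx0]. Qed.

Lemma thetaZ a v : rho i.+1 *m v = 0 -> theta (a *: v) = a *: theta v.
Proof. by move=> hv; rewrite -[a *: v]addr0 thetaP ?mulmx0 // theta0 addr0. Qed.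

Lemma theta_comb Q (a : 'I_Q -> R) (v : 'I_Q -> 'cV[R]_(n i.+1)) :
  (forall x, rho i.+1 *m v x = 0) ->
  rho i.+1 *m (\sum_x a x *: v x) = 0 /\
  theta (\sum_x a x *: v x) = \sum_x a x *: theta (v x).
Proof.
move=> hv; elim/big_rec2: _ => [|x s t _ [h1 h2]]; first by rewrite mulmx0 theta0.
split; last by rewrite thetaP ?h2.
by rewrite mulmxDr -scalemxAr hv h1 scaler0 addr0.
Qed.

End Theta.

Lemma exists_theta i : exists theta : 'cV[R]_(n i.+1) -> ext_coker i.+1 phi,
  [/\ forall a v w, rho i.+1 *m v = 0 -> rho i.+1 *m w = 0 ->
        theta (a *: v + w) = a *: theta v + theta w,
      forall v, rho i.+1 *m v = 0 -> theta v = 0 <-> exists w, v = rho i *m w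
    & forall e, exists2 v, rho i.+1 *m v = 0 & theta v = e].
Proof. exact: (Ext_matrix conj_proj_surj conj_proj_ker rho_exact). Qed.

Lemma exact_of_vanish i : (forall e : ext_coker i.+1 phi, e = 0) ->
  exact_mx (rho i.+1) (rho i).
Proof.
move=> h; split=> [|v hv]; first exact: rho_rho.
have [theta [_ ker _]] := exists_theta i.
by apply/(ker v hv)/h.
Qed.

Local Notation crho i := (coarse L u (rho i)).

Lemma koszul_exactness i : exact_mx (koszul i.+1) (koszul i.+2).
Proof. apply: koszul_exact => o be g; exact: ygen_regular_seq. Qed.

Lemma koszul1_image (v : 'cV[A]_(#|ext_basis D 0|)) :
  (exists w, v = koszul 1 *m w) <-> (forall t, in_ideal y D (v t 0)).
Proof.
rewrite koszul_d1_image; split=> h t; apply/in_idealE; exact: h.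
Qed.

(** The scalar lies in the augmentation ideal, the image of the first differential, so it factors
    through that differential; exactness carries the relation up. *)
Lemma self_absorbing_koszul l i : self_absorbing (gmonom 1 l - 1) (koszul i.+1).
Proof.
elim: i => [|i]; last exact: self_absorbing_exact (koszul_exactness i).
have [h hh] : exists h, (gmonom 1 l - 1)%:M = koszul 1 *m h.
  apply: image_cols => s; apply/koszul1_image => t; rewrite !mxE.
  rewrite -mulr_natr mulrC; apply: in_idealM; exact: monom_in_ideal.
by exists h; rewrite -hh mul_scalar_mx.
Qed.

Lemma dagger_exact i : exact_mx (dagger (rho i)) (dagger (rho i.+1)).
Proof.
split=> [|v hv]; first by rewrite -daggerM rho_rho dagger0.
have /rho_exact[z hz] : dagger v *m rho i = 0 by rewrite -[LHS]daggerK daggerM daggerK hv dagger0.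
by exists (dagger z); rewrite -daggerM -hz daggerK.
Qed.

(** With r the scalar of the hypothesis, [r - h d] factors through the next differential. The dagger
    of this identity, applied to a cocycle, exhibits the conjugate of r times it as a coboundary;
    hence the opposite sign of [l] in the hypothesis. *)
Lemma self_absorbing_kills j l :
  (forall i, self_absorbing (gmonom 1 (- l) - 1) (coarse L u (dagger (rho i)))) ->
  forall e : ext_coker j.+1 phi, galg_incl (gmonom 1 l - 1) *: e = 0.
Proof.
move=> sa e; have [theta [lin ker surj]] := exists_theta j.
have [v hv <-] := surj e; rewrite -(thetaZ lin ker) //.
apply/ker; first by rewrite -scalemxAr hv scaler0.
have [h hh] := sa j.
have [|h' hh'] := exact_mx_lift (V := (gmonom 1 (- l) - 1)%:M - h *m coarse L u (dagger (rho j)))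
    (exact_coarse hu (dagger_exact j)).
  by rewrite mulmxBr mul_mx_scalar hh mulmxA subrr.
have bar : gbar (gmonom 1 (- l) - 1) = gmonom 1 l - 1 :> A.
  by rewrite gbar_monomB1 opprK.
have := congr1 (@dagger k (sublattice L) _ _) hh'.
rewrite -scalemx1 daggerB daggerZ dagger1 bar !daggerM !dagger_coarse !daggerK.
move=> /(congr1 (mulmx^~ (restrict L u v))); rewrite mulmxBl -scalemxAl mul1mx -!mulmxA.
have -> : crho j.+1 *m restrict L u v = 0 by apply/(coarse_eq0 hu).
rewrite mulmx0 => /eqP; rewrite subr_eq0 => /eqP E.
apply/(coarse_image hu); exists (dagger h *m restrict L u v); rewrite -E.
exact: restrictZ.
Qed.

Lemma stable_equiv_trivial_action j Q :
  stable_cl_equiv (coarse L u phi) (dsum_copies Q (toricX k y j.+1)) ->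
  forall v, v \in L -> stabilizer (ext_coker j.+1 phi) v.
Proof.
move=> E v vL e; pose l : sublattice L := Sub v vL.
have incl : galg_incl (gmonom 1 l - 1) = gmonom 1 v - 1 :> R.
  exact: gpush_monomB1.
apply/eqP; rewrite -subr_eq0 -[X in _ - X]scale1r -scalerBl -incl; apply/eqP.
apply: self_absorbing_kills; elim=> [|i IH]; last first.
  exact: self_absorbing_exact (exact_coarse hu (dagger_exact i)) IH.
rewrite -phiE daggerK; apply: self_absorbing_stable E _.
apply: self_absorbing_copies; rewrite /toricX.
rewrite -[X in self_absorbing X](gbar_monomB1 k l).
exact/self_absorbing_dagger/self_absorbing_koszul.
Qed.

(** * Trivial action gives equivalence; E is Ext in degree [j.+1], between [rho j] and [rho j.+1] *)

Section Backward.
Context (j Q : nat).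
Hypothesis vanish : forall i, i <> j -> forall e : ext_coker i.+1 phi, e = 0.
Hypothesis dimE : has_kdim (ext_coker j.+1 phi) Q.
Hypothesis trivial_action : forall v, v \in L -> stabilizer (ext_coker j.+1 phi) v.
Hypothesis n_fin : exists m, forall i, (m <= i)%N -> n i = 0%N.

Lemma exact_crho i : i <> j -> exact_mx (crho i.+1) (crho i).
Proof. by move=> ij; apply: exact_coarse => //; apply/exact_of_vanish/vanish. Qed.

Lemma crho_stably_free : stably_free_kernel (crho j.+1).
Proof.
have [m n0] := n_fin.
apply: (@stably_free_kernel_tail _ (fun i => \sum_(x < n i) N)%N (fun i => crho i) j.+1 m).
  by move=> i ji; apply: exact_crho => e; rewrite e ltnn in ji.
by move=> i /n0 ->; rewrite big_ord0.
Qed.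

Lemma ideal_acts_trivially s (e : ext_coker j.+1 phi) : in_ideal y D s -> galg_incl s *: e = 0.
Proof.
move=> [g ->]; rewrite galg_inclE raddf_sum scaler_suml big1 // => l _.
rewrite [X in X *: _](rmorphM (gpush \val)) mulrC -scalerA /ygen.
rewrite [X in _ *: (X *: _)](gpush_monomB1 k \val) scalerBl scale1r.
by rewrite (trivial_action (valP (y l))) subrr scaler0.
Qed.

Lemma augmentation_acts (s : A) (e : ext_coker j.+1 phi) :
  galg_incl s *: e = gmonom (augmentation s) 0 *: e.
Proof.
have := ideal_acts_trivially e (sub_augmentation hy s).
rewrite galg_inclE raddfB /= gpushU raddf0 scalerBl => /eqP.
by rewrite subr_eq0 => /eqP.
Qed.

(** The generators are cocycles lifting a basis of E. Scalars act through the augmentation, so a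
    combination vanishes in E exactly when each coefficient lies in the augmentation ideal, the
    image of the first Koszul differential. *)
Lemma steq_crho_koszul1 : steq (crho j) (dsum_copies Q (koszul 1)).
Proof.
have [theta [lin ker surj]] := exists_theta j.
have [b hb] := dimE.
have /boolp.choice[v hv] x : exists w, rho j.+1 *m w = 0 /\ theta w = b x.
  by have [w] := surj (b x); exists w.
have v0 x : rho j.+1 *m v x = 0 by case: (hv x).
have vb x : theta (v x) = b x by case: (hv x).
pose m0 := #|ext_basis D 0|.
have m0_eq (t t' : 'I_m0) : t = t'.
  apply: enum_val_inj; have := enum_valP t; have := enum_valP t'.
  by rewrite !inE !cards_eq0 => /eqP -> /eqP ->.
have sum1 (F : 'I_m0 -> A) t : \sum_t' F t' = F t.
  by rewrite (big_pred1 t) // => t'; rewrite (m0_eq t' t) /= eqxx.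
have t0 : 'I_m0.
  rewrite /m0 (_ : ext_basis D 0 = [set set0]) ?cards1; first exact: ord0.
  by apply/setP => S; rewrite !inE cards_eq0.
(* [m0] equals 1 without being convertible to it: the sum reads off the only entry, and [const_mx 1]
   in [e] plays the 1 by 1 identity. *)
pose tot (c : 'cV[A]_(\sum_(x < Q) m0)) (x : 'I_Q) := \sum_t submxcol c x t 0.
pose e : 'M[A]_(\sum_(x < n j.+1) N, \sum_(x < Q) m0) :=
  \mxrow_(x < Q) (restrict L u (v x) *m const_mx 1).
have eE c : e *m c = restrict L u (\sum_x galg_incl (tot c x) *: v x).
  rewrite -[c in LHS]submxcolK mul_mxrow_mxcol.
  rewrite restrict_comb //.
  apply: eq_bigr => x _; rewrite -mulmxA.
  have -> : const_mx 1 *m submxcol c x = (tot c x)%:M :> 'M_1.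
    apply/matrixP => i i'; rewrite !ord1 [RHS]mxE eqxx mulr1n mxE.
    by apply: eq_bigr => t _; rewrite mxE mul1r.
  by rewrite mul_mx_scalar.
apply: (@steq_stably_free _ _ _ _ _ _ (crho j.+1) _ e) crho_stably_free _ _.
- by apply: mx_eq0_cols => V; rewrite -(unrestrictK hu V) -mulmxA !coarse_restrict // mulmxA rho_rho mul0mx restrict0.
- apply: mx_eq0_cols => c; rewrite -mulmxA eE; apply/(coarse_eq0 hu).
  by case: (theta_comb lin ker (fun x => galg_incl (tot c x)) v0).
- move=> V; rewrite -(unrestrictK hu V) => /(coarse_eq0 hu); move: (unrestrict u V) => {V}w hw.
  have [c [hc _]] := hb (theta w).
  have [c0 cth] := theta_comb lin ker (fun x => gmonom (c x) 0 : R) v0.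
  pose s := \sum_x (gmonom (c x) 0 : R) *: v x.
  have ws : rho j.+1 *m (- 1 *: s + w) = 0.
    by rewrite mulmxDr -scalemxAr c0 hw scaler0 addr0.
  have [|z hz] := (ker _ ws).1.
    rewrite lin // cth hc scaleN1r; under eq_bigr do rewrite vb.
    by rewrite addNr.
  exists (\mxcol_(x < Q) const_mx (gmonom (c x) 0)), (restrict L u z).
  rewrite eE coarse_restrict // -hz -restrictD; congr (restrict _ _ _).
  have -> : \sum_x galg_incl (tot (\mxcol_(x < Q) const_mx (gmonom (c x) 0)) x) *: v x = s.
    apply: eq_bigr => x _; rewrite /tot mxcolK (sum1 _ t0) mxE; congr (_ *: _).
    by rewrite galg_inclE gpushU raddf0.
  by rewrite scaleN1r addNKr.
- move=> c; rewrite eE.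
  have -> : (exists z, c = dsum_copies Q (koszul 1) *m z) <-> forall x, in_ideal y D (tot c x).
    rewrite dsum_copies_image; split=> h x; have := h x.
      move/koszul1_image => h'; rewrite /tot; apply: in_ideal_sum => t _; exact: h'.
    by move=> h'; apply/koszul1_image => t; rewrite -(sum1 (fun t => submxcol c x t 0) t).
  have [c0 cth] := theta_comb lin ker (fun x => galg_incl (tot c x)) v0.
  rewrite (coarse_image hu) -(ker _ c0) cth.
  have -> : \sum_x galg_incl (tot c x) *: theta (v x) =
      \sum_x gmonom (augmentation (tot c x)) 0 *: b x.
    by apply: eq_bigr => x _; rewrite augmentation_acts vb.
  split=> [e0 x|h]; last first.
    rewrite [LHS]big1 // => x _; rewrite -augmentation_acts.
    exact: ideal_acts_trivially.
  have [c' [hc' uc']] := hb 0.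
  have a0 : augmentation (tot c x) = 0.
    have E1 : c' = [ffun=> 0].
      apply: uc'; rewrite big1 // => x' _; rewrite ffunE /gmonom monalgU0 scale0r //.
    have E2 : c' = [ffun x => augmentation (tot c x)].
      by apply: uc'; apply: etrans (esym e0) _; apply: eq_bigr => x' _; rewrite ffunE.
    by move/ffunP/(_ x): E2; rewrite E1 !ffunE.
  by have := sub_augmentation hy (tot c x); rewrite a0 /gmonom monalgU0 subr0.
Qed.

(** Below degree [j] the dual complex is exact, so lowering [l] takes a syzygy there while raising
    [i] takes one in the Koszul complex; [l = 0] reaches [dagger phi]. *)
Lemma steq_crho_koszul i l : (l + i = j)%N -> steq (crho l) (dsum_copies Q (koszul i.+1)).
Proof.
elim: i l => [|i IH] l e.
  by move: e; rewrite addn0 => ->; apply: steq_crho_koszul1.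
apply: (@steq_syzygy _ _ _ _ _ _ _ (crho l.+1) _ (dsum_copies Q (koszul i.+1))).
- apply: exact_crho => lj; move: e; rewrite lj addnS => /eqP.
  by rewrite -[X in _ == X]addn0 -addnS eqn_add2l.
- exact/exact_copies/koszul_exactness.
- by apply: IH; rewrite addSnnS.
Qed.

Lemma trivial_action_stable_equiv :
  stable_cl_equiv (coarse L u phi) (dsum_copies Q (toricX k y j.+1)).
Proof.
apply: steq_stable_cl_equiv.
have := steq_dagger (steq_crho_koszul (add0n j)).
by rewrite dagger_copies dagger_coarse -phiE daggerK.
Qed.

End Backward.
End Main.

Theorem stable_equiv_toric_iff (k : comNzRingType) (G : zmodType) (L : zmodClosed G)
    (N : nat) (u : 'I_N -> G) (D : nat) (y : 'I_D -> sublattice L)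
    (q a j Q : nat) (phi : 'M[galg k G]_(q, a)) :
  regular (galg k G) -> coset_reps L u -> zbasis y ->
  (forall i, i <> j -> forall e : ext_coker i.+1 phi, e = 0) ->
  has_kdim (ext_coker j.+1 phi) Q ->
  stable_cl_equiv (coarse L u phi) (dsum_copies Q (toricX k y j.+1))
  <-> (forall v, v \in L -> stabilizer (ext_coker j.+1 phi) v).
Proof.
move=> regR hu hy vanish dimE.
have [n [rho [eq [ea [e ex fin]]]]] := free_resolution (dagger phi) regR.
move: phi vanish dimE e; case: q / eq; case: a / ea => phi vanish dimE.
rewrite castmx_id => e; split.
  exact: (stable_equiv_trivial_action hu hy ex (esym e)).
move=> triv; exact: (trivial_action_stable_equiv hu hy ex (esym e) vanish dimE triv fin).
Qed.

Theorem corollary4 (p D j q a b Q : nat)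
  (p_prime : prime p) (D_ge2 : (2 <= D)%N) (j_range : (1 <= j <= D - 1)%N)
  (phiX : 'M[laurent p D]_(q, a)) (phiZ : 'M[laurent p D]_(q, b))
  (code_top : topological_css phiX phiZ)
  (Ext_vanish : forall l : nat, (0 < l)%N -> l <> j ->
     forall e : ext_coker l phiX, e = 0)
  (dimE : has_kdim (ext_coker j phiX) Q)
  (Lam : zmodClosed 'rV[int]_D)
  (n : nat) (u : 'I_n -> 'rV[int]_D) (u_reps : coset_reps Lam u)
  (y : 'I_D -> sublattice Lam) (y_basis : zbasis y) :
  stable_cl_equiv (coarse Lam u phiX) (dsum_copies Q (toricX 'F_p y j))
  <-> (forall v : 'rV[int]_D, v \in Lam -> stabilizer (ext_coker j phiX) v).
Proof.
(* The general statement is indexed by the degree minus one. *)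
case: j j_range Ext_vanish dimE => [//|j] _ Ext_vanish dimE.
apply: stable_equiv_toric_iff => //; first exact: laurent_regular.
by move=> i ij; apply: Ext_vanish => // -[].
Qed.
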